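(* Let $G=(V,E)$ be a connected unimodular quasi-transitive graph of maximum degree at most $M$ satisfying $(\mathrm{HK}_{\gamma,c})$ and $(\mathrm{QT}_{r,\varepsilon})$ for some $r<\infty$, $c,\varepsilon>0$ and $\gamma>1/2$. Then for every $0\le\beta<(2\gamma-1)/\gamma$ there exists a constant $K(\beta)=K(\beta,\gamma,c,r,\varepsilon,M)<\infty$ such that \[\mathbf E_p\exp\left[\log^\beta|K_v|\right]\le K(\beta)\] for every $v\in V$ and every $p\le p_c(G)$.
   Context: Percolation: $\omega_p$ is Bernoulli bond percolation (each edge retained independently with probability $p$), with law $\mathbf P_p$, expectation $\mathbf E_p$; $K_v$ is the cluster of $v$; $p_c(G)=\inf\{p:\omega_p\text{ has an infinite cluster a.s.}\}$; $\exp[\log^\beta\infty]=\infty$. Quasi-transitive: $\mathrm{Aut}(G)$ has finitely many orbits on $V$; $[v]$ denotes the orbit of $v$. Unimodular: $|\mathrm{Stab}_u v|=|\mathrm{Stab}_v u|$ whenever $[u]=[v]$. Let $\mathcal O\subseteq V$ be a set containing exactly one vertex of each orbit; for unimodular quasi-transitive $G$ there is a unique probability measure $\mu$ on $\mathcal O$ such that $\sum_{o\in\mathcal O}\mu(o)\sum_{v\in V}F(o,v)=\sum_{o\in\mathcal O}\mu(o)\sum_{v\in V}F(v,o)$ for every $F:V^2\to[0,\infty]$ with $F(\gamma u,\gamma v)=F(u,v)$ for all $\gamma\in\mathrm{Aut}(G)$. $(\mathrm{QT}_{r,\varepsilon})$: $\mu(o)\ge\varepsilon$ for every $o\in\mathcal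 O$, and for every $u,v\in V$ there exist $w\in[u]$, $z\in[v]$ with graph distance $d(w,z)\le r$. $(\mathrm{HK}_{\gamma,c})$: $p_n(v,v)\le\exp[-cn^\gamma]$ for all $v\in V$, $n\ge1$, where $p_n$ is the $n$-step simple random walk transition probability. *)

(* Defs.v *)
From HB Require Import structures.
From mathcomp Require Import all_boot all_order all_algebra.
From mathcomp Require Import finmap.
From mathcomp Require Import all_classical all_reals all_analysis.
Set Implicit Arguments. Unset Strict Implicit. Unset Printing Implicit Defensive.
Import Order.TTheory GRing.Theory Num.Theory.
Local Open Scope classical_set_scope.
Local Open Scope ring_scope.

(* A locally finite simple graph on a countable vertex type V is given by its
   neighbour lists: w is adjacent to u iff w \in nbr u. *)
Section Graph.
Context {V : countType} (nbr : V -> seq V).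

Definition adj (u w : V) : bool := w \in nbr u.

Definition simple_graph : Prop :=
  (forall u, uniq (nbr u)) /\ (forall u, ~~ adj u u) /\
  (forall u w, adj u w = adj w u).

Fixpoint ppath (rel : V -> V -> Prop) (x : V) (s : seq V) : Prop :=
  if s is y :: s' then rel x y /\ ppath rel y s' else True.

Definition connected_graph : Prop :=
  forall u v, exists s, ppath (fun a b => adj a b) u s /\ last u s = v.

Definition max_degree_le (M : nat) : Prop := forall v, (size (nbr v) <= M)%N.

Definition dist_le (w z : V) (r : nat) : Prop :=
  exists s, ppath (fun a b => adj a b) w s /\ last w s = z /\ (size s <= r)%N.

Definition is_aut (g : V -> V) : Prop :=
  bijective g /\ forall u w, adj (g u) (g w) = adj u w.

Definition same_orbit (u v : V) : Prop := exists g, is_aut g /\ g u = v.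

Definition quasi_transitive : Prop :=
  exists s : seq V, forall v, exists o, o \in s /\ same_orbit o v.

Definition stab_orbit (u v : V) : set V :=
  [set w | exists g, is_aut g /\ g u = u /\ g v = w].

Definition unimodular : Prop :=
  forall u v, same_orbit u v -> card_eq (stab_orbit u v) (stab_orbit v u).

Definition orbit_transversal (O : seq V) : Prop :=
  uniq O /\ (forall v, exists o, o \in O /\ same_orbit o v) /\
  (forall o1 o2, o1 \in O -> o2 \in O -> same_orbit o1 o2 -> o1 = o2).

Definition mtp_measure {R : realType} (O : seq V) (mu : V -> R) : Prop :=
  (forall o, o \in O -> 0 <= mu o) /\ (\sum_(o <- O) mu o = 1) /\
  forall F : V -> V -> \bar R,
    (forall u w, (0 <= F u w)%E) ->
    (forall g, is_aut g -> forall u w, F (g u) (g w) = F u w) ->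
    (\sum_(o <- O) ((mu o)%:E * \esum_(w in [set: V]) F o w))%E =
    (\sum_(o <- O) ((mu o)%:E * \esum_(w in [set: V]) F w o))%E.

Definition QT {R : realType} (O : seq V) (mu : V -> R) (r : nat) (eps : R) : Prop :=
  (forall o, o \in O -> eps <= mu o) /\
  forall u v, exists w z, same_orbit u w /\ same_orbit v z /\ dist_le w z r.

Fixpoint rw_p {R : realType} (n : nat) (u w : V) : R :=
  match n with
  | 0 => if u == w then 1 else 0
  | n'.+1 => \sum_(x <- nbr u) (rw_p n' x w / (size (nbr u))%:R)
  end.

Definition HK {R : realType} (gamma c : R) : Prop :=
  forall (v : V) (n : nat), (1 <= n)%N ->
    @rw_p R n v v <= expR (- (c * (n%:R `^ gamma))).

(* edges: unordered pairs {u,w}, represented canonically by the ordered pair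
   with smaller pickle code first *)
Definition Edge := {e : V * V | adj (fst e) (snd e) && (choice.pickle (fst e) < choice.pickle (snd e))%N}.

Definition edge_open (om : Edge -> bool) (u w : V) : Prop :=
  exists e : Edge, om e /\ (val e = (u, w) \/ val e = (w, u)).

Definition cluster (om : Edge -> bool) (v : V) : set V :=
  [set w | exists s, ppath (edge_open om) v s /\ last v s = w].

Definition cluster_size {R : realType} (om : Edge -> bool) (v : V) : \bar R :=
  if `[< finite_set (cluster om v) >] then ((#|` fset_set (cluster om v)|)%fset%:R)%:E
  else (+oo)%E.

(* omega : Omega -> Edge -> bool is Bernoulli(p) bond percolation under P:
   the edge states are measurable and i.i.d. Bernoulli(p) (all finite-dimensional
   distributions are product ones). *)
Definition bernoulli_perc {R : realType} (p : R) {d : measure_display}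
  {Omega : measurableType d} (P : probability Omega R) (omega : Omega -> Edge -> bool)
  : Prop :=
  (forall e, measurable [set x | omega x e]) /\
  forall (F : seq Edge) (b : Edge -> bool), uniq F ->
    P [set x | forall e, e \in F -> omega x e = b e] =
    (\prod_(e <- F) (if b e then p else 1 - p))%:E.

Definition percolates {R : realType} (p : R) : Prop :=
  forall (d : measure_display) (Omega : measurableType d)
    (P : probability Omega R) (omega : Omega -> Edge -> bool),
    bernoulli_perc p P omega ->
    P [set x | exists v, ~ finite_set (cluster (omega x) v)] = 1%E.

(* p_c = inf {p in [0,1] : percolates p}, with inf of the empty set = 1 *)
Definition p_c {R : realType} : R :=
  inf ([set p : R | 0 <= p <= 1 /\ percolates p] `|` [set 1]).

End Graph.

Definition exp_log_pow {R : realType} (beta : R) (x : \bar R) : \bar R :=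
  match x with
  | r%:E => (expR ((ln r) `^ beta))%:E
  | +oo => +oo
  | -oo => 0
  end%E.

(* Main.v *)
(* Following Hutchcroft, one compares the tails of |K_v| at two scales n and n^C. Two facts are
   combined. First, the two-ghost inequality: if e = xy is closed and joins two distinct finite
   clusters of at least n vertices, then opening e merges them; weighting clusters by
   psi(k) = 1 - lam^k and using mass transport, the probability of this event is bounded by the
   mean fluctuation of the number of open edges touching a cluster, a martingale-type quantity
   of order n^(-const). Second, for moderately large clusters n <= |K| < n^C, let t_m be the
   mass-transport average of sum_w p_m(o, w) P(o <-> w). Mass transport and Cauchy-Schwarz give
   t_m^2 <= t_0 t_(2m), so the heat kernel bound forces t_m to be small: two vertices at
   distance m, both in clusters larger than n, are then typically in different clusters. If the
   tail at scale n were at least exp(-log^b n), Harris' inequality would make both endpoints of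
   some walk of length m lie in large clusters, and the two-ghost bound would fail unless the
   tail at scale n^C is at least exp(-log^b n^C). Iterating contradicts the finite expected
   cluster size which holds for p < p_c by sharpness (Duminil-Copin and Tassion); the resulting
   bound does not depend on that expectation and extends to p = p_c by continuity of
   probabilities of local events. *)
Require Import Defs.
From HB Require Import structures.
From mathcomp Require Import all_boot all_order all_algebra finmap.
From mathcomp Require Import all_classical all_reals all_analysis.
From mathcomp Require Import measurable_realfun.
From mathcomp Require Import ring lra zify.
Set Implicit Arguments. Unset Strict Implicit. Unset Printing Implicit Defensive.
Import Order.TTheory GRing.Theory Num.Theory.
Import numFieldNormedType.Exports.
Local Open Scope classical_set_scope.
Local Open Scope ring_scope.

(** * Product measures on cylinder functions *)

(** Every estimate is made on functions of finitely many edges, where expectation is a finite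
    weighted sum; a probability space enters only to exploit [percolates] and in the final integral.
    This is possible because [N <= |K_v|] is decided inside the ball of radius [N], and because
    clusters are cut off at a size [r] whose cost is a multiple of [B / r], with [B] a bound on the
    expected cluster size. Letting [r] grow while [n] is fixed removes this cost, so the
    uncontrolled [B] leaves no trace in the constants. Joining two vertices at distance [m] by
    opening edges costs [p ^ -m], while the two-ghost bound gains only a power of [n]. Hence [m] can
    be at most a multiple of [ln n], and it is this restriction that produces the exponent
    [2 - 1 / gamma]. It also requires a lower bound on [p]; for [p <= 1 / (2 M)] the expected
    cluster size is at most 2 and Markov's inequality suffices. The two-ghost inequality is used for
    clusters of size [n ^ 8] with [lam = 1 - n ^ -8], [k = n ^ 4] and [eta = 1 / n]: then a cluster
    of that size meets a ghost with probability at least [1 / 2], while all terms of [Phi] are of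
    order at most [1 / n]. *)

Section Cylinder.
Context {R : realType} {T : eqType}.
Implicit Types (p : R) (L : seq T) (om : T -> bool) (f g : (T -> bool) -> R).

Definition upd om e b : T -> bool := fun x => if x == e then b else om x.

Lemma upd_upd om e b b' : upd (upd om e b) e b' = upd om e b'.
Proof. by apply/funext => x; rewrite /upd; case: eqP. Qed.

Lemma updC om e e' b b' : e != e' ->
  upd (upd om e b) e' b' = upd (upd om e' b') e b.
Proof.
move=> ne; apply/funext => x; rewrite /upd; case: (x =P e') => // ->.
by rewrite eq_sym (negbTE ne).
Qed.

Lemma upd_id om e : upd om e (om e) = om.
Proof. by apply/funext => x; rewrite /upd; case: eqP => [->|]. Qed.

Lemma upd_same om e b : upd om e b e = b.
Proof. by rewrite /upd eqxx. Qed.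

Lemma upd_other om e b x : x != e -> upd om e b x = om x.
Proof. by rewrite /upd => /negbTE ->. Qed.

Record dep {X} (D : pred T) (f : (T -> bool) -> X) : Prop := Dep {
  depP : forall om om', (forall e, D e -> om e = om' e) -> f om = f om' }.

Definition cyl {X} (f : (T -> bool) -> X) := exists L, dep [pred e in L] f.

Lemma dep_sub X (D D' : pred T) (f : (T -> bool) -> X) :
  dep D f -> (forall e, D e -> D' e) -> dep D' f.
Proof. by move=> [Df] DD'; split=> om om' H; apply: Df => e /DD'; apply: H. Qed.

(** The configuration equal to [om] on [D] and to [om'] off [D] interpolates between the two. In
    [E_indep] this cuts an infinite dependence set, such as all edges off a cluster, down to a
    finite list. *)
Lemma dep_cap X (D D' : pred T) (f : (T -> bool) -> X) :
  dep D f -> dep D' f -> dep (fun e => D e && D' e) f.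
Proof.
move=> [Df] [Df']; split=> om om' H.
transitivity (f (fun e => if D e then om e else om' e)).
  by apply: Df => e ->.
apply: Df' => e D'e; case: ifP => // De.
by apply: H; rewrite De D'e.
Qed.

Lemma dep_upd X (D : pred T) (f : (T -> bool) -> X) om e b :
  dep D f -> ~~ D e -> f (upd om e b) = f om.
Proof.
move=> [Df] nDe; apply: Df => x Dx; apply: upd_other.
by apply: contraNneq nDe => <-.
Qed.

(** Conditional expectation given the coordinates outside [L], which stay frozen at [om].
    Repetitions in [L] are harmless, since a later update overwrites an earlier one, so lists can be
    concatenated freely. *)
Fixpoint Ex p L f om : R :=
  if L is e :: L' then
    p * Ex p L' f (upd om e true) + (1 - p) * Ex p L' f (upd om e false)
  else f om.

Lemma ExD p L f g om : Ex p L (fun x => f x + g x) om = Ex p L f om + Ex p L g om.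
Proof. by elim: L om => //= e L IH om; rewrite !IH; ring. Qed.

Lemma ExZ p L a f om : Ex p L (fun x => a * f x) om = a * Ex p L f om.
Proof. by elim: L om => //= e L IH om; rewrite !IH; ring. Qed.

Lemma Ex_cst p L a om : Ex p L (fun=> a) om = a.
Proof. by elim: L om => //= e L IH om; rewrite !IH; ring. Qed.

Lemma Ex_le p L f g om : 0 <= p <= 1 -> (forall x, f x <= g x) ->
  Ex p L f om <= Ex p L g om.
Proof.
move=> /andP[p0 p1] fg; elim: L om => //= e L IH om.
by apply: lerD; apply: ler_wpM2l; rewrite ?subr_ge0.
Qed.

Lemma eq_Ex p L f g om : (forall x, f x = g x) -> Ex p L f om = Ex p L g om.
Proof. by move=> fg; congr Ex; apply/funext. Qed.

Lemma Ex_cat p L L' f om : Ex p (L ++ L') f om = Ex p L (Ex p L' f) om.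
Proof. by elim: L om => //= e L IH om; rewrite !IH. Qed.

Lemma Ex_swap p e e' L f om : Ex p [:: e, e' & L] f om = Ex p [:: e', e & L] f om.
Proof.
case: (eqVneq e e') => [->//|ne] /=.
rewrite !(@updC om e' e) 1?eq_sym //; ring.
Qed.

Lemma Ex_consC p e L f om : Ex p (e :: L) f om = Ex p (rcons L e) f om.
Proof.
elim: L om => // e' L IH om; rewrite Ex_swap.
by rewrite rcons_cons [LHS]/= [RHS]/= -!IH.
Qed.

Lemma ExC p L L' f om : Ex p (L ++ L') f om = Ex p (L' ++ L) f om.
Proof.
elim: L om => [|e L IH] om; first by rewrite cats0.
rewrite -cat_rcons [RHS]Ex_cat -Ex_consC -Ex_cat /=.
by rewrite !IH.
Qed.

Lemma Ex_mull p D L f g om : dep D f -> {in L, forall e, ~~ D e} ->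
  Ex p L (fun x => f x * g x) om = f om * Ex p L g om.
Proof.
move=> Df; elim: L om => //= e L IH om nD.
have nDL : {in L, forall e, ~~ D e} by move=> x xL; apply: nD; rewrite inE xL orbT.
rewrite !IH // !(dep_upd _ _ Df) ?nD ?mem_head //; ring.
Qed.

Lemma Ex_id p D L f om : dep D f -> {in L, forall e, ~~ D e} -> Ex p L f om = f om.
Proof.
move=> Df nD; rewrite -[RHS]mulr1 -(Ex_cst p L 1 om) -(Ex_mull _ _ _ Df nD).
by apply: eq_Ex => x; rewrite mulr1.
Qed.

Lemma Ex_dep p D L f : dep D f -> dep (fun e => D e && (e \notin L)) (Ex p L f).
Proof.
move=> [Df]; elim: L => [|e L [IH]]; split=> om om' H /=.
  by apply: Df => e De; apply: H; rewrite De.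
by congr (_ * _ + _ * _); apply: IH => x /andP[Dx xL]; rewrite /upd; case: eqP => // /eqP xe;
  apply: H; rewrite Dx inE negb_or xe.
Qed.

(** Averaging over a list that covers the support leaves a constant. Averaging each of the two
    constants over the other list changes nothing, and the two double averages agree by [ExC]. This
    makes [E] well defined. *)
Lemma Ex_indep p L L' f om om' : dep [pred e in L] f -> dep [pred e in L'] f ->
  Ex p L f om = Ex p L' f om'.
Proof.
move=> dL dL'.
have c1 : dep pred0 (Ex p L f).
  by apply: (dep_sub (Ex_dep p L dL)) => e /=; rewrite andbN.
have c2 : dep pred0 (Ex p L' f).
  by apply: (dep_sub (Ex_dep p L' dL')) => e /=; rewrite andbN.
transitivity (Ex p L f om'); first exact: (depP c1).
rewrite -[LHS](Ex_id p (L:=L') om' c1) // -[RHS](Ex_id p (L:=L) om' c2) //.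
by rewrite -!Ex_cat ExC.
Qed.

Definition supp f : seq T := if pselect (cyl f) is left H then projT1 (cid H) else [::].

(* Junk unless [f] is a cylinder function; then the chosen support is irrelevant ([E_Ex]). *)
Definition E p f : R := Ex p (supp f) f (fun=> false).

Lemma E_Ex p L f om : dep [pred e in L] f -> E p f = Ex p L f om.
Proof.
move=> dL; rewrite /E /supp; case: pselect => [H|[]]; last by exists L.
by case: cid => L' dL' /=; apply: Ex_indep.
Qed.

Lemma cyl_cst X (a : X) : cyl (fun=> a).
Proof. by exists [::]; split. Qed.

Lemma cyl_comp X Y (h : X -> Y) (f : (T -> bool) -> X) : cyl f -> cyl (fun om => h (f om)).
Proof. by move=> [L dL]; exists L; split=> om om' H; rewrite (depP dL H). Qed.

Lemma cyl_comp2 X Y Z (h : X -> Y -> Z) (f : (T -> bool) -> X) (g : (T -> bool) -> Y) :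
  cyl f -> cyl g -> cyl (fun om => h (f om) (g om)).
Proof.
move=> [L dL] [L' dL']; exists (L ++ L'); split=> om om' H.
by congr h; [apply: (depP dL)|apply: (depP dL')] => e eL; apply: H; rewrite /= mem_cat (eL : e \in _) ?orbT.
Qed.

Lemma cyl_sum (I : Type) (s : seq I) (P : pred I) (f : I -> (T -> bool) -> R) :
  (forall i, cyl (f i)) -> cyl (fun om => \sum_(i <- s | P i) f i om).
Proof.
move=> cf; elim: s => [|i s IH].
  by under eq_fun do rewrite big_nil; apply: cyl_cst.
under eq_fun do rewrite big_cons; case: (P i) => //; exact: cyl_comp2.
Qed.

Lemma cyl_upd X (f : (T -> bool) -> X) e b : cyl f -> cyl (fun om => f (upd om e b)).
Proof.
move=> [L dL]; exists L; split=> om om' H; apply: (depP dL) => x xL.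
by rewrite /upd; case: eqP => // _; apply: H.
Qed.

Lemma cyl_joint f g : cyl f -> cyl g ->
  exists L, dep [pred e in L] f /\ dep [pred e in L] g.
Proof.
move=> [L dL] [L' dL']; exists (L ++ L'); split.
  by apply: (dep_sub dL) => e /= eL; rewrite mem_cat eL.
by apply: (dep_sub dL') => e /= eL; rewrite mem_cat eL orbT.
Qed.

Lemma dep_op (D : pred T) (X Y Z : Type) (h : X -> Y -> Z) (f : (T -> bool) -> X) (g : (T -> bool) -> Y) :
  dep D f -> dep D g -> dep D (fun om => h (f om) (g om)).
Proof. by move=> [df] [dg]; split=> om om' H; rewrite (df _ _ H) (dg _ _ H). Qed.

Lemma dep_comp (D : pred T) (X Y : Type) (h : X -> Y) (f : (T -> bool) -> X) :
  dep D f -> dep D (fun om => h (f om)).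
Proof. by move=> [df]; split=> om om' H; rewrite (df _ _ H). Qed.

Lemma eq_E p f g : (forall x, f x = g x) -> E p f = E p g.
Proof. by move=> fg; congr E; apply/funext. Qed.

Lemma E_cst p a : E p (fun=> a) = a.
Proof. by rewrite (@E_Ex _ [::] _ (fun=> false)). Qed.

Lemma ED p f g : cyl f -> cyl g -> E p (fun x => f x + g x) = E p f + E p g.
Proof.
move=> cf cg; have [L [df dg]] := cyl_joint cf cg.
by rewrite !(@E_Ex _ L _ (fun=> false)) // ?ExD //; apply: (dep_op +%R).
Qed.

Lemma EZ p a f : cyl f -> E p (fun x => a * f x) = a * E p f.
Proof.
by move=> [L dL]; rewrite !(@E_Ex _ L _ (fun=> false)) // ?ExZ //; split=> om om' /(depP dL) ->.
Qed.

Lemma EN p f : cyl f -> E p (fun x => - f x) = - E p f.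
Proof.
by move=> cf; rewrite -mulN1r -EZ //; apply: eq_E => x; rewrite mulN1r.
Qed.

Lemma EB p f g : cyl f -> cyl g -> E p (fun x => f x - g x) = E p f - E p g.
Proof. by move=> cf cg; rewrite ED ?EN //; apply: cyl_comp. Qed.

Lemma E_sum p (I : Type) (s : seq I) (P : pred I) (f : I -> (T -> bool) -> R) :
  (forall i, cyl (f i)) ->
  E p (fun om => \sum_(i <- s | P i) f i om) = \sum_(i <- s | P i) E p (f i).
Proof.
move=> cf; elim: s => [|i s IH].
  by rewrite big_nil -[RHS](E_cst p); apply: eq_E => om; rewrite big_nil.
rewrite big_cons -IH; case Pi : (P i); last first.
  by apply: eq_E => om; rewrite big_cons Pi.
rewrite -ED //; last exact: cyl_sum.
by apply: eq_E => om; rewrite big_cons Pi.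
Qed.

Lemma E_le p f g : 0 <= p <= 1 -> cyl f -> cyl g -> (forall x, f x <= g x) -> E p f <= E p g.
Proof.
move=> p01 cf cg fg; have [L [df dg]] := cyl_joint cf cg.
by rewrite !(@E_Ex _ L _ (fun=> false)) //; apply: Ex_le.
Qed.

Lemma E_ge0 p f : 0 <= p <= 1 -> cyl f -> (forall x, 0 <= f x) -> 0 <= E p f.
Proof.
by move=> p01 cf f0; rewrite -[leLHS](E_cst p); apply: E_le => //; apply: cyl_cst.
Qed.

Definition Ie p e f : (T -> bool) -> R :=
  fun om => p * f (upd om e true) + (1 - p) * f (upd om e false).

Lemma cyl_Ie p e f : cyl f -> cyl (Ie p e f).
Proof.
move=> cf; rewrite /Ie.
apply: (cyl_comp2 (fun a b => p * a + (1 - p) * b)); exact: cyl_upd.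
Qed.

Lemma E_Ie p e f : cyl f -> E p (Ie p e f) = E p f.
Proof.
move=> [L dL].
rewrite (@E_Ex _ (e :: L) f (fun=> false)); last first.
  by apply: (dep_sub dL) => x /= xL; rewrite inE xL orbT.
rewrite Ex_consC -cats1 Ex_cat (@E_Ex _ L _ (fun=> false)) //.
split=> om om' H; rewrite /Ie.
by congr (_ * _ + _ * _); apply: (depP dL) => x xL; rewrite /upd; case: eqP => // _; apply: H.
Qed.

(** Insertion tolerance. This is the source of the powers of [p] in [sg_ball] and [big_dist]. *)
Lemma E_surgery p e f : 0 <= p <= 1 -> cyl f -> (forall x, 0 <= f x) ->
  p * E p (fun om => f (upd om e true)) <= E p f.
Proof.
move=> p01 cf f0; rewrite -(E_Ie p e cf) -EZ; last exact: cyl_upd.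
apply: E_le => //; first by apply: cyl_comp; apply: cyl_upd.
  exact: cyl_Ie.
move=> om; rewrite /Ie lerDl mulr_ge0 // subr_ge0; by case/andP: p01.
Qed.

Lemma E_indep p (D D' : pred T) f g : cyl f -> cyl g -> dep D f -> dep D' g ->
  (forall e, D e -> ~~ D' e) -> E p (fun om => f om * g om) = E p f * E p g.
Proof.
move=> [L dL] [L' dL'] df dg disj.
pose L1 := [seq e <- L | D e]; pose L2 := [seq e <- L' | D' e].
have d1 : dep [pred e in L1] f.
  by apply: (dep_sub (dep_cap df dL)) => e /= De; rewrite mem_filter.
have d2 : dep [pred e in L2] g.
  by apply: (dep_sub (dep_cap dg dL')) => e /= De; rewrite mem_filter.
have d12 : {in L2, forall e, ~~ [pred e in L1] e}.
  move=> e; rewrite mem_filter /= => /andP[D'e _]; rewrite mem_filter negb_and.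
  by apply/orP; left; apply: contraL D'e => /disj.
rewrite (@E_Ex _ (L1 ++ L2) _ (fun=> false)); last first.
  apply: (dep_op *%R); [apply: (dep_sub d1)|apply: (dep_sub d2)] => e /= eL;
  by rewrite mem_cat eL ?orbT.
rewrite Ex_cat (@E_Ex _ L1 f (fun=> false)) // (@E_Ex _ L2 g (fun=> false)) //.
rewrite (eq_Ex _ _ (g := fun om => Ex p L2 g (fun=> false) * f om)) ?ExZ 1?mulrC // => om.
rewrite (Ex_mull _ _ _ d1) // mulrC; congr (_ * _).
by rewrite -!(E_Ex _ _ d2).
Qed.

(** * Harris' inequality, monotonicity in [p], relabelling and Russo's formula *)

Definition incr f := forall om om', (forall e, om e ==> om' e) -> f om <= f om'.

Lemma upd_incr om om' e b b' : (forall x, om x ==> om' x) -> b ==> b' ->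
  forall x, upd om e b x ==> upd om' e b' x.
Proof. by move=> H bb x; rewrite /upd; case: eqP. Qed.

Lemma incr_Ex p L f : 0 <= p <= 1 -> incr f -> incr (Ex p L f).
Proof.
move=> /andP[p0 p1] incf; elim: L => //= e L IH om om' H.
by apply: lerD; apply: ler_wpM2l; rewrite ?subr_ge0 //; apply: IH; apply: upd_incr.
Qed.

(* Two-point Chebyshev inequality, one coordinate at a time. *)
Lemma Ex_harris p L f g om : 0 <= p <= 1 -> incr f -> incr g ->
  Ex p L f om * Ex p L g om <= Ex p L (fun x => f x * g x) om.
Proof.
move=> p01 incf incg; elim: L om => //= e L IH om.
have /andP[p0 p1] := p01; have q0 : 0 <= 1 - p by rewrite subr_ge0.
apply: le_trans (lerD (ler_wpM2l p0 (IH _)) (ler_wpM2l q0 (IH _))).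
have H : forall x, upd om e false x ==> upd om e true x.
  by apply: upd_incr => // x; apply/implyP.
have := incr_Ex L p01 incf H; have := incr_Ex L p01 incg H.
set a := Ex p L f _; set b := Ex p L g _; set c := Ex p L f _; set d := Ex p L g _.
move=> gd fc.
have h : 0 <= (p * (1 - p)) * ((c - a) * (d - b)) by rewrite !mulr_ge0 ?subr_ge0.
by rewrite -subr_ge0; apply: le_trans h _; rewrite le_eqVlt; apply/orP; left; apply/eqP; ring.
Qed.

Lemma E_harris p f g : 0 <= p <= 1 -> cyl f -> cyl g -> incr f -> incr g ->
  E p f * E p g <= E p (fun x => f x * g x).
Proof.
move=> p01 cf cg incf incg; have [L [df dg]] := cyl_joint cf cg.
rewrite !(@E_Ex _ L _ (fun=> false)) //; last exact: (dep_op *%R).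
exact: Ex_harris.
Qed.

Lemma Ex_incr_p p p' L f om : 0 <= p -> p <= p' -> p' <= 1 -> incr f ->
  Ex p L f om <= Ex p' L f om.
Proof.
move=> p0 pp' p'1 incf; elim: L om => //= e L IH om.
have H : forall x, upd om e false x ==> upd om e true x.
  by apply: upd_incr => // x; apply/implyP.
have p1 := le_trans pp' p'1; have p'0 := le_trans p0 pp'.
have i1 : 0 <= p' <= 1 by rewrite p'0.
have := incr_Ex L i1 incf H; have := IH (upd om e true); have := IH (upd om e false).
set a := Ex _ _ _ _; set b := Ex _ _ _ _; set c := Ex _ _ _ _; set d := Ex _ _ _ _.
move=> h1 h2 h3; rewrite -subr_ge0.
have -> : p' * d + (1 - p') * b - (p * c + (1 - p) * a) =
   p * (d - c) + (1 - p) * (b - a) + (p' - p) * (d - b) by ring.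
by rewrite !addr_ge0 ?mulr_ge0 ?subr_ge0.
Qed.

Lemma E_incr_p p p' f : 0 <= p -> p <= p' -> p' <= 1 -> cyl f -> incr f -> E p f <= E p' f.
Proof.
move=> p0 pp' p'1 [L df] incf.
by rewrite !(@E_Ex _ L _ (fun=> false)) //; apply: Ex_incr_p.
Qed.

Lemma Ex_map p L (pi : T -> T) f om : injective pi ->
  Ex p (map pi L) (fun x => f (x \o pi)) om = Ex p L f (om \o pi).
Proof.
move=> inj; elim: L om => //= e L IH om.
have H b : upd om (pi e) b \o pi = upd (om \o pi) e b.
  by apply/funext => x; rewrite /upd /= (inj_eq inj).
by rewrite !IH !H.
Qed.

Lemma E_relabel p (pi : T -> T) f : injective pi -> cyl f ->
  E p (fun om => f (om \o pi)) = E p f.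
Proof.
move=> inj [L dL]; rewrite (@E_Ex _ (map pi L) _ (fun=> false)).
  by rewrite Ex_map // (E_Ex _ (fun=> false) dL).
split=> om om' H; apply: (depP dL) => e eL; apply: H => /=; exact: map_f.
Qed.

(** Finitely many bits give finitely many values. Thanks to this, [E_total] conditions on the value
    of a random list of vertices by a finite sum. *)
Lemma cyl_values (X : eqType) (h : (T -> bool) -> X) : cyl h ->
  exists s : seq X, uniq s /\ forall om, h om \in s.
Proof.
move=> [L dL].
suff [s Hs] : exists s : seq X, forall om, h om \in s.
  by exists (undup s); rewrite undup_uniq; split=> // om; rewrite mem_undup.
elim: L h dL => [|e L IH] h dL.
  by exists [:: h (fun=> false)] => om; rewrite inE; apply/eqP; apply: (depP dL).
have [|s1 H1] := IH (fun om => h (upd om e true)).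
  split=> om om' H; apply: (depP dL) => x; rewrite /= inE /upd; case: (x =P e) => //= _; exact: H.
have [|s2 H2] := IH (fun om => h (upd om e false)).
  split=> om om' H; apply: (depP dL) => x; rewrite /= inE /upd; case: (x =P e) => //= _; exact: H.
exists (s1 ++ s2) => om; rewrite mem_cat -(upd_id om e).
by case: (om e); rewrite ?H1 // H2 orbT.
Qed.

Lemma Ex_upd p L f e b om : e \notin L ->
  Ex p L (fun x => f (upd x e b)) om = Ex p L f (upd om e b).
Proof.
elim: L om => //= e' L IH om; rewrite inE negb_or => /andP[ne eL].
by rewrite !IH // !(@updC _ e e').
Qed.

Lemma ExB p L f g om : Ex p L (fun x => f x - g x) om = Ex p L f om - Ex p L g om.
Proof.
rewrite ExD; congr (_ + _); rewrite -[RHS]mulN1r -ExZ.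
by apply: eq_Ex => x; rewrite mulN1r.
Qed.

(** Russo's formula by the product rule, one coordinate at a time; [uniq L] lets the update at [e]
    pass through the averages over the rest of the list. *)
Lemma Ex_russo p L f om : uniq L ->
  is_derive p 1 (fun q : R => Ex q L f om)
    (\sum_(e <- L) Ex p L (fun x => f (upd x e true) - f (upd x e false)) om).
Proof.
elim: L om => [|e L IH] om /=.
  by rewrite big_nil => _; apply: is_derive_cst.
case/andP=> eL uL.
have H1 := IH (upd om e true) uL; have H0 := IH (upd om e false) uL.
have := is_deriveD (is_deriveM (is_derive_id p 1) H1)
  (is_deriveM (is_deriveB (is_derive_cst (1 : R) p 1) (is_derive_id p 1)) H0).
move=> H; apply: (is_derive_eq H).
rewrite big_cons big_split /= -!mulr_sumr !ExB !Ex_upd // !upd_upd /GRing.scale /=.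
rewrite (_ : (cst 1 - id) p = 1 - p) //; ring.
Qed.

Lemma E_russo p L f : uniq L -> dep [pred e in L] f ->
  is_derive p 1 (fun q : R => E q f)
    (\sum_(e <- L) E p (fun x => f (upd x e true) - f (upd x e false))).
Proof.
move=> uL dL.
have -> : (fun q => E q f) = (fun q => Ex q L f (fun=> false)).
  by apply/funext => q; apply: E_Ex.
apply: (is_derive_eq (Ex_russo p f (fun=> false) uL)); apply: eq_bigr => e _.
rewrite (@E_Ex _ L _ (fun=> false)) //; split=> om om' H.
by congr (_ - _); apply: (depP dL) => x xL; rewrite /upd; case: eqP => // _; apply: H.
Qed.

Definition Pr p (A : (T -> bool) -> bool) : R := E p (fun om => (A om)%:R).

Lemma cyl_natr (A : (T -> bool) -> bool) : cyl A -> cyl (fun om => (A om)%:R : R).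
Proof. exact: (cyl_comp (fun b : bool => b%:R)). Qed.

Lemma cylD f g : cyl f -> cyl g -> cyl (fun om => f om + g om).
Proof. exact: (cyl_comp2 +%R). Qed.

Lemma cylM f g : cyl f -> cyl g -> cyl (fun om => f om * g om).
Proof. exact: (cyl_comp2 *%R). Qed.

Lemma cylN f : cyl f -> cyl (fun om => - f om).
Proof. exact: (cyl_comp -%R). Qed.

Lemma cyl_and (A B : (T -> bool) -> bool) : cyl A -> cyl B -> cyl (fun om => A om && B om).
Proof. exact: (cyl_comp2 andb). Qed.

Lemma cyl_not (A : (T -> bool) -> bool) : cyl A -> cyl (fun om => ~~ A om).
Proof. exact: (cyl_comp negb). Qed.

Lemma Pr_ge0 p (A : (T -> bool) -> bool) : 0 <= p <= 1 -> cyl A -> 0 <= Pr p A.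
Proof. by move=> p01 cA; apply: E_ge0 => //; apply: cyl_natr. Qed.

Lemma Pr_le1 p (A : (T -> bool) -> bool) : 0 <= p <= 1 -> cyl A -> Pr p A <= 1.
Proof.
move=> p01 cA; rewrite -[leRHS](E_cst p); apply: E_le => //; first exact: cyl_natr.
  exact: cyl_cst.
by move=> om; rewrite lern1 leq_b1.
Qed.

Lemma E_total p (X : eqType) (h : (T -> bool) -> X) (s : seq X) (F : X -> (T -> bool) -> R) :
  uniq s -> (forall om, h om \in s) -> cyl h -> (forall x, cyl (F x)) ->
  E p (fun om => F (h om) om) = \sum_(x <- s) E p (fun om => (h om == x)%:R * F x om).
Proof.
move=> us hs ch cF; rewrite -E_sum; last first.
  by move=> x; apply: cylM => //; apply: cyl_natr; apply: (cyl_comp (fun y => y == x)).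
apply: eq_E => om.
rewrite (bigD1_seq (h om)) //= eqxx mul1r big1 ?addr0 // => x.
by rewrite eq_sym => /negbTE ->; rewrite mul0r.
Qed.

Lemma Pr_coord p e : Pr p (fun om => om e) = p.
Proof.
rewrite /Pr (@E_Ex _ [:: e] _ (fun=> false)) /=.
  by rewrite !upd_same mulr1 mulr0 addr0.
by split=> om om' /(_ e) -> //=; rewrite inE.
Qed.

End Cylinder.

(** * Clusters *)

Section Ppath.
Context {V : countType}.
Implicit Types (r : V -> V -> Prop) (x y : V) (s t : seq V).

Lemma ppath_sub r r' x s : (forall a b, r a b -> r' a b) -> ppath r x s -> ppath r' x s.
Proof. by move=> H; elim: s x => //= y s IH x [/H ? /IH]. Qed.

Lemma ppath_cat r x s t : ppath r x (s ++ t) <-> ppath r x s /\ ppath r (last x s) t.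
Proof.
elim: s x => [|y s IH] x /=; first by split=> // -[].
by split=> [[rxy /IH [? ?]]|[[rxy ps] pt]]; do ?split => //; apply/IH.
Qed.

Lemma ppath_rcons r x s y : ppath r x (rcons s y) <-> ppath r x s /\ r (last x s) y.
Proof. by rewrite -cats1 ppath_cat /=; split=> [[? []]|[]]. Qed.

End Ppath.

Section Clusters.
Context {V : countType} {nbr : V -> seq V}.
Hypothesis G : simple_graph nbr.
Local Notation cfg := (Edge nbr -> bool).
Implicit Types (om : cfg) (u v w x y z : V) (e : Edge nbr).

Lemma adjC u w : adj nbr u w = adj nbr w u.
Proof. by case: G => _ []. Qed.

Lemma nbrC u w : (w \in nbr u) = (u \in nbr w).
Proof. exact: adjC. Qed.

Lemma nbr_uniq u : uniq (nbr u).
Proof. by case: G. Qed.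

Lemma nbr_irr u : u \in nbr u = false.
Proof. by case: G => _ [/(_ u)/negbTE]. Qed.

Definition ed u w : option (Edge nbr) := if insub (u, w) is Some e then Some e else insub (w, u).

Definition eo om u w : bool := if ed u w is Some e then om e else false.

Lemma ed_val u w e : ed u w = Some e -> val e = (u, w) \/ val e = (w, u).
Proof.
rewrite /ed; case: insubP => [e' _ <- [<-]|_]; first by left.
by case: insubP => [e' _ <- [<-]|//]; right.
Qed.

Lemma ed_fst_snd e : ed (val e).1 (val e).2 = Some e.
Proof. by rewrite /ed -surjective_pairing valK. Qed.

Lemma ed_snd_fst e : ed (val e).2 (val e).1 = Some e.
Proof.
rewrite /ed -surjective_pairing valK.
case: insubP => // e' /=; have /andP[_ /=] := valP e.
by move=> lt1 /andP[_ lt2]; have := ltn_trans lt1 lt2; rewrite ltnn.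
Qed.

Lemma edC u w : ed u w = ed w u.
Proof.
have H a b e : ed a b = Some e -> ed b a = Some e.
  by case/ed_val => h; have := ed_fst_snd e; have := ed_snd_fst e; rewrite h.
case E1 : (ed u w) => [e|]; first by rewrite (H _ _ _ E1).
by case E2 : (ed w u) => [e|//]; rewrite (H _ _ _ E2) in E1.
Qed.

Lemma ed_adj u w e : ed u w = Some e -> w \in nbr u.
Proof.
have /andP[h _] := valP e.
by case/ed_val => H; move: h; rewrite H //= adjC.
Qed.

Lemma adj_ed u w : w \in nbr u -> exists e, ed u w = Some e.
Proof.
move=> uw; rewrite /ed.
have [lt|lt|/(pcan_inj choice.pickleK) uw'] := ltngtP (choice.pickle u) (choice.pickle w).
- have h : adj nbr (u, w).1 (u, w).2 && (choice.pickle (u, w).1 < choice.pickle (u, w).2)%N.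
    by rewrite /= /adj uw.
  by exists (Sub (u, w) h); rewrite insubT.
- have h : adj nbr (w, u).1 (w, u).2 && (choice.pickle (w, u).1 < choice.pickle (w, u).2)%N.
    by rewrite /= adjC /adj uw.
  case: insubP => [e' _ _|_]; first by exists e'.
  by exists (Sub (w, u) h); rewrite insubT.
- by rewrite uw' nbr_irr in uw.
Qed.

Lemma ed_eq a b x y e : ed a b = Some e -> ed x y = Some e ->
  (a = x /\ b = y) \/ (a = y /\ b = x).
Proof.
by move=> /ed_val[h1|h1] /ed_val[]; rewrite h1 => -[-> ->]; [left|right|right|left].
Qed.

Lemma eoC om u w : eo om u w = eo om w u.
Proof. by rewrite /eo edC. Qed.

Lemma eo_nbr om u w : eo om u w -> w \in nbr u.
Proof. by rewrite /eo; case E : (ed u w) => [e|//] _; apply: ed_adj E. Qed.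

Lemma eo_all u w : eo (fun=> true) u w = (w \in nbr u).
Proof.
apply/idP/idP; first exact: eo_nbr.
by rewrite /eo => /adj_ed [e ->].
Qed.

Lemma edge_openE om u w : edge_open om u w <-> eo om u w.
Proof.
rewrite /eo; split.
  move=> [e [ome [h|h]]]; have := ed_fst_snd e; have := ed_snd_fst e; rewrite h /=.
    by move=> _ ->.
  by move=> ->.
by case E : (ed u w) => [e|//] ome; exists e; split=> //; apply: ed_val.
Qed.

Definition conn om u w := exists s, ppath (eo om) u s /\ last u s = w.

Lemma clusterE om u w : Defs.cluster om u w <-> conn om u w.
Proof.
split=> -[s [ps sw]]; exists s; split=> //; apply: ppath_sub ps => a b; by rewrite edge_openE.
Qed.

Lemma conn_refl om u : conn om u u.
Proof. by exists [::]. Qed.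

Lemma conn_trans om u v w : conn om u v -> conn om v w -> conn om u w.
Proof.
move=> [s [ps sv]] [t [pt tw]]; exists (s ++ t); split.
  by apply/ppath_cat; rewrite sv.
by rewrite last_cat sv.
Qed.

Lemma conn_eo om u w : eo om u w -> conn om u w.
Proof. by move=> h; exists [:: w]. Qed.

Lemma conn_sym om u w : conn om u w -> conn om w u.
Proof.
move=> [s [ps <-]]; elim: s u ps => [|y s IH] u /=; first by move=> _; apply: conn_refl.
move=> [uy /IH h]; apply: conn_trans h _; apply: conn_eo; by rewrite eoC.
Qed.

Lemma conn_ind om u (P : V -> Prop) : P u ->
  (forall a b, conn om u a -> P a -> eo om a b -> P b) -> forall w, conn om u w -> P w.
Proof.
move=> Pu H w [s [ps <-]]; elim/last_ind: s ps => [//|s y IH] /ppath_rcons[ps ey].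
rewrite last_rcons; apply: (H (last u s)) => //; last exact: IH.
by exists s.
Qed.

Lemma eo_mono om om' u w : (forall e, om e ==> om' e) -> eo om u w -> eo om' u w.
Proof. by move=> H; rewrite /eo; case: ed => // e; apply/implyP. Qed.

Lemma conn_mono om om' u w : (forall e, om e ==> om' e) -> conn om u w -> conn om' u w.
Proof.
by move=> H [s [ps sw]]; exists s; split=> //; apply: ppath_sub ps => a b; apply: eo_mono.
Qed.

Fixpoint reach k om v : seq V :=
  if k is k'.+1 then
    undup (reach k' om v ++ flatten [seq [seq y <- nbr x | eo om x y] | x <- reach k' om v])
  else [:: v].

Lemma reach_uniq k om v : uniq (reach k om v).
Proof. by case: k => // k; apply: undup_uniq. Qed.

Lemma mem_reachS k om v y : y \in reach k.+1 om v <->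
  (y \in reach k om v) \/ exists2 x, x \in reach k om v & eo om x y.
Proof.
rewrite /= mem_undup mem_cat; split.
  case/orP; first by left.
  case/flattenP => _ /mapP[x xr ->]; rewrite mem_filter => /andP[exy _].
  by right; exists x.
case=> [->//|[x xr exy]]; apply/orP; right; apply/flattenP.
exists [seq y <- nbr x | eo om x y]; first exact: map_f.
by rewrite mem_filter exy (eo_nbr exy).
Qed.

Lemma reachP k om v w : w \in reach k om v <->
  exists s, ppath (eo om) v s /\ last v s = w /\ (size s <= k)%N.
Proof.
elim: k w => [|k IH] w.
  rewrite inE; split; first by move/eqP ->; exists [::].
  by move=> [[|y s] [_ [<- //=]]].
rewrite mem_reachS; split.
  case=> [/IH[s [ps [sw sk]]]|[x /IH[s [ps [sx sk]]] exw]].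
    by exists s; do ?split => //; apply: leqW.
  exists (rcons s w); rewrite last_rcons size_rcons; split=> //.
  by apply/ppath_rcons; rewrite sx.
move=> [s]; case/lastP: s => [|s y] [ps [<- sk]].
  by left; apply/IH; exists [::].
rewrite last_rcons; right; move/ppath_rcons: ps => [ps ey].
exists (last v s) => //; apply/IH; exists s; split=> //; split=> //.
by rewrite size_rcons in sk.
Qed.

Lemma mem_reach0 k om v : v \in reach k om v.
Proof. by apply/reachP; exists [::]. Qed.

Lemma reach_conn k om v w : w \in reach k om v -> conn om v w.
Proof. by case/reachP => s [ps [sw _]]; exists s. Qed.

Lemma reach_le k k' om v : (k <= k')%N -> {subset reach k om v <= reach k' om v}.
Proof.
move=> kk' w /reachP[s [ps [sw sk]]]; apply/reachP; exists s; do ?split => //.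
exact: leq_trans sk kk'.
Qed.

Lemma reach_mono k om om' v : (forall e, om e ==> om' e) ->
  {subset reach k om v <= reach k om' v}.
Proof.
move=> H w /reachP[s [ps sw]]; apply/reachP; exists s; split=> //.
by apply: ppath_sub ps => a b; apply: eo_mono.
Qed.

Lemma reach_sym k om u w : (w \in reach k om u) = (u \in reach k om w).
Proof.
suff H a b : a \in reach k om b -> b \in reach k om a by apply/idP/idP; apply: H.
case/reachP => s [ps [<-]]; elim: s b k ps => [|y s IH] b k /= ps sk.
  exact: mem_reach0.
case: k sk => // k sk; case: ps => eby ps.
have /reachP[t [pt [ty tk]]] := IH y k ps sk.
apply/reachP; exists (rcons t b); rewrite last_rcons size_rcons; split=> //.
by apply/ppath_rcons; rewrite ty eoC.
Qed.

(** As long as the search is not closed under open edges, each step adds a vertex; so after [k]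
    steps it is closed or has more than [k] vertices. *)
Lemma reach_full k om v w : (size (reach k om v) <= k)%N ->
  conn om v w -> w \in reach k om v.
Proof.
suff H : (k < size (reach k om v))%N \/
    (forall a b, a \in reach k om v -> eo om a b -> b \in reach k om v).
  case: H => [lt|cl] le; first by rewrite ltnNge le in lt.
  move: w; apply: (conn_ind (P := fun w => w \in reach k om v)); first exact: mem_reach0.
  by move=> a b _; apply: cl.
elim: k => [|k IH]; first by left.
case: (pselect (forall a b, a \in reach k om v -> eo om a b -> b \in reach k om v)) => [cl|ncl].
  right=> a b /mem_reachS ha eab; apply/mem_reachS; left.
  by case: ha => [ha|[x xr /cl]]; [apply: cl eab|move=> /(_ xr) ha; apply: cl eab].
left; case: IH => // lt; apply: leq_ltn_trans lt _.
move: ncl => /existsNP[a /existsNP[b /not_implyP[ar /not_implyP[eab br]]]].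
have sub : {subset b :: reach k om v <= reach k.+1 om v}.
  move=> z; rewrite inE => /orP[/eqP ->|]; last exact: reach_le.
  by apply/mem_reachS; right; exists a.
have := uniq_leq_size (s1 := b :: reach k om v) _ sub; apply.
by rewrite /= reach_uniq andbT; apply/negP.
Qed.

(* [N <= |K_v|]: a cluster not exhausted after [N] steps has more than [N] vertices. *)
Definition big om v N := (N <= size (reach N om v))%N.

Lemma mem_fin N om v w : ~~ big om v N -> w \in reach N om v <-> conn om v w.
Proof.
by rewrite /big -ltnNge => /ltnW h; split; [apply: reach_conn|apply: reach_full].
Qed.

Lemma bigP N om v : big om v N <->
  exists s, [/\ uniq s, size s = N & forall w, w \in s -> conn om v w].
Proof.
split=> [h|[s [us sN sc]]].
  exists (take N (reach N om v)); split; first by rewrite take_uniq ?reach_uniq.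
    by rewrite size_takel.
  by move=> w /mem_take; apply: reach_conn.
apply: contraT => nb; have /uniq_leq_size : {subset s <= reach N om v}.
  by move=> w /sc; rewrite (mem_fin _ nb).
by move: nb; rewrite /big -ltnNge sN us => lt /(_ isT); rewrite leqNgt lt.
Qed.

Lemma big_mono N om om' v : (forall e, om e ==> om' e) -> big om v N -> big om' v N.
Proof.
move=> H /bigP[s [us sN sc]]; apply/bigP; exists s; split=> // w /sc.
exact: conn_mono.
Qed.

Lemma big_le N N' om v : (N <= N')%N -> big om v N' -> big om v N.
Proof.
move=> NN' /bigP[s [us sN sc]]; apply/bigP; exists (take N s); split.
- by rewrite take_uniq.
- by rewrite size_takel // sN.
- by move=> w /mem_take; apply: sc.
Qed.

Lemma conn_big N om u v : conn om u v -> big om u N = big om v N.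
Proof.
suff H a b : conn om a b -> big om a N -> big om b N.
  by move=> h; apply/idP/idP; apply: H => //; apply: conn_sym.
move=> h /bigP[s [us sN sc]]; apply/bigP; exists s; split=> // w /sc.
by apply: conn_trans; apply: conn_sym.
Qed.

Lemma fin_reach_eq N om u v : ~~ big om u N -> conn om u v ->
  perm_eq (reach N om u) (reach N om v).
Proof.
move=> nb h; have nb' : ~~ big om v N by rewrite -(conn_big _ h).
apply: uniq_perm; rewrite ?reach_uniq // => w; apply/idP/idP.
  move=> /(mem_fin _ nb) uw; apply/(mem_fin _ nb'); exact: conn_trans (conn_sym h) uw.
by move=> /(mem_fin _ nb') uw; apply/(mem_fin _ nb); apply: conn_trans h uw.
Qed.

Lemma big_size N N' om v : ~~ big om v N' -> big om v N = (N <= size (reach N' om v))%N.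
Proof.
move=> nb; have [le|lt] := leqP N' N.
  have nb2 : ~~ big om v N by apply: contra nb; apply: big_le.
  rewrite (negbTE nb2); symmetry; apply/negbTE; rewrite -ltnNge.
  by apply: leq_trans le; rewrite ltnNge.
apply/idP/idP => [/bigP[s [us <- sc]]|h].
  apply: uniq_leq_size => // w /sc; by move=> /(mem_fin _ nb).
apply/bigP; exists (take N (reach N' om v)); split; first by rewrite take_uniq ?reach_uniq.
  by rewrite size_takel.
by move=> w /mem_take; apply: reach_conn.
Qed.

Definition ball k v := reach k (fun=> true) v.

Lemma reach_ball k om v : {subset reach k om v <= ball k v}.
Proof. by apply: reach_mono => e; apply/implyP. Qed.

Lemma nbr_ball u w : w \in nbr u -> w \in ball 1 u.
Proof.
by move=> h; apply/mem_reachS; right; exists u; rewrite ?mem_head // eo_all.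
Qed.

Definition tE (K : seq V) : seq (Edge nbr) :=
  undup (flatten [seq pmap (ed x) (nbr x) | x <- K]).

Lemma mem_tE K e : (e \in tE K) = ((val e).1 \in K) || ((val e).2 \in K).
Proof.
rewrite mem_undup; apply/flattenP/orP.
  move=> [_ /mapP[x xK ->]]; rewrite mem_pmap => /mapP[y _ /esym/ed_val[->|->]] /=;
  by [left|right].
have h1 := ed_fst_snd e; have h2 := ed_snd_fst e.
case=> h; [exists (pmap (ed (val e).1) (nbr (val e).1))|exists (pmap (ed (val e).2) (nbr (val e).2))].
- exact: map_f.
- rewrite mem_pmap; apply/mapP; exists (val e).2 => //; exact: ed_adj h1.
- exact: map_f.
- rewrite mem_pmap; apply/mapP; exists (val e).1 => //; exact: ed_adj h2.
Qed.

Lemma tE_uniq K : uniq (tE K).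
Proof. exact: undup_uniq. Qed.

Lemma ed_tE K x y e : ed x y = Some e -> x \in K -> e \in tE K.
Proof. by rewrite mem_tE => /ed_val[->|->] /= ->; rewrite ?orbT. Qed.

Lemma eo_agree K om om' x y : (forall e, e \in tE K -> om e = om' e) -> x \in K ->
  eo om x y = eo om' x y.
Proof.
by move=> H xK; rewrite /eo; case E : (ed x y) => [e|//]; apply: H; apply: ed_tE E xK.
Qed.

Lemma reach_agree k om om' v :
  (forall x y, x \in reach k om v -> eo om x y = eo om' x y) -> reach k om v = reach k om' v.
Proof.
elim: k => //= k IH H; rewrite -IH; last first.
  by move=> x y xr; apply: H; rewrite mem_undup mem_cat xr.
congr (undup (_ ++ flatten _)); apply/eq_in_map => x xr; apply: eq_filter => y.
by apply: H; rewrite mem_undup mem_cat xr.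
Qed.

Lemma dep_reach k v : dep [pred e in tE (ball k v)] (fun om => reach k om v).
Proof.
split=> om om' H; apply: reach_agree => x y xr.
by apply: (eo_agree (K := ball k v)) => //; apply: (reach_ball xr).
Qed.

Lemma cyl_reach k v : cyl (fun om => reach k om v).
Proof. by exists (tE (ball k v)); apply: dep_reach. Qed.

Lemma cyl_big N v : cyl (fun om => big om v N).
Proof. exact: (cyl_comp (fun s => N <= size s)%N (cyl_reach N v)). Qed.

Lemma cyl_eo x y : cyl (fun om => eo om x y).
Proof.
exists (tE [:: x]); split=> om om' H; apply: (eo_agree (K := [:: x])) => //.
by rewrite inE.
Qed.

Definition rs (S : pred V) om : cfg := fun e => [&& om e, S (val e).1 & S (val e).2].

Lemma eo_rs S om x y : eo (rs S om) x y = [&& eo om x y, S x & S y].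
Proof.
rewrite /eo; case E : (ed x y) => [e|//]; rewrite /rs.
by case: (ed_val E) => -> //=; rewrite [S y && _]andbC.
Qed.

Lemma rs_le S om e : rs S om e ==> om e.
Proof. by apply/implyP => /andP[]. Qed.

Lemma rs_in (S : pred V) om v w : S v -> conn (rs S om) v w -> S w.
Proof.
by move=> Sv; apply: (conn_ind (P := fun w => S w)) => // a b _ _; rewrite eo_rs => /and3P[].
Qed.

Lemma dep_rs X (f : cfg -> X) S : dep [pred e | S (val e).1 && S (val e).2] (fun om => f (rs S om)).
Proof.
split=> om om' H; congr f; apply/funext => e; rewrite /rs.
by case h : (S _ && S _) => //=; rewrite ?andbF // H.
Qed.

Lemma cyl_rs X (f : cfg -> X) S : cyl f -> cyl (fun om => f (rs S om)).
Proof.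
move=> [L dL]; exists L; split=> om om' H; apply: (depP dL) => e eL.
by rewrite /rs H.
Qed.

Lemma conn_upd om x y e z : ed x y = Some e ->
  conn (upd om e true) x z <-> conn (upd om e false) x z \/ conn (upd om e false) y z.
Proof.
move=> E; have le : forall e', upd om e false e' ==> upd om e true e'.
  by apply: upd_incr => // e'; apply/implyP.
split.
  move: z; apply: conn_ind; first by left; apply: conn_refl.
  move=> a b _ IH; rewrite {1}/eo; case E' : (ed a b) => [e'|//]; case: (eqVneq e' e) => [ee _|ne].
    rewrite ee in E'; case: (ed_eq E' E) => -[_ ->]; first by right; apply: conn_refl.
    by left; apply: conn_refl.
  rewrite upd_other // => oe.
  have eab : eo (upd om e false) a b by rewrite /eo E' upd_other.
  by case: IH => IH; [left|right]; apply: conn_trans IH (conn_eo eab).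
have exy : eo (upd om e true) x y by rewrite /eo E upd_same.
case=> h; first exact: conn_mono le h.
exact: conn_trans (conn_eo exy) (conn_mono le h).
Qed.

End Clusters.

Arguments ed {V} nbr u w.
Arguments ball {V} nbr k v.
Arguments tE {V} nbr K.

(** * Sharpness of the phase transition *)

Section Sharpness.
Context {R : realType} {V : countType} {nbr : V -> seq V}.
Hypothesis G : simple_graph nbr.
Local Notation cfg := (Edge nbr -> bool).
Implicit Types (om : cfg) (u v w x y z : V) (e : Edge nbr) (S : seq V) (p : R).

Lemma sum_nbr_edges (A : nmodType) (L : seq (Edge nbr)) x (F : V -> A) : uniq L ->
  {subset tE nbr [:: x] <= L} ->
  \sum_(y <- nbr x) F y =
  \sum_(e <- L) ((if (val e).1 == x then F (val e).2 else 0) +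
                 (if (val e).2 == x then F (val e).1 else 0)).
Proof.
move=> uL sL; pose W e := (if (val e).1 == x then F (val e).2 else 0) +
                 (if (val e).2 == x then F (val e).1 else 0).
rewrite -[RHS]/(\sum_(e <- L) W e).
have -> : \sum_(y <- nbr x) F y = \sum_(e <- pmap (ed nbr x) (nbr x)) W e.
  rewrite big_pmap big_seq [RHS]big_seq; apply: eq_bigr => y yx.
  have [e Ee] := adj_ed G yx; rewrite Ee /= /W.
  have yx' : (y == x) = false by apply/eqP => E; rewrite E (nbr_irr G) in yx.
  by case: (ed_val Ee) => -> /=; rewrite eqxx yx' ?addr0 ?add0r.
rewrite [RHS](bigID (fun e => e \in tE nbr [:: x])) /= [X in _ + X]big1 ?addr0; last first.
  move=> e; rewrite (mem_tE G) !inE negb_or /W => /andP[/negbTE -> /negbTE ->].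
  by rewrite addr0.
rewrite -[RHS]big_filter.
suff H : perm_eq (pmap (ed nbr x) (nbr x)) [seq e <- L | e \in tE nbr [:: x]] by rewrite (perm_big _ H).
apply: uniq_perm.
- apply: (pmap_uniq (g := fun e => if (val e).1 == x then (val e).2 else (val e).1)).
    move=> y; case E : (ed nbr x y) => [e|//] /=.
    case: (ed_val E) => -> /=; first by rewrite eqxx.
    by case: eqP.
  exact: (nbr_uniq G).
- exact: filter_uniq.
- move=> e; rewrite mem_filter; have := sL e.
  by rewrite /tE /= cats0 mem_undup; case: (e \in pmap _ _) => // /(_ isT) ->.
Qed.

Lemma sum_pairs_edges (A : nmodType) (K : seq V) (F : V -> V -> A) : uniq K ->
  \sum_(x <- K) \sum_(y <- nbr x) F x y =
  \sum_(e <- tE nbr K) ((if (val e).1 \in K then F (val e).1 (val e).2 else 0) +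
                        (if (val e).2 \in K then F (val e).2 (val e).1 else 0)).
Proof.
move=> uK.
have aux (z : V) (f : V -> A) : (if z \in K then f z else 0) =
    \sum_(i <- K) (if z == i then f i else 0).
  case: ifP => zK; last first.
    rewrite big_seq big1 // => i iK; case: eqP => // zi; by rewrite zi iK in zK.
  rewrite (bigD1_seq z) //= eqxx big1 ?addr0 // => i; by rewrite eq_sym => /negbTE ->.
under [RHS]eq_bigr => e _.
  rewrite (aux _ (fun x => F x (val e).2)) (aux _ (fun x => F x (val e).1)) -big_split /=.
  over.
rewrite exchange_big /= big_seq [RHS]big_seq; apply: eq_bigr => x xK.
rewrite (@sum_nbr_edges _ (tE nbr K)) ?tE_uniq // => e.
by rewrite !(mem_tE G) !inE => /orP[]/eqP ->; rewrite xK ?orbT.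
Qed.

(** The cluster of [v] in the subgraph induced on [S]. When [v \in S], [size S] steps exhaust it,
    because it stays inside [S] ([cSP]). *)
Definition cS S om v := reach (size S) (rs (fun z => z \in S) om) v.

Lemma cSP S om v x : v \in S -> x \in cS S om v <-> conn (rs (fun z => z \in S) om) v x.
Proof.
move=> vS; split; first exact: reach_conn.
apply: reach_full => //; apply: uniq_leq_size; first exact: reach_uniq.
by move=> z /(reach_conn G) /rs_in; apply.
Qed.

Lemma cS_sub S om v : v \in S -> {subset cS S om v <= S}.
Proof. by move=> vS z /(cSP _ _ vS) /rs_in; apply. Qed.

Lemma cyl_cS S v : cyl (fun om => cS S om v).
Proof. exact: (cyl_rs _ (cyl_reach G _ v)). Qed.

Lemma dep_cS S v : dep [pred e | (val e).1 \in S & (val e).2 \in S] (fun om => cS S om v).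
Proof. exact: (dep_rs (fun om => reach (size S) om v) (fun z => z \in S)). Qed.

(** Exploration from [v] queries only edges of [S] that touch the explored set. The event that this
    set is [C] is therefore independent of the edges leaving [S] and of the edges off [C], as
    [tau_step] requires. *)
Lemma dep_cS_eq S v (C : seq V) :
  dep [pred e | [&& (val e).1 \in S, (val e).2 \in S & ((val e).1 \in C) || ((val e).2 \in C)]]
    (fun om => cS S om v == C).
Proof.
suff H om om' : (forall e, [&& (val e).1 \in S, (val e).2 \in S &
      ((val e).1 \in C) || ((val e).2 \in C)] -> om e = om' e) ->
    cS S om v = C -> cS S om' v = C.
  split=> om om' E; apply/eqP/eqP; apply: H => // e eC; by rewrite E.
move=> E eqC; rewrite -eqC; symmetry; apply: reach_agree => // x y.
rewrite -/(cS S om v) eqC => xC; rewrite !eo_rs /eo.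
case: (boolP (x \in S)) => xS; rewrite ?andbF //=.
case: (boolP (y \in S)) => yS; rewrite ?andbF //=.
case Exy : (ed nbr x y) => [e|//]; rewrite E //.
by case: (ed_val Exy) => -> /=; rewrite xS yS xC ?orbT.
Qed.

(* Duminil-Copin and Tassion's functional: the expected number of open edges leaving [S]
   from a vertex joined to [v] inside [S]. *)
Definition phi p S v : R :=
  p * \sum_(x <- S) \sum_(y <- nbr x | y \notin S) Pr p (fun om => x \in cS S om v).

Definition tau p n v u : R := Pr p (fun om => u \in reach n om v).

Definition chi p n v : R := E p (fun om => (size (reach n om v))%:R).

Lemma cyl_mem (s : cfg -> seq V) u : cyl s -> cyl (fun om => u \in s om).
Proof. exact: (cyl_comp (fun s => u \in s)). Qed.

Lemma cyl_size (s : cfg -> seq V) : cyl s -> cyl (fun om => (size (s om))%:R : R).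
Proof. exact: (cyl_comp (fun s => (size s)%:R)). Qed.

Lemma sum_mem_le (B s : seq V) : uniq s -> uniq B ->
  \sum_(u <- B) (u \in s)%:R <= (size s)%:R :> R.
Proof.
move=> us uB; rewrite -natr_sum ler_nat.
rewrite (eq_bigr (fun u => if u \in s then 1%N else 0%N)); last by move=> u _; case: (u \in s).
rewrite -big_mkcond sum1_count -size_filter; apply: uniq_leq_size; first exact: filter_uniq.
by move=> z; rewrite mem_filter => /andP[].
Qed.

Lemma size_sum_mem (B s : seq V) : uniq s -> uniq B -> {subset s <= B} ->
  (size s)%:R = \sum_(u <- B) (u \in s)%:R :> R.
Proof.
move=> us uB sB; rewrite -natr_sum; congr (_%:R).
rewrite (eq_bigr (fun u => if u \in s then 1%N else 0%N)); last by move=> u _; case: (u \in s).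
rewrite -big_mkcond sum1_count -size_filter; apply: perm_size; apply: uniq_perm => //.
  exact: filter_uniq.
by move=> z; rewrite mem_filter; case: (boolP (z \in s)) => // /sB ->.
Qed.

(** The path is cut at its last visit to the cluster of [v] in [S]. The next vertex is outside [S],
    since otherwise it would belong to that cluster, and the rest of the path avoids the cluster. At
    least one step has been spent, whence [n] in place of [n.+1]. *)
Lemma exit_path S om v u n : v \in S -> u \notin S -> u \in reach n.+1 om v ->
  exists x y, [/\ x \in cS S om v, y \notin S, eo om x y &
    u \in reach n (rs (fun z => z \notin cS S om v) om) y].
Proof.
move=> vS uS /(reachP G)[s [ps [su sn]]].
set C := cS S om v.
suff H k : forall s x, (size s <= k)%N -> x \in C -> ppath (eo om) x s -> last x s = u ->
  exists x' y s', [/\ x' \in C, y \notin S, eo om x' y &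
    [/\ ppath (eo (rs (fun z => z \notin C) om)) y s', last y s' = u & (size s' < size s)%N]].
  have [|x [y [s' [xC yS exy [ps' s'u lt]]]]] := H _ s v (leqnn _) _ ps su.
    exact: mem_reach0.
  exists x, y; split=> //; apply/(reachP G); exists s'; do ?split => //.
  by rewrite -ltnS; apply: leq_trans sn.
elim: k => [|k IH] {s ps su sn} [|y s] x //= sk xC; try by
  move=> _ xu; move: uS; rewrite -xu (cS_sub vS xC).
move=> [exy ps] su.
case: (boolP (has (mem C) (y :: s))) => [/hasP[z zs zC]|nC].
  move: zs; rewrite inE; case/orP => [/eqP zy|zs].
    have [|x' [y' [s' [h1 h2 h3 [h4 h5 h6]]]]] := IH s y sk _ ps su.
      by rewrite -zy.
    exists x', y', s'; split=> //; split=> //; exact: leqW.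
  case/splitPr: zs ps su sk => s1 s2 /ppath_cat[_ [_ ps2]].
  rewrite last_cat /= size_cat /= => su sk.
  have [|x' [y' [s' [h1 h2 h3 [h4 h5 h6]]]]] := IH s2 z _ zC ps2 su.
    lia.
  exists x', y', s'; split=> //; split=> //; lia.
have yC : y \notin C by apply: contra nC => yC; apply/hasP; exists y; rewrite ?mem_head.
exists x, y, s; split=> //.
  apply: contra yC => yS; apply/(cSP _ _ vS).
  apply: (conn_trans (v := x)); first by apply/(cSP _ _ vS).
  by apply: conn_eo; rewrite eo_rs exy yS (cS_sub vS xC).
split=> //.
elim: s y {exy su sk IH} ps nC yC => //= z s IH y [eyz ps].
rewrite /= !negb_or => /and3P[h1 h2 h3] yC; split; last by apply: IH => //; rewrite /= negb_or h2.
by rewrite eo_rs eyz yC.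
Qed.

Lemma cyl_tau n v u : cyl (fun om => u \in reach n om v).
Proof. exact: cyl_mem (cyl_reach G n v). Qed.

Lemma cyl_cS_mem S v x : cyl (fun om => x \in cS S om v).
Proof. exact: cyl_mem (cyl_cS S v). Qed.

(** Simon-Lieb inequality. Once the cluster of [v] in [S] is fixed as [C], the state of the exit
    edge and the connection to [u] off [C] are independent of this event and of each other.
    Forgetting that the connection avoids [C] leaves [tau p n y u]. *)
Lemma tau_step p S v u n : 0 <= p <= 1 -> v \in S -> u \notin S ->
  tau p n.+1 v u <= \sum_(x <- S) \sum_(y <- nbr x | y \notin S)
     p * Pr p (fun om => x \in cS S om v) * tau p n y u.
Proof.
move=> p01 vS uS; have [Cs [uCs CsP]] := cyl_values (cyl_cS S v).
pose F (C : seq V) x y om : R := (x \in C)%:R * (eo om x y)%:R * (u \in reach n (rs (fun z => z \notin C) om) y)%:R.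
have cF C x y : cyl (F C x y).
  apply: cylM; first apply: cylM.
  - exact: cyl_cst.
  - exact/cyl_natr/(cyl_eo G).
  - apply: cyl_natr; apply: (cyl_rs (f := fun om => u \in reach n om y)); exact: cyl_tau.
have cFF x y : cyl (fun om => F (cS S om v) x y om).
  have [L HL] := cyl_cS S v.
  pose H C om := (cS S om v == C)%:R * F C x y om.
  have cH C : cyl (H C).
    by apply: cylM => //; apply: cyl_natr; apply: (cyl_comp (fun s => s == C)); exists L.
  have -> : (fun om => F (cS S om v) x y om) = (fun om => \sum_(C <- Cs) H C om).
    apply/funext => om; rewrite (bigD1_seq (cS S om v)) //= /H eqxx mul1r big1 ?addr0 // => C.
    by rewrite eq_sym => /negbTE ->; rewrite mul0r.
  exact: cyl_sum.
apply: (@le_trans _ _ (E p (fun om => \sum_(x <- S) \sum_(y <- nbr x | y \notin S) F (cS S om v) x y om))).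
  apply: E_le => //; first exact/cyl_natr/cyl_tau.
    by apply: cyl_sum => x; apply: cyl_sum.
  move=> om.
  have F0 C x y : 0 <= F C x y om by rewrite !mulr_ge0.
  case: (boolP (u \in reach n.+1 om v)) => ur; last first.
    by apply: sumr_ge0 => x _; apply: sumr_ge0 => y _.
  have [x [y [xC yS exy uy]]] := exit_path vS uS ur.
  have xS := cS_sub vS xC.
  rewrite (big_rem x) //= (big_rem y) ?(eo_nbr G exy) //= yS.
  rewrite {1}/F xC exy uy !mulr1 -addrA lerDl addr_ge0 //; first exact: sumr_ge0.
  by apply: sumr_ge0 => ? _; apply: sumr_ge0.
rewrite E_sum; last first.
  by move=> x; apply: cyl_sum.
rewrite big_seq [leRHS]big_seq; apply: ler_sum => x xS.
rewrite E_sum; last by move=> y; apply: cFF.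
rewrite big_seq_cond [leRHS]big_seq_cond; apply: ler_sum => y /andP[yx yS].
rewrite (E_total p (F := fun C => F C x y) uCs CsP (cyl_cS S v) (fun C => cF C x y)).
have -> : p * Pr p (fun om => x \in cS S om v) * tau p n y u =
   \sum_(C <- Cs) (x \in C)%:R * Pr p (fun om => cS S om v == C) * (p * tau p n y u).
  rewrite /Pr (E_total p (F := fun (C : seq V) om => (x \in C)%:R) uCs CsP (cyl_cS S v)); last first.
    by move=> C; apply: cyl_cst.
  rewrite mulrAC mulrC mulr_suml; apply: eq_bigr => C _; congr (_ * _).
  rewrite -EZ; last by apply: cyl_natr; apply: (cyl_comp (fun s => s == C)); apply: cyl_cS.
  by apply: eq_E => om; rewrite mulrC.
apply: ler_sum => C _.
case: (boolP (x \in C)) => xC; last first.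
  rewrite mul0r mul0r (@eq_E _ _ _ _ (fun=> 0)) ?E_cst // => om.
  by rewrite /F (negbTE xC) !mul0r mulr0.
have [e Ee] := adj_ed G yx.
have cA : cyl (fun om => (cS S om v == C)%:R : R).
  by apply: cyl_natr; apply: (cyl_comp (fun s => s == C)); apply: cyl_cS.
have cB : cyl (fun om => (eo om x y)%:R : R) by apply/cyl_natr/(cyl_eo G).
have cD : cyl (fun om => (u \in reach n (rs (fun z => z \notin C) om) y)%:R : R).
  by apply: cyl_natr; apply: (cyl_rs (f := fun om => u \in reach n om y)); exact: cyl_tau.
rewrite (eq_E _ (g := fun om => (cS S om v == C)%:R *
   ((eo om x y)%:R * (u \in reach n (rs (fun z => z \notin C) om) y)%:R))); last first.
  by move=> om; rewrite /F xC mul1r.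
have dA := dep_comp (fun b : bool => b%:R : R) (dep_cS_eq S v C).
have dB : dep [pred e' | e' == e] (fun om => (eo om x y)%:R : R).
  by split=> om om' H; rewrite /eo Ee H /=.
have dD := dep_rs (fun om => (u \in reach n om y)%:R : R) (fun z => z \notin C).
rewrite (E_indep p cA (cylM cB cD) dA (D' := [pred e' | (e' == e) || ((val e').1 \notin C) && ((val e').2 \notin C)])); first last.
- move=> e' /= /and3P[h1 h2 h3]; rewrite negb_or negb_and !negbK h3 andbT; apply: contraTneq h1 => e'e; rewrite e'e in h2 *.
  by case: (ed_val Ee) => E; rewrite E /= in h2 *; rewrite ?h2 // h2 in yS.
- apply: (dep_op *%R); first by apply: (dep_sub dB) => e' /= ->.
  by apply: (dep_sub dD) => e' /= ->; rewrite orbT.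
rewrite (E_indep p cB cD dB dD); last first.
  move=> e' /= /eqP ->; by case: (ed_val Ee) => -> /=; rewrite xC ?andbF.
rewrite mul1r ler_wpM2l ?Pr_ge0 //; first by apply: (cyl_comp (fun s => s == C)); apply: cyl_cS.
rewrite (_ : E p (fun om => (eo om x y)%:R) = p); last first.
  by rewrite -[RHS](Pr_coord p e); apply: eq_E => om; rewrite /eo Ee.
case/andP: (p01) => p0 _; rewrite ler_wpM2l //; apply: E_le => //; first exact/cyl_natr/cyl_tau.
move=> om; rewrite ler_nat; case: (boolP (u \in reach n (rs _ _) _)) => // h.
by rewrite (reach_mono G _ h) // => e'; apply: rs_le.
Qed.

Lemma chi_tau p n v (B : seq V) : uniq B -> {subset ball nbr n v <= B} ->
  chi p n v = \sum_(u <- B) tau p n v u.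
Proof.
move=> uB sB; rewrite -E_sum; last by move=> u; apply/cyl_natr/cyl_tau.
apply: eq_E => om; apply: size_sum_mem => //; first exact: reach_uniq.
by move=> z /(reach_ball G) /sB.
Qed.

(** Vertices of [S] contribute at most [size S]; summing [tau_step] over the others brings out the
    factor [phi p S v]. *)
Lemma chi_step p n v S B : 0 <= p <= 1 -> v \in S -> 0 <= B ->
  (forall y, chi p n y <= B) -> chi p n.+1 v <= (size S)%:R + phi p S v * B.
Proof.
move=> p01 vS B0 HB; have p0 : 0 <= p by case/andP: p01.
rewrite (chi_tau p (B := ball nbr n.+1 v)) //; last exact: reach_uniq.
rewrite (bigID (fun u => u \in S)) /=; apply: lerD.
  apply: (@le_trans _ _ (\sum_(u <- ball nbr n.+1 v | u \in S) 1%:R)).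
    by apply: ler_sum => u _; apply: Pr_le1 => //; apply: cyl_tau.
  rewrite -natr_sum ler_nat sum1_count -size_filter; apply: uniq_leq_size.
    by rewrite filter_uniq // reach_uniq.
  by move=> z; rewrite mem_filter => /andP[].
apply: le_trans (ler_sum _ (fun u (h : u \notin S) => tau_step n p01 vS h)) _.
rewrite exchange_big /= /phi mulr_sumr mulr_suml; apply: ler_sum => x _.
rewrite exchange_big /= mulr_sumr mulr_suml; apply: ler_sum => y _.
rewrite -mulr_sumr; apply: ler_wpM2l.
  by rewrite mulr_ge0 // Pr_ge0 //; apply: cyl_cS_mem.
apply: le_trans (HB y).
apply: (@le_trans _ _ (\sum_(u <- ball nbr n.+1 v) tau p n y u)).
  rewrite [leRHS](bigID (fun u => u \notin S)) /= lerDl; apply: sumr_ge0 => u _.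
  by apply: Pr_ge0 => //; apply: cyl_tau.
rewrite -E_sum; last by move=> u; apply/cyl_natr/cyl_tau.
apply: E_le => //.
- by apply: cyl_sum => u; apply/cyl_natr/cyl_tau.
- exact/cyl_size/(cyl_reach G).
- by move=> om; apply: sum_mem_le; apply: reach_uniq.
Qed.

(** The bound is the fixed point of [B = L + rho * B], so [chi_step] preserves it along the
    induction on [n]. *)
Lemma chi_bound p L rho : 0 <= p <= 1 -> rho < 1 ->
  (forall v, exists S, [/\ v \in S, (size S <= L)%N & phi p S v <= rho]) ->
  forall n v, chi p n v <= L%:R / (1 - rho).
Proof.
move=> p01 rho1 H; have r1 : 0 < 1 - rho by rewrite subr_gt0.
have phi0 S v : 0 <= phi p S v.
  apply: mulr_ge0; first by case/andP: p01.
  apply: sumr_ge0 => x _; apply: sumr_ge0 => y _; apply: Pr_ge0 => //; exact: cyl_cS_mem.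
have B0 : 0 <= L%:R / (1 - rho) by rewrite divr_ge0 // ltW.
elim=> [|n IH] v.
  rewrite /chi /= E_cst; have [S [vS SL Sr]] := H v.
  have L1 : (1 : R) <= L%:R.
    by rewrite ler1n; apply: leq_trans SL; case: S vS {Sr}.
  rewrite ler_pdivlMr // mul1r; apply: le_trans L1; rewrite gerBl.
  exact: le_trans (phi0 S v) Sr.
have [S [vS SL Sr]] := H v.
apply: le_trans (chi_step p01 vS B0 IH) _.
apply: (@le_trans _ _ (L%:R + rho * (L%:R / (1 - rho)))).
  by apply: lerD; [rewrite ler_nat|apply: ler_wpM2r].
rewrite le_eqVlt; apply/orP; left; apply/eqP; field; lra.
Qed.

Lemma big_chi p N v : 0 <= p <= 1 -> N%:R * Pr p (fun om => big om v N) <= chi p N v.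
Proof.
move=> p01; rewrite -EZ; last exact/cyl_natr/(cyl_big G).
apply: E_le => //.
- by apply: cylM; [apply: cyl_cst|apply/cyl_natr/(cyl_big G)].
- exact/cyl_size/(cyl_reach G).
- move=> om; rewrite /big; case: leqP => h; rewrite ?mulr1 ?mulr0 ?ler_nat //; exact: ler0n.
Qed.

(** * The differential inequality of Duminil-Copin and Tassion *)

Definition out (Lam : seq V) om z : bool := `[< exists w, conn om z w /\ w \notin Lam >].

Lemma outP Lam om z : out Lam om z <-> exists w, conn om z w /\ w \notin Lam.
Proof. by split=> [/asboolP|h]; last exact/asboolP. Qed.

Lemma out_notin Lam om z : z \notin Lam -> out Lam om z.
Proof. by move=> h; apply/outP; exists z; split=> //; apply: conn_refl. Qed.

Lemma out_conn Lam om x y : conn om x y -> out Lam om y -> out Lam om x.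
Proof.
by move=> xy /outP[w [yw wL]]; apply/outP; exists w; split=> //; apply: conn_trans xy yw.
Qed.

Lemma out_mono Lam om om' z : (forall e, om e ==> om' e) -> out Lam om z -> out Lam om' z.
Proof.
by move=> H /outP[w [zw wL]]; apply/outP; exists w; split=> //; apply: conn_mono H zw.
Qed.

(* Exploring towards the outside only queries edges with an endpoint from which
   the outside is reached in the other configuration. *)
Lemma out_transfer Lam om om' z :
  (forall x y, eo om x y -> x \in Lam -> out Lam om x -> out Lam om' y -> out Lam om' x) ->
  out Lam om z -> out Lam om' z.
Proof.
move=> H /outP[w [[s [ps <-]] wL]].
elim: s z ps wL => [|y s IH] z /=; first by move=> _; apply: out_notin.
move=> [ezy ps] wL; case: (boolP (z \in Lam)) => zL; last exact: out_notin.
apply: (H _ _ ezy zL _ (IH _ ps wL)); apply/outP; exists (last y s); split=> //.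
by exists (y :: s).
Qed.

Lemma dep_out Lam z : dep [pred e in tE nbr Lam] (fun om => out Lam om z).
Proof.
suff H om om' : (forall e, e \in tE nbr Lam -> om e = om' e) -> out Lam om z -> out Lam om' z.
  split=> om om' E; apply/idP/idP; apply: H => // e eL; symmetry; exact: E.
move=> E; apply: out_transfer => x y exy xL _; apply: out_conn; apply: conn_eo.
by rewrite -(eo_agree G _ E).
Qed.

(** The random set of Duminil-Copin and Tassion, revealed by exploring from outside [Lam]
    inwards. *)
Definition Sin Lam om := [seq z <- Lam | ~~ out Lam om z].

Lemma dep_Sin Lam : dep [pred e in tE nbr Lam] (fun om => Sin Lam om).
Proof.
split=> om om' H; apply: eq_filter => z; congr (~~ _).
exact: (depP (dep_out Lam z)).
Qed.

(** The exploration from the outside never looks at an edge with both endpoints in the unreached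
    set. Conditionally on that set being [S], percolation inside [S] is thus untouched. *)
Lemma dep_Sin_eq Lam S :
  dep [pred e | ~~ (((val e).1 \in S) && ((val e).2 \in S))] (fun om => Sin Lam om == S).
Proof.
suff H om om' : (forall e, ~~ (((val e).1 \in S) && ((val e).2 \in S)) -> om e = om' e) ->
    Sin Lam om = S -> Sin Lam om' = S.
  split=> om om' E; apply/eqP/eqP; apply: H => // e eS; symmetry; exact: E.
move=> E eqS; rewrite -[RHS]eqS; apply: eq_filter => z; congr (~~ _).
have eoE x y : (x \notin S) || (y \notin S) -> eo om x y = eo om' x y.
  move=> h; rewrite /eo; case Exy : (ed nbr x y) => [e|//]; apply: E.
  by rewrite negb_and; case: (ed_val Exy) => -> //=; rewrite orbC.
have nS x : out Lam om x -> x \notin S.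
  by move=> h; rewrite -eqS mem_filter h.
apply/idP/idP; apply: out_transfer => x y exy xL ox oy; apply: (out_conn _ oy); apply: conn_eo.
  by rewrite eoE // (nS y) // orbT.
by rewrite -eoE // (nS x).
Qed.

Definition notout Lam v0 om : R := (~~ out Lam om v0)%:R.

Lemma dep_notout Lam v0 : dep [pred e in tE nbr Lam] (notout Lam v0).
Proof. exact: (dep_comp (fun b => (~~ b)%:R) (dep_out Lam v0)). Qed.

Lemma cyl_notout Lam v0 : cyl (notout Lam v0).
Proof. by exists (tE nbr Lam); apply: dep_notout. Qed.

Lemma notout_upd Lam v0 om e : notout Lam v0 (upd om e true) <= notout Lam v0 (upd om e false).
Proof.
rewrite /notout ler_nat; case: (boolP (out _ (upd om e true) _)) => //= h.
suff -> : ~~ out Lam (upd om e false) v0 by [].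
apply: contra h; apply: out_mono; by apply: upd_incr => // x; apply/implyP.
Qed.

(** An edge from [x \in S], joined to [v0] inside [S], to some [y \notin S] must be closed, since
    [y] reaches the outside and [x] does not. Opening it lets [v0] escape, so it is pivotal. *)
Lemma pivotal_pointwise Lam v0 om (S := Sin Lam om) : uniq Lam -> v0 \in Lam ->
  (v0 \in S)%:R * (\sum_(x <- S) \sum_(y <- nbr x | y \notin S) (x \in cS S om v0)%:R) <=
  \sum_(e <- tE nbr Lam) (notout Lam v0 (upd om e false) - notout Lam v0 (upd om e true)).
Proof.
move=> uL v0L; have nn e : 0 <= notout Lam v0 (upd om e false) - notout Lam v0 (upd om e true).
  by rewrite subr_ge0 notout_upd.
case: (boolP (v0 \in S)) => v0S; last by rewrite mul0r; apply: sumr_ge0.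
have uS : uniq S by apply: filter_uniq.
have nS x : x \in S -> ~~ out Lam om x by rewrite mem_filter => /andP[].
have oS x : x \notin S -> out Lam om x.
  rewrite mem_filter negb_and negbK => /orP[//|]; exact: out_notin.
rewrite mul1r; under eq_bigr do rewrite big_mkcond /=.
rewrite sum_pairs_edges //.
apply: (@le_trans _ _ (\sum_(e <- tE nbr S) (notout Lam v0 (upd om e false) - notout Lam v0 (upd om e true)))); last first.
  have HP : perm_eq (tE nbr S) [seq e <- tE nbr Lam | e \in tE nbr S].
    apply: uniq_perm; rewrite ?filter_uniq ?tE_uniq // => e; rewrite mem_filter.
    case: (boolP (e \in tE nbr S)) => //=; rewrite !(mem_tE G) => /orP[]; rewrite mem_filter => /andP[_ ->] //.
    by rewrite orbT.
  rewrite (perm_big _ HP) big_filter [leRHS](bigID (fun e => e \in tE nbr S)) /= lerDl.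
  by apply: sumr_ge0 => e _.
have key e x y : ed nbr x y = Some e -> x \in S -> y \notin S -> x \in cS S om v0 ->
   notout Lam v0 (upd om e false) - notout Lam v0 (upd om e true) = 1.
  move=> E xS yS xc; have v0x : conn om v0 x.
    by apply: (conn_mono _ ((cSP _ _ v0S).1 xc)) => e'; apply: rs_le.
  have ce : om e = false.
    apply/negbTE/negP => oe; move: (nS _ xS); apply/negP; rewrite negbK.
    by apply: (out_conn _ (oS _ yS)); apply: conn_eo; rewrite /eo E.
  have le : forall e', om e' ==> upd om e true e'.
    by move=> e'; rewrite /upd; case: eqP => [_|_]; rewrite ?implybT ?implybb.
  rewrite -{1}ce upd_id /notout nS // (_ : out Lam (upd om e true) v0 = true) ?subr0 //.
  apply: (out_conn (conn_mono le v0x)); apply: out_conn (out_mono le (oS _ yS)).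
  by apply: conn_eo; rewrite /eo E upd_same.
apply: ler_sum => e _; have k1 := key e _ _ (ed_fst_snd e); have k2 := key e _ _ (ed_snd_fst e).
case: (boolP ((val e).1 \in S)) => h1; case: (boolP ((val e).2 \in S)) => h2 //=;
  rewrite ?addr0 ?add0r //; case: (boolP (_ \in cS _ _ _)) => h3 //.
  by rewrite k1.
by rewrite k2.
Qed.

(** By independence on [Sin Lam om = S], the mean number of pivotal edges there is at least the
    double sum in [phi p S v0], and this is at least [phi p S v0 >= 1] because [p <= 1]. *)
Lemma russo_lower p Lam v0 : 0 <= p <= 1 -> uniq Lam -> v0 \in Lam ->
  (forall S, v0 \in S -> 1 <= phi p S v0) ->
  E p (notout Lam v0) <= \sum_(e <- tE nbr Lam)
    E p (fun om => notout Lam v0 (upd om e false) - notout Lam v0 (upd om e true)).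
Proof.
move=> p01 uL v0L H; have /andP[p0 p1] := p01.
have cyS : cyl (fun om => Sin Lam om) by exists (tE nbr Lam); apply: dep_Sin.
have [Ss [uSs SsP]] := cyl_values cyS.
pose F (S : seq V) om : R := (v0 \in S)%:R * (\sum_(x <- S) \sum_(y <- nbr x | y \notin S) (x \in cS S om v0)%:R).
have cX S : cyl (fun om => \sum_(x <- S) \sum_(y <- nbr x | y \notin S) (x \in cS S om v0)%:R : R).
  by apply: cyl_sum => x; apply: cyl_sum => y; apply/cyl_natr/cyl_cS_mem.
have cF S : cyl (F S) by apply: cylM => //; apply: cyl_cst.
have cdiff e : cyl (fun om => notout Lam v0 (upd om e false) - notout Lam v0 (upd om e true)).
  by apply: cylD; [|apply: cylN]; apply: cyl_upd; apply: cyl_notout.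
rewrite -E_sum //.
have cFS : cyl (fun om => F (Sin Lam om) om).
  exists (tE nbr Lam); split=> om om' E.
  rewrite /F (depP (dep_Sin Lam) E); congr (_ * _).
  apply: eq_bigr => x _; apply: eq_bigr => y _; congr (_ \in _)%:R.
  have dd := dep_sub (dep_cS (Sin Lam om') v0) (D' := [pred e in tE nbr Lam]).
  apply: (depP (dd _) E) => e /=; rewrite (mem_tE G) => /andP[]; rewrite mem_filter => /andP[_ ->] //.
apply: (@le_trans _ _ (E p (fun om => F (Sin Lam om) om))); last first.
  apply: E_le => //; first exact: cyl_sum.
  by move=> om; apply: pivotal_pointwise.
rewrite (E_total p uSs SsP cyS cF).
have -> : E p (notout Lam v0) = \sum_(S <- Ss) E p (fun om => (Sin Lam om == S)%:R * (v0 \in S)%:R).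
  rewrite -(E_total p (F := fun (S : seq V) om => (v0 \in S)%:R) uSs SsP cyS); last first.
    by move=> S; apply: cyl_cst.
  by apply: eq_E => om; rewrite mem_filter v0L andbT.
apply: ler_sum => S _.
have cS1 : cyl (fun om => (Sin Lam om == S)%:R : R).
  by apply: cyl_natr; apply: (cyl_comp (fun s => s == S)).
have d1 := dep_comp (fun b : bool => b%:R : R) (dep_Sin_eq Lam S).
have d2 : dep [pred e | (val e).1 \in S & (val e).2 \in S] (F S).
  exact: (dep_comp (fun C => (v0 \in S)%:R * (\sum_(x <- S) \sum_(y <- nbr x | y \notin S) (x \in C)%:R)) (dep_cS S v0)).
rewrite (E_indep p cS1 (cF S) d1 d2); last by move=> e /=.
case: (boolP (v0 \in S)) => v0S; last first.
  rewrite (@eq_E _ _ _ _ (fun=> 0)) ?E_cst; last by move=> om; rewrite mulr0.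
  rewrite (@eq_E _ _ _ (F S) (fun=> 0)) ?E_cst ?mulr0 // => om.
  by rewrite /F (negbTE v0S) mul0r.
rewrite (@eq_E _ _ _ _ (fun om => (Sin Lam om == S)%:R)); last by move=> om; rewrite mulr1.
rewrite ler_peMr //; first by apply: E_ge0.
have -> : E p (F S) = \sum_(x <- S) \sum_(y <- nbr x | y \notin S) Pr p (fun om => x \in cS S om v0).
  rewrite (@eq_E _ _ _ (F S) (fun om => \sum_(x <- S) \sum_(y <- nbr x | y \notin S) (x \in cS S om v0)%:R)).
    rewrite E_sum; last by move=> x; apply: cyl_sum => y; apply/cyl_natr/cyl_cS_mem.
    by apply: eq_bigr => x _; rewrite E_sum // => y; apply/cyl_natr/cyl_cS_mem.
  by move=> om; rewrite /F v0S mul1r.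
apply: le_trans (H S v0S) _; rewrite /phi ler_piMl //.
apply: sumr_ge0 => x _; apply: sumr_ge0 => y _; apply: Pr_ge0 => //; exact: cyl_cS_mem.
Qed.

Lemma phi_incr p p' S v : 0 <= p -> p <= p' -> p' <= 1 -> phi p S v <= phi p' S v.
Proof.
move=> p0 pp' p'1; have p'0 := le_trans p0 pp'; have p1 := le_trans pp' p'1.
have X0 x : 0 <= Pr p (fun om => x \in cS S om v) by apply: Pr_ge0; rewrite ?p0 //; apply: cyl_cS_mem.
apply: ler_pM => //; first by apply: sumr_ge0 => x _; apply: sumr_ge0.
apply: ler_sum => x _; apply: ler_sum => y _; apply: E_incr_p => //.
  exact/cyl_natr/cyl_cS_mem.
move=> om om' H; rewrite ler_nat; case: (boolP (x \in cS S om v)) => // h.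
rewrite (reach_mono G _ h) // => e; rewrite /rs.
by case: (om e) (H e) => //= ->; rewrite implybb.
Qed.

(** The inequality [f' <= - f] holds on all of [[p, p']] since [phi] increases with [p]. So
    [f q * expR q] is nonincreasing there, and [f p <= 1]. *)
Lemma notout_decay p p' Lam v0 : 0 <= p -> p <= p' -> p' <= 1 -> uniq Lam -> v0 \in Lam ->
  (forall S, v0 \in S -> 1 <= phi p S v0) ->
  E p' (notout Lam v0) <= expR (p - p').
Proof.
move=> p0 pp' p'1 uL v0L H; have p1 := le_trans pp' p'1.
set f := fun q : R => E q (notout Lam v0).
set D := fun q : R => \sum_(e <- tE nbr Lam)
    E q (fun om => notout Lam v0 (upd om e true) - notout Lam v0 (upd om e false)).
have df (q : R) : is_derive q 1 f (D q) := E_russo q (tE_uniq Lam) (dep_notout Lam v0).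
have dg (q : R) : is_derive q 1 (fun q : R => f q * expR q) (f q * expR q + expR q * D q).
  have := is_deriveM (df q) (is_derive_expR q).
  by move=> H1; apply: (is_derive_eq H1).
have DL q : p <= q <= p' -> D q <= - f q.
  move=> /andP[pq qp']; rewrite -subr_le0 opprK.
  have q01 : 0 <= q <= 1 by rewrite (le_trans p0 pq) (le_trans qp' p'1).
  have := russo_lower q01 uL v0L (fun S vS => le_trans (H S vS) (phi_incr S v0 p0 pq (le_trans qp' p'1))).
  rewrite -subr_ge0 -oppr_le0 opprB addrC; congr (_ + _ <= _).
  rewrite /D -sumrN; apply: eq_bigr => e _; rewrite -EN; last first.
    by apply: cylD; [|apply: cylN]; apply: cyl_upd; apply: cyl_notout.
  by apply: eq_E => om; rewrite opprB.
have := @ler0_derive1_le_cc R (fun q => f q * expR q) p p'.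
have fp1 : f p <= 1.
  rewrite -(E_cst (T := Edge nbr) p 1); apply: E_le; rewrite ?p0 //; first exact: cyl_notout.
    exact: cyl_cst.
  by move=> om; rewrite /notout lern1 leq_b1.
move=> HH; have {HH} : f p' * expR p' <= f p * expR p.
  apply: HH.
  - move=> x _; have [] := dg x; done.
  - move=> x; rewrite in_itv /= => /andP[px xp']; rewrite derive1E (derive_val (is_derive := dg x)).
    rewrite (mulrC (f x)) -mulrDr mulr_ge0_le0 ?expR_ge0 //.
    by rewrite -lerBrDl sub0r DL // !ltW.
  - apply: continuous_subspaceT => x; apply: differentiable_continuous.
    apply/derivable1_diffP; have [] := dg x; done.
  - by rewrite in_itv /= lexx pp'.
  - by rewrite in_itv /= lexx pp'.
  - exact: pp'.
move=> h; rewrite expRD expRN ler_pdivlMr ?expR_gt0 //.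
by apply: le_trans h _; rewrite ler_piMl ?expR_ge0.
Qed.

(** A cluster leaving the ball of radius [n] cannot be exhausted in [n] steps. The lower bound does
    not depend on [n], and this is what contradicts subcriticality of [p']. *)
Lemma big_lower p p' v0 n : 0 <= p -> p <= p' -> p' <= 1 ->
  (forall S, v0 \in S -> 1 <= phi p S v0) ->
  1 - expR (p - p') <= Pr p' (fun om => big om v0 n).
Proof.
move=> p0 pp' p'1 H; have p'01 : 0 <= p' <= 1 by rewrite (le_trans p0 pp').
have uB : uniq (ball nbr n v0) by apply: reach_uniq.
have := notout_decay p0 pp' p'1 uB (mem_reach0 G _ _ _) H.
rewrite lerBlDr -lerBlDl; apply: le_trans.
rewrite lerBlDl -(E_cst (T := Edge nbr) p' 1) -ED; last 2 first.
- exact/cyl_natr/(cyl_big G).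
- exact: cyl_notout.
apply: E_le => //; first exact: cyl_cst.
  by apply: cylD; [exact/cyl_natr/(cyl_big G)|exact: cyl_notout].
move=> om; rewrite /notout -natrD ler1n addn_gt0.
case: (boolP (out _ _ _)) => h; rewrite ?orbT // orbF.
have [w [vw wB]] := (outP _ _ _).1 h.
case: (boolP (big om v0 n)) => // nb.
by move: wB; rewrite (reach_ball G ((mem_fin G _ nb).2 vw)).
Qed.

End Sharpness.

(** * The law of percolation and the 0-1 law *)

Section Law.
Context {R : realType} {V : countType} {nbr : V -> seq V}.
Hypothesis G : simple_graph nbr.
Local Notation cfg := (Edge nbr -> bool).
Context {d : measure_display} {Omega : measurableType d} {P : probability Omega R}
  {p : R} {omega : Omega -> cfg}.
Hypothesis B : bernoulli_perc p P omega.

Implicit Types (om : cfg) (v : V).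

Let ev (A : cfg -> bool) : set Omega := [set x | A (omega x)].

Lemma ev_upd (A : cfg -> bool) e :
  ev A = ([set x | omega x e] `&` ev (fun om => A (upd om e true))) `|`
         (~` [set x | omega x e] `&` ev (fun om => A (upd om e false))).
Proof.
apply/seteqP; split=> x; rewrite /ev /=.
  move=> Ax; case E : (omega x e); [left|right]; split=> //;
  by rewrite -E upd_id.
by case=> -[] E; [|move/negP/negbTE in E]; rewrite -{1}E upd_id.
Qed.

Lemma measurable_cyl (A : cfg -> bool) : cyl A -> measurable (ev A).
Proof.
move=> [L]; elim: L A => [|e L IH] A dA.
  have -> : ev A = [set x | A (fun=> false)].
    have E om : A om = A (fun=> false) by apply: (depP dA).
    by apply/seteqP; split=> x; rewrite /ev /= E.
  case: (A _); [suff -> : [set x : Omega | true] = setT by exact: measurableT|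
    suff -> : [set x : Omega | false] = set0 by exact: measurable0]; by apply/seteqP; split.
have H b : dep [pred x in L] (fun om => A (upd om e b)).
  split=> om om' E; apply: (depP dA) => x; rewrite /= inE /upd.
  by case: (x =P e) => //= _ /E.
rewrite (ev_upd A e); apply: measurableU; apply: measurableI; try exact: IH.
  exact: (B.1 e).
by apply: measurableC; exact: (B.1 e).
Qed.

(** [F] holds the revealed edges and [L] those still to be averaged. Splitting on the next edge
    moves it from [L] to [F], so that only full patterns remain at the end, and their probabilities
    are given by [bernoulli_perc]. *)
Lemma prob_cyl_pattern (L F : seq (Edge nbr)) (b : cfg) (A : cfg -> bool) : uniq (F ++ L) ->
  dep [pred e in F ++ L] A ->
  P ([set x | forall e, e \in F -> omega x e = b e] `&` ev A) =
  ((\prod_(e <- F) (if b e then p else 1 - p)) * Ex p L (fun om => (A om)%:R) b)%:E.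
Proof.
elim: L F b => [|e L IH] F b.
  rewrite cats0 => uF dA /=; set Pt := [set x | _].
  have H x : Pt x -> A (omega x) = A b by move=> Px; apply: (depP dA).
  case Ab : (A b); last first.
    rewrite mulr0 (_ : _ `&` _ = set0) ?measure0 //; apply/seteqP; split=> // x [Px].
    by rewrite /ev /= H // Ab.
  rewrite mulr1 -(B.2 F b uF); congr (P _); apply/seteqP; split=> [x []//|x Px]; split=> //.
  by rewrite /ev /= H.
move=> uFL dA.
have perm : perm_eq (F ++ e :: L) ((e :: F) ++ L) by rewrite -cat_rcons perm_cat2r perm_rcons.
have uFL' : uniq ((e :: F) ++ L) by rewrite -(perm_uniq perm).
have dA' : dep [pred x in (e :: F) ++ L] A.
  by apply: (dep_sub dA) => x; rewrite /= (perm_mem perm).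
have eF : e \notin F by move: uFL'; rewrite /= mem_cat negb_or => /andP[/andP[]].
pose Pt c := [set x | forall e', e' \in e :: F -> omega x e' = upd b e c e'].
have mPt c : measurable (Pt c).
  rewrite (_ : Pt c = ev (fun om => all (fun e' => om e' == upd b e c e') (e :: F))).
    apply: measurable_cyl; exists (e :: F); split=> om om' E.
    by apply: eq_in_all => e' e'F; rewrite E.
  apply/seteqP; split=> x; rewrite /Pt /ev /=.
    move=> H; apply/andP; split; first by apply/eqP/H/mem_head.
    by apply/allP => e' e'F; apply/eqP/H; rewrite inE e'F orbT.
  by move=> /andP[/eqP h1 /allP h2] e'; rewrite inE => /orP[/eqP ->//|/h2/eqP].
have mA : measurable (ev A) by apply: measurable_cyl; exists (F ++ e :: L).
have split_set : [set x | forall e0, e0 \in F -> omega x e0 = b e0] `&` ev A =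
    (Pt true `&` ev A) `|` (Pt false `&` ev A).
  have ne e' : e' \in F -> (e' == e) = false.
    by move=> e'F; apply/eqP => E; rewrite E (negbTE eF) in e'F.
  rewrite -setIUl; congr (_ `&` _); apply/seteqP; split=> x; rewrite /Pt /=.
    move=> H; case E : (omega x e); [left|right] => e'; rewrite inE => /orP[/eqP ->|e'F];
    by rewrite ?upd_same // /upd ne // H.
  by case=> H e' e'F; rewrite (H e') ?inE ?e'F ?orbT // /upd ne.
transitivity (P (Pt true `&` ev A) + P (Pt false `&` ev A))%E.
  rewrite split_set; apply: measureU; [exact: measurableI..|].
  apply/seteqP; split=> // x [] [H1 _] [H2 _].
  by have := H1 e (mem_head _ _); rewrite (H2 e (mem_head _ _)) !upd_same.
rewrite (IH (e :: F) (upd b e true) uFL' dA' : P (Pt true `&` ev A) = _).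
rewrite (IH (e :: F) (upd b e false) uFL' dA' : P (Pt false `&` ev A) = _).
rewrite -EFinD; congr EFin; rewrite !big_cons !upd_same /=.
have pr c : \prod_(j <- F) (if upd b e c j then p else 1 - p) =
   \prod_(j <- F) (if b j then p else 1 - p).
  rewrite big_seq [RHS]big_seq; apply: eq_bigr => j jF.
  by rewrite upd_other //; apply: contraNneq eF => <-.
rewrite !pr; ring.
Qed.

Lemma prob_cyl (A : cfg -> bool) : cyl A -> P (ev A) = (Pr p A)%:E.
Proof.
move=> [L dL].
have dU : dep [pred e in [::] ++ undup L] A.
  by apply: (dep_sub dL) => e /=; rewrite mem_undup.
have := prob_cyl_pattern (fun=> false) (undup_uniq L : uniq ([::] ++ undup L)) dU.
rewrite big_nil mul1r /Pr (@E_Ex _ _ _ (undup L) _ (fun=> false)); last first.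
  exact: (dep_comp (fun b : bool => b%:R : R) dU).
by move=> <-; congr (P _); apply/seteqP; split=> [x Ax|x []//]; split=> // e.
Qed.

Lemma prob_fin (A : set Omega) : measurable A -> P A \is a fin_num.
Proof. by move=> mA; apply: fin_num_measure. Qed.

Lemma indep_bigcup (A : (set Omega)^nat) (C : set Omega) : (forall n, measurable (A n)) ->
  measurable C -> nondecreasing_seq A -> (forall n, P (A n `&` C) = (P (A n) * P C)%E) ->
  P ((\bigcup_n A n) `&` C) = (P (\bigcup_n A n) * P C)%E.
Proof.
move=> mA mC nd H.
have mU : measurable (\bigcup_n A n) by apply: bigcup_measurable.
have c1 := nondecreasing_cvg_mu (mu := P) mA mU nd.
have := nondecreasing_cvg_mu (mu := P) (F := fun n => A n `&` C) (fun n => measurableI _ _ (mA n) mC).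
rewrite -setI_bigcupl => /(_ (measurableI _ _ mU mC)) c2.
have /c2 {}c2 : nondecreasing_seq (fun n => A n `&` C).
  by move=> m n mn; apply/subsetPset; apply: setSI; apply/subsetPset; apply: nd.
have c3 := cvgeZr (prob_fin mC) c1.
apply: (cvg_unique (@ereal_hausdorff R) c2).
rewrite (_ : P \o _ = (fun n => (P \o A) n * P C)%E) //.
by apply/funext => n /=; rewrite H.
Qed.

Lemma indep_setC (A C : set Omega) : measurable A -> measurable C ->
  P (A `&` C) = (P A * P C)%E -> P (~` A `&` C) = (P (~` A) * P C)%E.
Proof.
move=> mA mC H; rewrite probability_setC // muleBl ?prob_fin //.
rewrite mul1e -H (measureDI P mC mA) setDE [C `&` A]setIC [~` A `&` C]setIC addeK //.
by apply: prob_fin; apply: measurableI.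
Qed.

Lemma indep_bigcap (A : (set Omega)^nat) (C : set Omega) : (forall n, measurable (A n)) ->
  measurable C -> nonincreasing_seq A -> (forall n, P (A n `&` C) = (P (A n) * P C)%E) ->
  P ((\bigcap_n A n) `&` C) = (P (\bigcap_n A n) * P C)%E.
Proof.
move=> mA mC ni H; rewrite -[\bigcap_n A n]setCK setC_bigcap.
have mAC n : measurable (~` A n) by apply: measurableC.
apply: indep_setC => //; first exact: bigcup_measurable.
apply: indep_bigcup => //; last by move=> n; apply: indep_setC.
by move=> m n mn; apply/subsetPset/subsetC/subsetPset; apply: ni.
Qed.

Lemma finite_clusterP om v : finite_set (Defs.cluster om v) <-> exists N, ~~ big om v N.
Proof.
split.
  move/finite_seqP => [s Hs]; exists (size s).+1; apply/negP => /(bigP G)[t [ut tN tc]].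
  have sub : {subset t <= s}.
    by move=> z /tc /clusterE; rewrite Hs.
  by have := uniq_leq_size ut sub; rewrite tN ltnn.
move=> [N nb]; apply: (sub_finite_set _ (finite_seq (reach N om v))) => w /clusterE.
by move=> /(mem_fin G _ nb).
Qed.

Lemma finite_listP om v :
  (exists N, ~~ big om v N) <-> exists l : seq V, forall w, conn om v w -> w \in l.
Proof.
split=> [[N nb]|[l H]]; first by exists (reach N om v) => w /(mem_fin G _ nb).
exists (size l).+1; apply/negP => /(bigP G)[t [ut tN tc]].
have sub : {subset t <= l} by move=> z /tc /H.
by have := uniq_leq_size ut sub; rewrite tN ltnn.
Qed.

Definition close (F : seq (Edge nbr)) om : cfg := fun e => (e \notin F) && om e.

(** Reopening the finitely many edges of [F] joins only finitely many clusters. Finiteness of all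
    clusters is therefore a tail property. *)
Lemma finite_close F om : (forall v, exists N, ~~ big (close F om) v N) ->
  forall v, exists N, ~~ big om v N.
Proof.
move=> H v.
have /choice[l Hl] : forall v, exists l : seq V, forall w, conn (close F om) v w -> w \in l.
  by move=> z; apply/finite_listP.
have key w : conn om v w -> conn (close F om) v w \/
    exists2 e, e \in F & conn (close F om) (val e).1 w \/ conn (close F om) (val e).2 w.
  move: w; apply: conn_ind; first by left; apply: conn_refl.
  move=> a b _ IH; rewrite /eo; case E : (ed nbr a b) => [e|//] oe.
  case: (boolP (e \in F)) => eF.
    right; exists e => //; case: (ed_val E) => -> /=; [right|left]; exact: conn_refl.
  have eab : conn (close F om) a b by apply: conn_eo; rewrite /eo E /close eF.
  case: IH => [h|[e' e'F h]]; first by left; apply: conn_trans h eab.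
  by right; exists e' => //; case: h => h; [left|right]; apply: conn_trans h eab.
apply/finite_listP; exists (l v ++ flatten [seq l (val e).1 ++ l (val e).2 | e <- F]) => w.
case/key => [h|[e eF h]]; rewrite mem_cat; first by rewrite Hl.
apply/orP; right; apply/flattenP; exists (l (val e).1 ++ l (val e).2).
  exact: (map_f (fun e => l (val e).1 ++ l (val e).2)).
by rewrite mem_cat; case: h => h; rewrite (Hl _ _ h) ?orbT.
Qed.

Lemma close_le F om e : close F om e ==> om e.
Proof. by apply/implyP => /andP[]. Qed.

Definition vs k : seq V := pmap (@choice.unpickle V) (iota 0 k).

Definition inf_event : set Omega := [set x | exists v, ~ finite_set (Defs.cluster (omega x) v)].

Let Ev F k N : set Omega := ev (fun om => has (fun v => big (close F om) v N) (vs k)).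

Lemma cyl_has F k N : cyl (fun om => has (fun v => big (close F om) v N) (vs k)).
Proof.
elim: (vs k) => [|v s IH] /=; first exact: cyl_cst.
apply: (cyl_comp2 orb _ IH).
have [L dL] := cyl_big G N v; exists L; split=> om om' E; apply: (depP dL) => e eL.
by rewrite /close E.
Qed.

(** Finitely many vertices in finite clusters have a common size bound, so the choice of the vertex
    among the first [k] may depend on [N]. The event becomes a monotone limit of cylinder events
    that ignore the edges of [F]. *)
Lemma inf_eventE F : inf_event = \bigcup_k \bigcap_N Ev F k N.
Proof.
apply/seteqP; split=> x.
  move=> [v nf]; have [v' Hv'] : exists v', forall N, big (close F (omega x)) v' N.
    apply: contrapT => /forallNP H; apply: nf; apply/finite_clusterP.
    move: v; apply: (finite_close (F := F)) => v; apply: contrapT => /forallNP H2; apply: (H v) => N.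
    by apply/negPn/negP; apply: H2.
  exists (choice.pickle v').+1 => // N _; rewrite /Ev /ev /=; apply/hasP; exists v' => //.
  rewrite mem_pmap; apply/mapP; exists (choice.pickle v'); first by rewrite mem_iota /=.
  by rewrite choice.pickleK.
move=> [k _ H]; apply: contrapT => /forallNP nf.
have /choice[n Hn] : forall v, exists N, ~~ big (omega x) v N.
  by move=> v; apply/finite_clusterP; apply: contrapT; apply: nf.
have /hasP[v vk bv] := H (\max_(v <- vs k) n v)%N I.
have le : (n v <= \max_(v <- vs k) n v)%N by apply: leq_bigmax_seq.
have := Hn v; rewrite (big_le G le) //.
by apply: (big_mono G _ bv) => e; apply: close_le.
Qed.

Lemma measurable_Ev F k N : measurable (Ev F k N).
Proof. by apply: measurable_cyl; apply: cyl_has. Qed.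

Lemma measurable_cap F k : measurable (\bigcap_N Ev F k N).
Proof. by apply: bigcap_measurable => // N _; apply: measurable_Ev. Qed.

Lemma measurable_inf : measurable inf_event.
Proof.
by rewrite (inf_eventE [::]); apply: bigcup_measurable => k _; apply: measurable_cap.
Qed.

Lemma indep_inf F (C : set Omega) : measurable C ->
  (forall k N, P (Ev F k N `&` C) = (P (Ev F k N) * P C)%E) ->
  P (inf_event `&` C) = (P inf_event * P C)%E.
Proof.
move=> mC H; rewrite (inf_eventE F); apply: indep_bigcup => //.
- by move=> k; apply: measurable_cap.
- move=> k k' kk'; apply/subsetPset => x Hx N _; have /hasP[v vk bv] := Hx N I.
  apply/hasP; exists v => //; move: vk; rewrite !mem_pmap => /mapP[i]; rewrite mem_iota /= add0n => ik Ev'.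
  by apply/mapP; exists i => //; rewrite mem_iota /= add0n (leq_trans ik).
- move=> k; apply: indep_bigcap => //; first by move=> N; apply: measurable_Ev.
  move=> N N' NN'; apply/subsetPset => x /hasP[v vk bv]; apply/hasP; exists v => //.
  exact: big_le bv.
Qed.

(** The event is independent of every cylinder event, hence of itself. The law is required because
    [percolates] asks for probability one: its failure has to be strengthened to probability
    zero. *)
Lemma zero_one : P inf_event = 0%E \/ P inf_event = 1%E.
Proof.
have indep_cyl (A : cfg -> bool) : cyl A -> P (inf_event `&` ev A) = (P inf_event * P (ev A))%E.
  move=> [F dF]; have cA : cyl A by exists F.
  apply: (indep_inf (F := F)); first exact: measurable_cyl.
  move=> k N; have cH := cyl_has F k N.
  have -> : Ev F k N `&` ev A = ev (fun om => has (fun v => big (close F om) v N) (vs k) && A om).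
    by apply/seteqP; split=> x; rewrite /Ev /ev /=; move/andP.
  rewrite !prob_cyl //; last exact: cyl_and.
  rewrite -EFinM; congr EFin.
  rewrite -(E_indep (D := [pred e | e \notin F]) (D' := [pred e in F]) p (cyl_natr cH) (cyl_natr cA)).
  - by apply: eq_E => om; rewrite -natrM mulnb.
  - split=> om om' E; congr (has _ _)%:R; apply/funext => v; congr (big _ _ _).
    apply/funext => e; rewrite /close; case: (boolP (e \in F)) => //= eF; exact: E.
  - exact: (dep_comp (fun b : bool => b%:R : R) dF).
  - by move=> e /=.
have H : P inf_event = (P inf_event * P inf_event)%E.
  rewrite -{1}[inf_event]setIid; apply: (indep_inf (F := [::])); first exact: measurable_inf.
  move=> k N; have h := indep_cyl _ (cyl_has [::] k N).
  by rewrite [LHS](_ : _ = P (inf_event `&` Ev [::] k N)); [rewrite [RHS]muleC|rewrite setIC].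
have := prob_fin measurable_inf; case: (P inf_event) H => [r| |] //= [rr] _.
have : r * (r - 1) = 0 by rewrite mulrBr -rr mulr1 subrr.
by move/eqP; rewrite mulf_eq0 subr_eq0 => /orP[]/eqP ->; [left|right].
Qed.

Lemma big_small v (eps : R) : P inf_event <> 1%E -> 0 < eps ->
  exists N, Pr p (fun om => big om v N) < eps.
Proof.
move=> ne1 eps0; have P0 : P inf_event = 0%E by case: zero_one.
pose A N := ev (fun om => big om v N).
have mA N : measurable (A N) by apply: measurable_cyl; apply: cyl_big.
have mI : measurable (\bigcap_N A N) by apply: bigcap_measurable.
have c1 : P \o A @ \oo --> P (\bigcap_N A N).
  apply: nonincreasing_cvg_mu => //.
    by rewrite -ge0_fin_numE ?prob_fin.
  by move=> m n mn; apply/subsetPset => x; apply: big_le.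
have {}c1 : P \o A @ \oo --> 0%E.
  rewrite (_ : 0%E = P (\bigcap_N A N)) //; apply/esym/eqP.
  rewrite eq_le measure_ge0 andbT -P0; apply: le_measure; rewrite ?inE //.
    exact: measurable_inf.
  move=> x Hx; exists v => /finite_clusterP[N]; apply/negP; rewrite negbK; exact: (Hx N I).
have /fine_cvgP[_ c2] : (P \o A) @ \oo --> 0%:E by [].
have /cvgrPdist_lt/(_ eps eps0)[N _ HN] := c2.
exists N; have := HN N (leqnn N); rewrite /= sub0r normrN /A prob_cyl; last exact: cyl_big.
by apply: le_lt_trans; rewrite /= ler_norm.
Qed.

End Law.

Lemma not_percolates_small {R : realType} {V : countType} (nbr : V -> seq V) (p : R) v eps :
  simple_graph nbr -> ~ percolates nbr p -> 0 < eps ->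
  exists N, Pr p (fun om : Edge nbr -> bool => big om v N) < eps.
Proof.
move=> G np eps0; apply: contrapT => H; apply: np => d Omega P omega B.
apply: contrapT => ne1; apply: H; exact: (big_small G B v ne1 eps0).
Qed.

(** * Automorphisms, random walk and mass transport *)

Section Automorphisms.
Context {R : realType} {V : countType} {nbr : V -> seq V}.
Hypothesis G : simple_graph nbr.
Local Notation cfg := (Edge nbr -> bool).
Implicit Types (om : cfg) (u v w x y z : V) (e : Edge nbr) (p : R).
Context {g : V -> V}.
Hypothesis Ag : is_aut nbr g.

Lemma aut_inj : injective g.
Proof. by case: Ag => /bij_inj. Qed.

Lemma aut_surj w : exists u, w = g u.
Proof. by case: Ag => -[f fK gK] _; exists (f w); rewrite gK. Qed.

Lemma aut_mem_nbr u w : (g w \in nbr (g u)) = (w \in nbr u).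
Proof. by case: Ag => _ /(_ u w). Qed.

Lemma aut_nbr u : perm_eq (nbr (g u)) (map g (nbr u)).
Proof.
apply: uniq_perm; [exact: nbr_uniq|by rewrite map_inj_uniq ?nbr_uniq //; apply: aut_inj|].
move=> z; have [z' ->] := aut_surj z; rewrite aut_mem_nbr mem_map //; exact: aut_inj.
Qed.

Lemma aut_deg u : size (nbr (g u)) = size (nbr u).
Proof. by rewrite (perm_size (aut_nbr u)) size_map. Qed.

(** The action of [g] on edges. For an automorphism the default [e] is never taken ([ed_ge]). *)
Definition ge e := odflt e (ed nbr (g (val e).1) (g (val e).2)).

Lemma ed_ge x y e : ed nbr x y = Some e -> ed nbr (g x) (g y) = Some (ge e).
Proof.
move=> E; have : g y \in nbr (g x) by rewrite aut_mem_nbr; apply: ed_adj G _ _ _ E.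
move=> /(adj_ed G)[f Ef]; rewrite Ef /ge.
by case: (ed_val E) => -> /=; [|rewrite (edC (g y))]; rewrite Ef.
Qed.

Lemma ge_inj : injective ge.
Proof.
move=> e e' E; have h := ed_ge (ed_fst_snd e); have h' := ed_ge (ed_fst_snd e').
rewrite -E in h'; case: (ed_eq h h') => -[/aut_inj h1 /aut_inj h2]; apply/Some_inj.
  by rewrite -[LHS]ed_fst_snd -[RHS]ed_fst_snd h1 h2.
by rewrite -[LHS]ed_fst_snd -[RHS]ed_snd_fst h1 h2.
Qed.

Lemma eo_ge om x y : eo (om \o ge) x y = eo om (g x) (g y).
Proof.
rewrite {1}/eo; case E : (ed nbr x y) => [e|]; first by rewrite /eo (ed_ge E).
symmetry; apply/negbTE/negP => /(eo_nbr G); rewrite aut_mem_nbr => /(adj_ed G)[e].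
by rewrite E.
Qed.

Lemma reach_ge k om v w : (w \in reach k (om \o ge) v) = (g w \in reach k om (g v)).
Proof.
elim: k w => [|k IH] w; first by rewrite !inE (inj_eq aut_inj).
apply/idP/idP => /(mem_reachS G)[h|[x xr ex]]; apply/(mem_reachS G).
- by left; rewrite -IH.
- by right; exists (g x); rewrite -?IH // -eo_ge.
- by left; rewrite IH.
- have [x' xx'] := aut_surj x; rewrite xx' in xr ex.
  by right; exists x'; rewrite ?IH // eo_ge.
Qed.

Lemma reach_ge_perm k om v : perm_eq (map g (reach k (om \o ge) v)) (reach k om (g v)).
Proof.
apply: uniq_perm; rewrite ?reach_uniq // ?map_inj_uniq ?reach_uniq //; try exact: aut_inj.
move=> z; have [z' ->] := aut_surj z; rewrite mem_map; last exact: aut_inj.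
exact: reach_ge.
Qed.

Lemma size_reach_ge k om v : size (reach k (om \o ge) v) = size (reach k om (g v)).
Proof. by rewrite -(perm_size (reach_ge_perm k om v)) size_map. Qed.

Lemma big_ge om v N : big (om \o ge) v N = big om (g v) N.
Proof. by rewrite /big size_reach_ge. Qed.

Lemma E_aut p (f f' : cfg -> R) : cyl f' ->
  (forall om, f om = f' (om \o ge)) -> E p f = E p f'.
Proof. by move=> cf H; rewrite -(E_relabel p ge_inj cf); apply: eq_E. Qed.

Lemma rw_aut n u w : rw_p nbr n (g u) (g w) = rw_p nbr n u w :> R.
Proof.
elim: n u => [|n IH] u /=; first by rewrite (inj_eq aut_inj).
rewrite (perm_big _ (aut_nbr u)) big_map aut_deg; apply: eq_bigr => x _.
by rewrite IH.
Qed.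

Lemma sum_nbr_aut (F : V -> R) u : \sum_(y <- nbr (g u)) F y = \sum_(y <- nbr u) F (g y).
Proof. by rewrite (perm_big _ (aut_nbr u)) big_map. Qed.

End Automorphisms.

Arguments ge {V nbr} g e.

(** * Reversibility and heat kernel bounds for the simple random walk *)

Section RandomWalk.
Context {R : realType} {V : countType} {nbr : V -> seq V}.
Hypothesis G : simple_graph nbr.
Hypothesis dpos : forall v, (0 < size (nbr v))%N.
Implicit Types (u v w x y z : V).
Local Notation rw n u w := (@rw_p V nbr R n u w).
Local Notation deg v := ((size (nbr v))%:R : R).

Lemma deg_gt0 v : 0 < deg v.
Proof. by rewrite ltr0n. Qed.

Lemma rw_ge0 n u w : 0 <= rw n u w.
Proof.
elim: n u => [|n IH] u /=; first by case: ifP.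
by apply: sumr_ge0 => x _; rewrite divr_ge0.
Qed.

Lemma ballS k u x : x \in nbr u -> {subset ball nbr k x <= ball nbr k.+1 u}.
Proof.
move=> xu w; rewrite /ball (reach_sym G) => /(reachP G)[s [ps [sx sk]]].
rewrite (reach_sym G); apply/(mem_reachS G); right; exists x.
  by apply/(reachP G); exists s.
by rewrite (eo_all G) (nbrC G).
Qed.

Lemma rw_supp n u w : w \notin ball nbr n u -> rw n u w = 0.
Proof.
elim: n u => [|n IH] u /=.
  by rewrite inE eq_sym => /negbTE ->.
move=> H; rewrite big_seq big1 // => x xu; rewrite IH ?mul0r //.
by apply: contra H; apply: ballS.
Qed.

Lemma rw_CK m n u w (B : seq V) : uniq B -> {subset ball nbr m u <= B} ->
  rw (m + n) u w = \sum_(z <- B) rw m u z * rw n z w.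
Proof.
move=> uB; elim: m u => [|m IH] u sB.
  rewrite (bigD1_seq u) //=; last by apply: sB; apply: mem_reach0.
  rewrite eqxx mul1r big1 ?addr0 // => z zu.
  by rewrite eq_sym (negbTE zu) mul0r.
rewrite addSn /=; under [RHS]eq_bigr do rewrite mulr_suml.
rewrite exchange_big /= big_seq [RHS]big_seq; apply: eq_bigr => x xu.
rewrite IH; last by move=> z /(ballS xu) /sB.
by rewrite mulr_suml; apply: eq_bigr => z _; rewrite mulrAC.
Qed.

Lemma rwSr n u w : rw n.+1 u w = \sum_(x <- nbr w) rw n u x / deg x.
Proof.
elim: n u => [|n IH] u.
  have D a b (f : V -> R) : \sum_(x <- nbr b) (if x == a then 1 else 0) / f x =
      (if a \in nbr b then 1 / f a else 0).
    case: ifP => h.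
      rewrite (bigD1_seq a) ?nbr_uniq //= eqxx big1 ?addr0 // => x /negbTE ->; exact: mul0r.
    rewrite big_seq big1 // => x xb; case: eqP => [xa|]; last by rewrite mul0r.
    by rewrite -xa xb in h.
  rewrite /= (D w u (fun=> deg u)); under eq_bigr do rewrite eq_sym.
  by rewrite (D u w (fun x => deg x)) (nbrC G).
rewrite -[LHS]/(\sum_(x <- nbr u) rw n.+1 x w / deg u); under eq_bigr do rewrite IH mulr_suml.
rewrite exchange_big /=; apply: eq_bigr => x _.
rewrite [in RHS]/= mulr_suml; apply: eq_bigr => y _; exact: mulrAC.
Qed.

Lemma rw_rev n u w : deg u * rw n u w = deg w * rw n w u.
Proof.
elim: n u w => [|n IH] u w /=.
  by rewrite eq_sym; case: eqP => [->|_]; rewrite ?mulr0.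
rewrite -/(rw_p nbr n.+1 w u) rwSr !mulr_sumr; apply: eq_bigr => x _.
have -> : deg u * (rw n x w / deg u) = rw n x w by field; rewrite lt0r_neq0 ?deg_gt0.
by rewrite mulrA -IH; field; rewrite lt0r_neq0 ?deg_gt0.
Qed.

Lemma rw_sum n u (B : seq V) : uniq B -> {subset ball nbr n u <= B} ->
  \sum_(w <- B) rw n u w = 1.
Proof.
move=> uB; elim: n u => [|n IH] u sB /=.
  rewrite (bigD1_seq u) //=; last by apply: sB; apply: mem_reach0.
  rewrite eqxx big1 ?addr0 // => z zu; by rewrite eq_sym (negbTE zu).
rewrite exchange_big /= big_seq (eq_bigr (fun=> (deg u)^-1)).
  rewrite -big_seq big_const_seq count_predT iter_addr_0.
  by rewrite -[LHS]mulr_natl divff // lt0r_neq0 ?deg_gt0.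
by move=> x xu; rewrite -mulr_suml IH ?mul1r // => z /(ballS xu) /sB.
Qed.

(** Splitting the walk at its midpoint, reversibility and [2 a b <= a ^ 2 + b ^ 2] bound the
    transition probability by [deg w] times an average of return probabilities; [M] comes from this
    degree. *)
Lemma rw_offdiag (M : nat) j u w (b : R) : max_degree_le nbr M ->
  (forall v, rw (j + j) v v <= b) -> rw (j + j) u w <= M%:R * b.
Proof.
move=> dM Hb; pose B := undup (ball nbr j u ++ ball nbr j w).
have uB : uniq B by apply: undup_uniq.
have sBu : {subset ball nbr j u <= B} by move=> z h; rewrite mem_undup mem_cat h.
have sBw : {subset ball nbr j w <= B} by move=> z h; rewrite mem_undup mem_cat h orbT.
have sq v : {subset ball nbr j v <= B} ->
    rw (j + j) v v = deg v * \sum_(z <- B) rw j v z ^+ 2 / deg z.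
  move=> sB; rewrite (rw_CK _ _ uB sB) mulr_sumr; apply: eq_bigr => z _.
  have e : rw j z v = deg v * rw j v z / deg z.
    by rewrite -rw_rev; field; rewrite lt0r_neq0 ?deg_gt0.
  by rewrite e; field; rewrite lt0r_neq0 ?deg_gt0.
rewrite (rw_CK _ _ uB sBu).
apply: (@le_trans _ _ (deg w / 2 * (\sum_(z <- B) rw j u z ^+ 2 / deg z + \sum_(z <- B) rw j w z ^+ 2 / deg z))).
  rewrite -big_split mulr_sumr; apply: ler_sum => z _ /=.
  have -> : rw j z w = deg w * rw j w z / deg z.
    by rewrite -rw_rev; field; rewrite lt0r_neq0 ?deg_gt0.
  have h : 0 <= deg w / (2 * deg z) * (rw j u z - rw j w z) ^+ 2.
    by rewrite mulr_ge0 ?sqr_ge0 // divr_ge0 // mulr_ge0.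
  rewrite -subr_ge0; apply: le_trans h _; rewrite le_eqVlt; apply/orP; left; apply/eqP.
  by field; rewrite lt0r_neq0 ?deg_gt0.
have le1 v : {subset ball nbr j v <= B} -> \sum_(z <- B) rw j v z ^+ 2 / deg z <= b.
  move=> sB; apply: le_trans (Hb v); rewrite (sq v sB) ler_peMl //; last by rewrite ler1n.
  by apply: sumr_ge0 => z _; rewrite divr_ge0 // sqr_ge0.
have b0 : 0 <= b by apply: le_trans (Hb u); apply: rw_ge0.
apply: (@le_trans _ _ (deg w / 2 * (b + b))).
  by apply: ler_wpM2l; [rewrite divr_ge0|apply: lerD; apply: le1].
have -> : deg w / 2 * (b + b) = deg w * b by field.
by apply: ler_wpM2r; rewrite // ler_nat.
Qed.

(** The walk can step back and forth along an edge. *)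
Lemma rw_return_lower (M : nat) n v : max_degree_le nbr M ->
  (M%:R ^-1) ^+ (n + n) <= rw (n + n) v v.
Proof.
move=> dM; elim: n v => [|n IH] v; first by rewrite /= eqxx.
rewrite addSn addnS.
have step k a b x : x \in nbr a -> M%:R^-1 * rw k x b <= rw k.+1 a b.
  move=> xa; rewrite /= (big_rem x) //=.
  apply: (@le_trans _ _ (rw k x b / deg a)).
    rewrite mulrC; apply: ler_wpM2l; first exact: rw_ge0.
    rewrite lef_pV2 ?posrE ?deg_gt0 ?ler_nat //.
    by rewrite ltr0n; apply: leq_trans (dM a).
  by rewrite lerDl; apply: sumr_ge0 => y _; rewrite divr_ge0 ?rw_ge0.
have [x xv] : exists x, x \in nbr v.
  by case: (nbr v) (dpos v) => // x s _; exists x; rewrite mem_head.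
have vx : v \in nbr x by rewrite (nbrC G).
apply: le_trans (step _ _ _ _ xv); rewrite exprS; apply: ler_wpM2l; first by rewrite invr_ge0.
apply: le_trans (step _ _ _ _ vx); rewrite exprS; apply: ler_wpM2l; first by rewrite invr_ge0.
exact: IH.
Qed.

End RandomWalk.

(** * Mass transport for functions of finite range *)

Section MassTransport.
Context {R : realType} {V : countType} {nbr : V -> seq V}.
Hypothesis G : simple_graph nbr.
Context {O : seq V} {mu : V -> R}.
Hypothesis MT : mtp_measure nbr O mu.

Lemma esum_seq (B : seq V) (f : V -> R) : uniq B -> (forall w, 0 <= f w) ->
  (forall w, w \notin B -> f w = 0) ->
  (\esum_(w in [set: V]) (f w)%:E)%E = (\sum_(w <- B) f w)%:E.
Proof.
move=> uB f0 fB.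
rewrite (eq_esum (b := fun w => if w \in [set` B] then (f w)%:E else 0%E)); last first.
  move=> w _; case: ifP => // /negbT; rewrite notin_setE /= => /negP /fB ->.
  by [].
rewrite -esum_mkcond esum_fset; last 2 first.
- exact: finite_seq.
- by move=> w _; rewrite lee_fin.
by rewrite -sumEFin -fsbig_seq.
Qed.

Lemma mtp_nneg k (f : V -> V -> R) : (forall u w, 0 <= f u w) ->
  (forall g, is_aut nbr g -> forall u w, f (g u) (g w) = f u w) ->
  (forall u w, w \notin ball nbr k u -> f u w = 0) ->
  \sum_(o <- O) mu o * \sum_(w <- ball nbr k o) f o w =
  \sum_(o <- O) mu o * \sum_(w <- ball nbr k o) f w o.
Proof.
move=> f0 fg fB; have [_ [_ H]] := MT.
have /= := H (fun u w => (f u w)%:E) (fun u w => f0 u w) (fun g Ag u w => congr1 EFin (fg g Ag u w)).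
have e1 o : (\esum_(w in [set: V]) (f o w)%:E)%E = (\sum_(w <- ball nbr k o) f o w)%:E.
  by apply: esum_seq => //; [apply: reach_uniq|apply: fB].
have e2 o : (\esum_(w in [set: V]) (f w o)%:E)%E = (\sum_(w <- ball nbr k o) f w o)%:E.
  apply: (esum_seq (f := fun w => f w o)) => //; first exact: reach_uniq.
  by move=> w; rewrite /ball (reach_sym G) => /fB.
under eq_bigr do rewrite e1 -EFinM; under [in RHS]eq_bigr do rewrite e2 -EFinM.
by rewrite !sumEFin => -[].
Qed.

(** Positive and negative parts are transported separately. Signed functions are essential for the
    two-ghost inequality, whose weights [wt] change sign with the state of the edge. *)
Lemma mtp_fin k (f : V -> V -> R) :
  (forall g, is_aut nbr g -> forall u w, f (g u) (g w) = f u w) ->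
  (forall u w, w \notin ball nbr k u -> f u w = 0) ->
  \sum_(o <- O) mu o * \sum_(w <- ball nbr k o) f o w =
  \sum_(o <- O) mu o * \sum_(w <- ball nbr k o) f w o.
Proof.
move=> fg fB.
have fE u w : f u w = Num.max (f u w) 0 - Num.max (- f u w) 0.
  by case: (lerP (f u w) 0) => h; [rewrite (max_idPl _) ?oppr_ge0 // | rewrite (max_idPr _) ?oppr_le0 ?ltW //];
  rewrite ?sub0r ?opprK ?subr0.
have e1 := mtp_nneg (k := k) (f := fun u w => Num.max (f u w) 0).
have e2 := mtp_nneg (k := k) (f := fun u w => Num.max (- f u w) 0).
transitivity (\sum_(o <- O) mu o * \sum_(w <- ball nbr k o) Num.max (f o w) 0 -
  \sum_(o <- O) mu o * \sum_(w <- ball nbr k o) Num.max (- f o w) 0).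
  rewrite -sumrB; apply: eq_bigr => o _; rewrite -mulrBr -sumrB; congr (_ * _).
  by apply: eq_bigr => w _; apply: fE.
rewrite e1; last 3 first.
- by move=> u w; rewrite le_max lexx orbT.
- by move=> g Ag u w; rewrite fg.
- by move=> u w /fB ->; rewrite maxxx.
rewrite e2; last 3 first.
- by move=> u w; rewrite le_max lexx orbT.
- by move=> g Ag u w; rewrite fg.
- by move=> u w /fB ->; rewrite oppr0 maxxx.
rewrite -sumrB; apply: eq_bigr => o _; rewrite -mulrBr -sumrB; congr (_ * _).
by apply: eq_bigr => w _; symmetry; apply: fE.
Qed.

End MassTransport.

(** * Fluctuations of the number of open edges touching a cluster *)

Section Fluctuation.
Context {R : realType}.

Lemma expR_le_quad (y : R) : y <= 1 / 2 -> expR y <= 1 + y + 2 * y ^+ 2.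
Proof.
move=> y2; have h : 0 < 1 - y by lra.
have e1 : 1 - y <= expR (- y) by apply: expR_ge1Dx.
have : expR y * (1 - y) <= 1.
  by rewrite -[leRHS](expRxMexpNx_1 y); apply: ler_wpM2l; rewrite ?expR_ge0.
rewrite -ler_pdivlMr // => /le_trans; apply.
rewrite ler_pdivrMr //; nra.
Qed.

Context {T : eqType}.
Implicit Types (om : T -> bool) (L : seq T) (p s : R).

Definition rho p s (b : bool) : R := expR (s * (p - b%:R) - s ^+ 2).

(** The linear terms cancel because the edge variable is centred. The quadratic ones add up to
    [2 p (1 - p) s ^ 2 <= s ^ 2], which the normalisation [expR (- s ^+ 2)] in [rho] absorbs. *)
Lemma rho_mean p s : 0 <= p <= 1 -> `|s| <= 1 / 2 -> p * rho p s true + (1 - p) * rho p s false <= 1.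
Proof.
move=> /andP[p0 p1]; rewrite ler_norml => /andP[s1 s2]; rewrite /rho !expRD mulrA [(1 - p) * _]mulrA -mulrDl.
rewrite expRN ler_pdivrMr ?expR_gt0 // mul1r subr0.
have {}h1 : expR (s * (p - 1)) <= 1 + s * (p - 1) + 2 * (s * (p - 1)) ^+ 2 by apply: expR_le_quad; nra.
have h2 : expR (s * p) <= 1 + s * p + 2 * (s * p) ^+ 2 by apply: expR_le_quad; nra.
apply: (@le_trans _ _ (1 + s ^+ 2)); last exact: expR_ge1Dx.
apply: le_trans (lerD (ler_wpM2l p0 h1) (ler_wpM2l _ h2)) _; first by lra.
have -> : p * (1 + s * (p - 1) + 2 * (s * (p - 1)) ^+ 2) + (1 - p) * (1 + s * p + 2 * (s * p) ^+ 2) =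
  1 + 2 * (p * (1 - p)) * s ^+ 2 by ring.
rewrite lerD2l ler_piMl ?sqr_ge0 //; nra.
Qed.

(* Reweighting each queried edge by [rho] amounts to changing the parameter. *)
Lemma Ex_tilt p s : 0 <= p <= 1 -> `|s| <= 1 / 2 ->
  exists2 p', 0 <= p' <= 1 & forall L (f : (T -> bool) -> R) om, uniq L -> (forall x, 0 <= f x) ->
    Ex p L (fun x => f x * \prod_(e <- L) rho p s (x e)) om <= Ex p' L f om.
Proof.
move=> p01 s2; have Z1 := rho_mean p01 s2; have /andP[p0 p1] := p01.
set Z := _ + _ in Z1.
have r0 b : 0 < rho p s b by apply: expR_gt0.
have Z0 : 0 < Z.
  have [pe0|pn0] := eqVneq p 0; first by rewrite /Z pe0 mul0r add0r subr0 mul1r; apply: expR_gt0.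
  apply: ltr_pwDl; first by rewrite mulr_gt0 // lt0r pn0.
  by rewrite mulr_ge0 ?subr_ge0 // ltW.
pose p' := p * rho p s true / Z.
have q' : 1 - p' = (1 - p) * rho p s false / Z.
  rewrite /p' -[X in X - _](divff (lt0r_neq0 Z0)) -mulrBl; congr (_ / _).
  by rewrite /Z addrC addKr.
have q'0 : 0 <= 1 - p' by rewrite q'; apply: divr_ge0; [apply: mulr_ge0; [rewrite subr_ge0|apply: ltW]|apply: ltW].
have p'0 : 0 <= p' by apply: divr_ge0; [apply: mulr_ge0 => //; apply: ltW|apply: ltW].
have p'01 : 0 <= p' <= 1 by rewrite p'0 -subr_ge0.
have e1 : p * rho p s true = Z * p' by rewrite /p' [RHS]mulrC divfK // lt0r_neq0.
have e2 : (1 - p) * rho p s false = Z * (1 - p') by rewrite q' [RHS]mulrC divfK // lt0r_neq0.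
clearbody p'; exists p' => // L f om; elim: L f om => [|e L IH] f om.
  by move=> _ f0 /=; rewrite big_nil mulr1.
move=> /= /andP[eL uL] f0.
have E b : Ex p L (fun x => f x * \prod_(e0 <- e :: L) rho p s (x e0)) (upd om e b) <=
    rho p s b * Ex p' L f (upd om e b).
  apply: (@le_trans _ _ (Ex p L (fun x => rho p s (x e) * (f x * \prod_(e0 <- L) rho p s (x e0))) (upd om e b))).
    by rewrite le_eqVlt; apply/orP; left; apply/eqP/eq_Ex => x; rewrite big_cons; ring.
  have d1 : dep [pred x | x == e] (fun x : T -> bool => rho p s (x e)).
    by split=> om1 om2 H; rewrite (H e) //= eqxx.
  rewrite (Ex_mull _ _ _ d1) ?upd_same; last first.
    by move=> x xL /=; apply: contraNneq eL => <-.
  by apply: ler_wpM2l; [exact: ltW|apply: IH].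
apply: (le_trans (lerD (ler_wpM2l p0 (E true)) (ler_wpM2l _ (E false)))); first by rewrite subr_ge0.
have F0 b : 0 <= Ex p' L f (upd om e b).
  by rewrite -[leLHS](Ex_cst p' L 0 (upd om e b)); apply: Ex_le.
rewrite !mulrA e1 e2 -!mulrA -mulrDr; apply: ler_piMl => //.
by apply: addr_ge0; apply: mulr_ge0.
Qed.

End Fluctuation.

(** * Expected fluctuation of a cluster weighted by ghosts *)

Section TwoGhost.
Context {R : realType} {V : countType} {nbr : V -> seq V}.
Hypothesis G : simple_graph nbr.
Hypothesis dpos : forall v, (0 < size (nbr v))%N.
Context {M : nat}.
Hypothesis dM : max_degree_le nbr M.
Local Notation cfg := (Edge nbr -> bool).
Implicit Types (om : cfg) (u v w x y z : V) (e : Edge nbr).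
Context {p : R}.
Hypothesis p01 : 0 <= p <= 1.
Context {r : nat}.

Let p0 : 0 <= p. Proof. by case/andP: p01. Qed.
Let p1 : p <= 1. Proof. by case/andP: p01. Qed.

(** When [K] is a cluster, this is the final value of the martingale that adds [p] minus the state
    of each edge queried during the exploration. *)
Definition hfl om (K : seq V) : R := \sum_(e <- tE nbr K) (p - (om e)%:R).

Lemma size_tE_le (K : seq V) : (size (tE nbr K) <= M * size K)%N.
Proof.
apply: leq_trans (size_undup _) _; elim: K => [|x K IH] //=.
rewrite size_cat mulnS; apply: leq_add => //.
by apply: leq_trans (dM x); rewrite size_pmap count_size.
Qed.

Lemma size_tE_ge (K : seq V) : uniq K -> (size K <= 2 * size (tE nbr K))%N.
Proof.
move=> uK; have AB := sum_pairs_edges G (fun _ _ => 1%N) uK.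
apply: (@leq_trans (\sum_(x <- K) \sum_(y <- nbr x) 1)%N).
  by rewrite -sum1_size; apply: leq_sum => x _; rewrite sum1_size.
rewrite AB mulnC -sum1_size big_distrl /=; apply: leq_sum => e _.
by case: ifP => _; case: ifP.
Qed.

Lemma hfl_le om (K : seq V) : hfl om K <= (size (tE nbr K))%:R.
Proof.
rewrite -sum1_size natr_sum; apply: ler_sum => e _.
by rewrite lerBlDr; apply: (le_trans p1); rewrite lerDl.
Qed.

Lemma cyl_hfl (K : seq V) : cyl (fun om => hfl om K).
Proof.
apply: cyl_sum => e; exists [:: e]; split=> om om' H; congr (_ - _%:R).
by rewrite H //= inE.
Qed.

Definition fin om v := ~~ big om v r.

Lemma finE om v : fin om v = (size (reach r om v) < r)%N.
Proof. by rewrite /fin /big ltnNge. Qed.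

Lemma cyl_fin v : cyl (fun om => fin om v).
Proof. exact/cyl_not/(cyl_big G). Qed.

Lemma prod_rho s om (K : seq V) :
  \prod_(e <- tE nbr K) rho p s (om e) = expR (s * hfl om K - s ^+ 2 * (size (tE nbr K))%:R).
Proof.
rewrite -expR_sum; congr expR; rewrite /hfl mulr_sumr -sum1_size natr_sum mulr_sumr -sumrB.
by apply: eq_bigr => e _; rewrite mulr1.
Qed.

Lemma cyl_hfl_reach v : cyl (fun om => hfl om (reach r om v)).
Proof.
have [Ks [uKs HKs]] := cyl_values (cyl_reach G r v).
have -> : (fun om => hfl om (reach r om v)) =
    (fun om => \sum_(k <- Ks) (reach r om v == k)%:R * hfl om k).
  apply/funext => om; rewrite (bigD1_seq (reach r om v)) //= eqxx mul1r big1 ?addr0 // => k.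
  by rewrite eq_sym => /negbTE ->; rewrite mul0r.
apply: cyl_sum => k; apply: cylM (cyl_hfl k).
exact: (cyl_comp (fun s => (s == k)%:R) (cyl_reach G r v)).
Qed.

Definition Xexp s v om : R := (fin om v)%:R *
  expR (s * hfl om (reach r om v) - s ^+ 2 * (size (tE nbr (reach r om v)))%:R).

Lemma cyl_Xexp s v : cyl (Xexp s v).
Proof.
apply: cylM; first exact/cyl_natr/cyl_fin.
exact: (cyl_comp2 (fun a (k : seq V) => expR (s * a - s ^+ 2 * (size (tE nbr k))%:R)) (cyl_hfl_reach v) (cyl_reach G r v)).
Qed.

(** Optional stopping for the exponential supermartingale. The event that the cluster is [k] depends
    only on the edges touching [k], and [Ex_tilt] turns the product of [rho] over them into a change
    of parameter. Under the new parameter the probabilities of the different [k] add up to at most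
    1. *)
Lemma E_Xexp s v : `|s| <= 1 / 2 -> E p (Xexp s v) <= 1.
Proof.
move=> s2; have [p' p'01 tilt] := Ex_tilt (T := Edge nbr) p01 s2.
have cr := cyl_reach G r v.
have [Ks [uKs HKs]] := cyl_values cr.
pose F (k : seq V) om : R := (size k < r)%:R * \prod_(e <- tE nbr k) rho p s (om e).
have cF k : cyl (F k).
  apply: (cyl_comp (fun a => (size k < r)%:R * a)).
  rewrite (_ : (fun om => _) = fun om => expR (s * hfl om k - s ^+ 2 * (size (tE nbr k))%:R)); last first.
    by apply/funext => om; rewrite prod_rho.
  exact: (cyl_comp (fun a => expR (s * a - s ^+ 2 * (size (tE nbr k))%:R)) (cyl_hfl k)).
rewrite (_ : E p (Xexp s v) = E p (fun om => F (reach r om v) om)); last first.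
  by apply: eq_E => om; rewrite /F /Xexp prod_rho finE.
rewrite (E_total p uKs HKs cr cF).
have ck k : cyl (fun om => (reach r om v == k)%:R * (size k < r)%:R : R).
  exact: (cyl_comp (fun s => (s == k)%:R * (size k < r)%:R) cr).
apply: (@le_trans _ _ (\sum_(k <- Ks) E p' (fun om => (reach r om v == k)%:R * (size k < r)%:R))).
  apply: ler_sum => k _.
  have dk : dep [pred e in tE nbr k] (fun om => (reach r om v == k)%:R * (size k < r)%:R : R).
    suff H om om' : (forall e, e \in tE nbr k -> om e = om' e) -> reach r om v = k -> reach r om' v = k.
      split=> om om' E; congr (_%:R * _); congr nat_of_bool; apply/eqP/eqP; apply: H => // e ek; symmetry; exact: E.
    move=> E Ek; rewrite -Ek; symmetry; apply: (reach_agree) => x y; rewrite Ek => xk.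
    exact: (eo_agree G _ E).
  rewrite (E_Ex p' (fun=> false) dk) (@E_Ex _ _ _ (tE nbr k) _ (fun=> false)); last first.
    split=> om om' H; rewrite /F mulrA [RHS]mulrA; congr (_ * _); first exact: (depP dk).
    by rewrite big_seq [RHS]big_seq; apply: eq_bigr => e ek; rewrite H.
  apply: le_trans (tilt _ (fun om => (reach r om v == k)%:R * (size k < r)%:R) _ (tE_uniq _) _).
    by rewrite le_eqVlt; apply/orP; left; apply/eqP/eq_Ex => om; rewrite /F mulrA.
  by move=> om; rewrite mulr_ge0.
rewrite -E_sum // -[leRHS](E_cst (T := Edge nbr) p' 1); apply: E_le => //.
- exact: cyl_sum.
- exact: cyl_cst.
- move=> om; rewrite (bigD1_seq (reach r om v)) //= eqxx mul1r big1 ?addr0 ?lern1 ?leq_b1 // => k.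
  by rewrite eq_sym => /negbTE ->; rewrite mul0r.
Qed.

Context {lam : R}.
Hypothesis lam01 : 0 <= lam <= 1.

(** The probability that [k] vertices contain a ghost, when each is one independently with
    probability [1 - lam]. *)
Definition psi k : R := 1 - lam ^+ k.

Let lam0 : 0 <= lam. Proof. by case/andP: lam01. Qed.
Let lam1 : lam <= 1. Proof. by case/andP: lam01. Qed.

Lemma psi_ge0 k : 0 <= psi k.
Proof. by rewrite subr_ge0 exprn_ile1. Qed.

Lemma psi_le1 k : psi k <= 1.
Proof. by rewrite lerBlDr lerDl exprn_ge0. Qed.

Lemma psi_mono k k' : (k <= k')%N -> psi k <= psi k'.
Proof. by move=> kk'; rewrite lerB // ler_wiXn2l. Qed.

Lemma psi_lin k : psi k <= k%:R * (1 - lam).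
Proof.
elim: k => [|k IH]; first by rewrite /psi expr0 subrr mul0r.
have -> : psi k.+1 = psi k + lam ^+ k * (1 - lam) by rewrite /psi exprSr; ring.
rewrite -natr1 mulrDl mul1r lerD // ler_piMl ?subr_ge0 //; exact: exprn_ile1.
Qed.

Lemma psiD a b : psi a + psi b - psi (a + b) = psi a * psi b.
Proof. by rewrite /psi exprD; ring. Qed.

Definition cs om v := size (reach r om v).

Lemma cs_gt0 om v : (0 < cs om v)%N.
Proof. by have := mem_reach0 G r om v; rewrite /cs; case: reach. Qed.

(** The fluctuation of the cluster, weighted by its chance to meet a ghost and shared equally among
    its vertices, in preparation for the transport in [Z_flow]. *)
Definition flow v om : R := (fin om v)%:R * (psi (cs om v) / (cs om v)%:R) * hfl om (reach r om v).

Lemma cyl_psi_size v : cyl (fun om => psi (cs om v) / (cs om v)%:R).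
Proof. exact: (cyl_comp (fun s => psi (size s) / (size s)%:R) (cyl_reach G r v)). Qed.

Lemma cyl_flow v : cyl (flow v).
Proof.
apply: cylM (cyl_hfl_reach v); apply: cylM (cyl_psi_size v); exact/cyl_natr/cyl_fin.
Qed.

(* The three terms come from clusters of size at most [k], from larger clusters whose
   fluctuation is at most [eta] times their size, and from the exponentially unlikely rest. *)
Definition Phi (k : nat) (eta : R) : R :=
  M%:R * (k%:R * (1 - lam) + eta + expR (- (eta ^+ 2 * k%:R / 8))).

Lemma flow_pointwise k (eta : R) v om : 0 <= eta ->
  flow v om <= M%:R * (k%:R * (1 - lam) + eta +
     expR (- (eta ^+ 2 * k%:R / 8)) * Xexp (eta / 2) v om).
Proof.
move=> eta0; rewrite /flow /Xexp; case: (fin om v); last first.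
  by rewrite !mul0r mulr0 addr0 mulr_ge0 // addr_ge0 // mulr_ge0 // subr_ge0.
rewrite !mul1r; set h := hfl _ _; set t := size (tE _ _); set a := cs om v.
have a0 : 0 < a%:R :> R by rewrite ltr0n cs_gt0.
have hT : h <= t%:R by apply: hfl_le.
have tM : t%:R <= M%:R * a%:R :> R by rewrite -natrM ler_nat; apply: size_tE_le.
have ta : a%:R <= 2 * t%:R :> R by rewrite -natrM ler_nat; apply: size_tE_ge; apply: reach_uniq.
have X0 : 0 <= expR (- (eta ^+ 2 * k%:R / 8)) * expR (eta / 2 * h - (eta / 2) ^+ 2 * t%:R).
  by rewrite mulr_ge0 ?expR_ge0.
have l0 : 0 <= k%:R * (1 - lam) by rewrite mulr_ge0 // subr_ge0.
have [h0|h0] := leP h 0.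
  apply: (@le_trans _ _ 0); last by rewrite mulr_ge0 // !addr_ge0.
  by rewrite mulr_ge0_le0 // divr_ge0 ?psi_ge0.
have ps0 : 0 <= psi a / a%:R by rewrite divr_ge0 ?psi_ge0.
have MT : psi a / a%:R * h <= psi a * M%:R.
  rewrite -mulrA; apply: ler_wpM2l; first exact: psi_ge0.
  rewrite mulrC ler_pdivrMr //; exact: le_trans hT tM.
have [ak|ka] := ltnP a k.
  apply: (le_trans MT); rewrite mulrC; apply: ler_wpM2l => //.
  rewrite -addrA; apply: ler_wpDr; first by rewrite addr_ge0.
  apply: (le_trans (psi_lin a)); apply: ler_wpM2r; rewrite ?subr_ge0 // ler_nat; exact: ltnW.
have [he|he] := leP h (eta * t%:R).
  apply: (@le_trans _ _ (M%:R * eta)); last first.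
    by apply: ler_wpM2l => //; rewrite addrAC lerDr addr_ge0.
  apply: (@le_trans _ _ (1 / a%:R * (eta * (M%:R * a%:R)))).
    apply: ler_pM => //; first exact: ltW.
      by apply: ler_wpM2r; rewrite ?invr_ge0 ?psi_le1.
    by apply: (le_trans he); apply: ler_wpM2l.
  rewrite le_eqVlt; apply/orP; left; apply/eqP; field; exact: lt0r_neq0.
apply: (le_trans MT); rewrite mulrC; apply: ler_wpM2l => //.
apply: (le_trans (psi_le1 a)); apply: ler_wpDl; first by rewrite addr_ge0.
(* From [h > eta * t] the exponent in [Xexp] is at least [eta ^ 2 * t / 4], hence at least
   [eta ^ 2 * k / 8] since [k <= 2 t]. This is the origin of the 8 in [Phi]. *)
rewrite -expRD -[leLHS]expR0 ler_expR.
have ka' : k%:R <= 2 * t%:R :> R by apply: le_trans ta; rewrite ler_nat.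
nra.
Qed.

Lemma E_flow k (eta : R) v : 0 <= eta <= 1 -> E p (flow v) <= Phi k eta.
Proof.
move=> /andP[eta0 eta1].
have cX := cyl_Xexp (eta / 2) v.
set c := expR (- (eta ^+ 2 * k%:R / 8)); set b := k%:R * (1 - lam) + eta.
have c1 : cyl (fun om => c * Xexp (eta / 2) v om) by apply: (cylM _ cX); apply: cyl_cst.
have c2 : cyl (fun om => b + c * Xexp (eta / 2) v om) by apply: cylD => //; apply: cyl_cst.
apply: (@le_trans _ _ (E p (fun om => M%:R * (b + c * Xexp (eta / 2) v om)))).
  apply: E_le => //; first exact: cyl_flow.
    by apply: cylM => //; apply: cyl_cst.
  by move=> om; apply: flow_pointwise.
rewrite EZ //; apply: ler_wpM2l => //; rewrite ED //; last exact: cyl_cst.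
rewrite E_cst EZ // lerD2l ler_piMr ?expR_ge0 //; apply: E_Xexp.
by rewrite ger0_norm ?divr_ge0 //; lra.
Qed.

End TwoGhost.

Arguments fin {V nbr} r om v.
Arguments cs {V nbr} r om v.
Arguments psi {R} lam k.
Arguments hfl {R V nbr} p om K.
Arguments flow {R V nbr} p r lam v om.
Arguments Phi {R} M lam k eta.

(** * The two-ghost inequality *)

Section TwoGhostIdentity.
Context {R : realType} {V : countType} {nbr : V -> seq V}.
Hypothesis G : simple_graph nbr.
Hypothesis dpos : forall v, (0 < size (nbr v))%N.
Context {M : nat}.
Hypothesis dM : max_degree_le nbr M.
Local Notation cfg := (Edge nbr -> bool).
Implicit Types (om : cfg) (u v w x y z : V) (e : Edge nbr).
Context {p : R}.
Hypothesis p01 : 0 <= p <= 1.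
Context {r : nat} {lam : R}.
Hypothesis lam01 : 0 <= lam <= 1.
Local Notation K om v := (reach r om v).
Local Notation finr om v := (fin r om v).
Local Notation csr om v := (cs r om v).
Local Notation psil k := (psi lam k).

Let p0 : 0 <= p. Proof. by case/andP: p01. Qed.
Let p1 : p <= 1. Proof. by case/andP: p01. Qed.

(* Averaging over the state of the edge [xy] gives [0] when [x] and [y] are connected
   without it. Otherwise both endpoints together give
   [p (1 - p) (psi a + psi b - psi (a + b)) = p (1 - p) psi a psi b] for cluster sizes [a], [b]:
   this is where the product of two ghosts comes from. *)
Definition wt om x y : R :=
  if eo om x y then - ((1 - p) / 2) else if y \in K om x then p / 2 else p.

Definition Zf x y om : R := (finr om x)%:R * psil (csr om x) * wt om x y.

(** The two-ghost event cut off at size [r]. For adjacent [x] and [y] it forces the edge between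
    them to be closed. *)
Definition sg N x y om : bool :=
  [&& big om x N, big om y N, finr om x, finr om y & y \notin K om x].

Lemma cyl_wt x y : cyl (fun om => wt om x y).
Proof.
exact: (cyl_comp2 (fun b (s : seq V) => if b then - ((1 - p) / 2) else if y \in s then p / 2 else p)
  (cyl_eo G x y) (cyl_reach G r x)).
Qed.

Lemma cyl_psi x : cyl (fun om => psil (csr om x)).
Proof. exact: (cyl_comp (fun s => psil (size s)) (cyl_reach G r x)). Qed.

Lemma cyl_Zf x y : cyl (Zf x y).
Proof.
apply: cylM (cyl_wt x y); apply: cylM (cyl_psi x); apply: cyl_natr; exact: cyl_fin.
Qed.

Lemma cyl_sg N x y : cyl (sg N x y).
Proof.
do 4 (apply: cyl_and; [by [exact: cyl_big|exact: cyl_fin]|]).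
by apply: cyl_not; apply: cyl_tau.
Qed.

Lemma fin_upd om e x : finr (upd om e true) x -> finr (upd om e false) x.
Proof.
apply: contra; apply: (big_mono G); by apply: upd_incr => // z; apply/implyP.
Qed.

Lemma Z_pointwise N x y e om : ed nbr x y = Some e ->
  p * psil N ^+ 2 * ((1 - p) * (sg N x y (upd om e false))%:R) - (big (upd om e true) x r)%:R <=
  p * (Zf x y (upd om e true) + Zf y x (upd om e true)) +
  (1 - p) * (Zf x y (upd om e false) + Zf y x (upd om e false)).
Proof.
move=> E; set om1 := upd om e true; set om0 := upd om e false.
have eo1 : eo om1 x y by rewrite /eo E /om1 upd_same.
have eo0 : eo om0 x y = false by rewrite /eo E /om0 upd_same.
have q0 : 0 <= 1 - p by rewrite subr_ge0.
have ps0 k : 0 <= psil k by apply: psi_ge0.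
have ps1 k : psil k <= 1 by apply: psi_le1.
have b1 : big om1 x r = big om1 y r by apply: (conn_big G); apply: conn_eo.
have Zge a b om' : eo om' a b = false -> 0 <= Zf a b om'.
  move=> h; rewrite /Zf /wt h mulr_ge0 ?mulr_ge0 //.
  by case: ifP => _; rewrite ?divr_ge0.
(* If opening [e] carries the cluster past the cutoff, the identity breaks down; the subtracted
   indicator equals 1 and pays for the whole product on the left. *)
case: (boolP (big om1 x r)) => bx.
  have -> : Zf x y om1 = 0 by rewrite /Zf /fin bx !mul0r.
  have -> : Zf y x om1 = 0 by rewrite /Zf /fin -b1 bx !mul0r.
  rewrite addr0 mulr0 add0r; apply: (@le_trans _ _ 0); last first.
    by rewrite mulr_ge0 // addr_ge0 // Zge // eoC.
  rewrite subr_le0 mulr1n; apply: mulr_ile1.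
  - by rewrite mulr_ge0 // exprn_ge0.
  - by rewrite mulr_ge0.
  - by apply: mulr_ile1 => //; rewrite ?exprn_ge0 // exprn_ile1.
  - by apply: mulr_ile1 => //; [by rewrite gerBl|rewrite lern1 leq_b1].
have fx1 : finr om1 x by [].
have fy1 : finr om1 y by rewrite /fin -b1.
have fx0 : finr om0 x by apply: fin_upd fx1.
have fy0 : finr om0 y by apply: fin_upd fy1.
have cxy1 : conn om1 x y by apply: conn_eo.
have K1 : perm_eq (K om1 x) (K om1 y) := fin_reach_eq G fx1 cxy1.
have mem1 z : (z \in K om1 x) <-> (z \in K om0 x) \/ (z \in K om0 y).
  split=> [/(mem_fin G _ fx1)/(conn_upd om z E)[h|h]|[/(mem_fin G _ fx0) h|/(mem_fin G _ fy0) h]].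
  - by left; apply/(mem_fin G _ fx0).
  - by right; apply/(mem_fin G _ fy0).
  - by apply/(mem_fin G _ fx1)/(conn_upd om z E); left.
  - by apply/(mem_fin G _ fx1)/(conn_upd om z E); right.
have cs1 : csr om1 y = csr om1 x by rewrite /cs (perm_size K1).
have Z1 : Zf x y om1 + Zf y x om1 = - (1 - p) * psil (csr om1 x).
  rewrite /Zf fx1 fy1 cs1 /wt eo1 eoC eo1 /= mulr1n; field => //.
rewrite Z1 subr0.
(* If [x] and [y] are joined without [e], both states give the same cluster and the weights average
   to zero. *)
case: (boolP (y \in K om0 x)) => yx.
  have cxy0 : conn om0 x y by apply/(mem_fin G _ fx0).
  have -> : sg N x y om0 = false by rewrite /sg yx !andbF.
  have c0 : csr om0 x = csr om1 x.
    apply: perm_size; apply: uniq_perm; rewrite ?reach_uniq // => z.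
    apply/idP/idP => [h|/mem1[//|h]]; first by apply/mem1; left.
    by rewrite (perm_mem (fin_reach_eq G fx0 cxy0)).
  have c0' : csr om0 y = csr om1 x by rewrite -c0 /cs (perm_size (fin_reach_eq G fx0 cxy0)).
  have xy : x \in K om0 y by rewrite (reach_sym G).
  rewrite /Zf fx0 fy0 c0 c0' /wt eo0 eoC eo0 yx xy /= !mulr0 mulr1n le_eqVlt; apply/orP; left; apply/eqP; field => //.
have xy : x \notin K om0 y by rewrite (reach_sym G).
have cc : csr om1 x = (csr om0 x + csr om0 y)%N.
  rewrite /cs -size_cat; apply: perm_size; apply: uniq_perm; rewrite ?reach_uniq //.
    rewrite cat_uniq !reach_uniq andbT /=; apply/hasPn => z /= zy; apply: contra yx => zx.
    apply/(mem_fin G _ fx0); apply: (conn_trans (v := z)); first by apply/(mem_fin G _ fx0).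
    by apply: conn_sym; apply/(mem_fin G _ fy0).
  move=> z; rewrite mem_cat; apply/idP/orP; by move/mem1.
rewrite cc /Zf fx0 fy0 /wt eo0 eoC eo0 (negbTE yx) (negbTE xy).
rewrite /= mulr1n.
have -> : p * (- (1 - p) * psil (csr om0 x + csr om0 y)) + (1 - p) *
   (1 * psil (csr om0 x) * p + 1 * psil (csr om0 y) * p) =
   p * (1 - p) * (psil (csr om0 x) * psil (csr om0 y)) by rewrite -psiD; ring.
have -> : p * psil N ^+ 2 * ((1 - p) * (sg N x y om0)%:R) = p * (1 - p) * (psil N ^+ 2 * (sg N x y om0)%:R).
  by ring.
apply: ler_wpM2l; first by rewrite mulr_ge0.
rewrite /sg fx0 fy0 yx !andbT.
case: (boolP (big om0 x N)) => bx0; last by rewrite mulr0 mulr_ge0.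
case: (boolP (big om0 y N)) => by0; last by rewrite mulr0 mulr_ge0.
rewrite (big_size G _ fx0) in bx0; rewrite (big_size G _ fy0) in by0.
by rewrite mulr1 expr2; apply: ler_pM => //; apply: psi_mono.
Qed.

(** The loss [beta / p] bounds, by insertion tolerance, the probability that opening the edge
    creates a cluster beyond the cutoff. *)
Lemma E_Z_ge N x y (beta : R) : y \in nbr x -> Pr p (fun om => big om x r) <= beta -> 0 < p ->
  p * psil N ^+ 2 * Pr p (sg N x y) - beta / p <= E p (Zf x y) + E p (Zf y x).
Proof.
move=> yx hb pgt; have [e Ee] := adj_ed G yx.
have cZ : cyl (fun om => Zf x y om + Zf y x om) by apply: cylD; apply: cyl_Zf.
have cs' := cyl_sg N x y.
have cI : cyl (Ie p e (fun om => (sg N x y om)%:R)) by apply: cyl_Ie; apply: cyl_natr.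
have cb : cyl (fun om => (big (upd om e true) x r)%:R : R).
  exact: (cyl_upd (f := fun om => (big om x r)%:R) e true (cyl_natr (cyl_big G r x))).
rewrite -ED; [|exact: cyl_Zf..].
rewrite -(E_Ie p e cZ).
apply: (@le_trans _ _ (E p (fun om => p * psil N ^+ 2 * Ie p e (fun om => (sg N x y om)%:R) om -
   (big (upd om e true) x r)%:R))).
  rewrite EB //; last by apply: cylM => //; apply: cyl_cst.
  rewrite EZ // E_Ie; last exact: cyl_natr.
  apply: lerD => //; rewrite lerN2 ler_pdivlMr // mulrC.
  apply: le_trans hb; apply: (@E_surgery _ _ p e (fun om => (big om x r)%:R)) => //.
  exact/cyl_natr/(cyl_big G).
apply: E_le => //.
- by apply: cylD; [apply: cylM => //; apply: cyl_cst|apply: cylN].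
- exact: cyl_Ie.
- move=> om; rewrite /Ie (_ : sg N x y (upd om e true) = false) ?mulr0 ?add0r; first exact: Z_pointwise.
  rewrite /sg; case: (boolP (finr (upd om e true) x)) => f1; rewrite ?andbF //=.
  suff -> : y \in K (upd om e true) x by rewrite !andbF.
  by apply/(mem_fin G _ f1); apply: conn_eo; rewrite /eo Ee upd_same.
Qed.

(** An edge with both endpoints in the cluster is met in both orientations, which explains the
    halves in [wt]; a closed boundary edge is met once and carries the full [p]. *)
Lemma hfl_pairs om v : finr om v ->
  \sum_(x <- K om v) \sum_(y <- nbr x) wt om x y = hfl p om (K om v).
Proof.
move=> fv; rewrite (sum_pairs_edges G) ?reach_uniq //; rewrite /hfl big_seq [RHS]big_seq.
apply: eq_bigr => e; rewrite (mem_tE G) => eK.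
set a := (val e).1 in eK *; set b := (val e).2 in eK *.
have Eab : ed nbr a b = Some e by apply: ed_fst_snd.
have eab : eo om a b = om e by rewrite /eo Eab.
have eba : eo om b a = om e by rewrite eoC.
have mc z : z \in K om v -> forall w, (w \in K om v) = (w \in K om z).
  move=> /(mem_fin G _ fv) vz w; exact: perm_mem (fin_reach_eq G fv vz) w.
rewrite /wt eab eba; case oe : (om e).
  have ab : (a \in K om v) = (b \in K om v).
    apply/idP/idP => /(mem_fin G _ fv) h; apply/(mem_fin G _ fv); apply: (conn_trans h);
    by apply: conn_eo; rewrite ?eab ?eba.
  rewrite ab orbb in eK; rewrite ab eK mulr1n; field => //.
rewrite mulr0n subr0.
case: (boolP (a \in K om v)) => ha; case: (boolP (b \in K om v)) => hb.
- rewrite -(mc a ha b) hb -(mc b hb a) ha; field => //.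
- by rewrite -(mc a ha b) (negbTE hb) addr0.
- by rewrite -(mc b hb a) (negbTE ha) add0r.
- by rewrite (negbTE ha) (negbTE hb) in eK.
Qed.

Context {O : seq V} {mu : V -> R}.
Hypothesis MT : mtp_measure nbr O mu.

Lemma wt_aut g (Ag : is_aut nbr g) om x y : wt (om \o ge g) x y = wt om (g x) (g y).
Proof. by rewrite /wt (eo_ge G Ag) (reach_ge G Ag). Qed.

Lemma fin_aut g (Ag : is_aut nbr g) om x : finr (om \o ge g) x = finr om (g x).
Proof. by rewrite /fin (big_ge G Ag). Qed.

Lemma cs_aut g (Ag : is_aut nbr g) om x : csr (om \o ge g) x = csr om (g x).
Proof. by rewrite /cs (size_reach_ge G Ag). Qed.

Lemma Zf_aut g x y : is_aut nbr g -> E p (Zf (g x) (g y)) = E p (Zf x y).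
Proof.
move=> Ag; apply: (E_aut G Ag); first exact: cyl_Zf.
by move=> om; rewrite /Zf (wt_aut Ag) (fin_aut Ag) (cs_aut Ag).
Qed.

Lemma sum_ball1 (F : V -> R) o : (forall y, y \notin nbr o -> F y = 0) ->
  \sum_(y <- ball nbr 1 o) F y = \sum_(y <- nbr o) F y.
Proof.
move=> HF; rewrite (bigID (fun y => y \in nbr o)) /= [X in _ + X]big1 ?addr0 //.
rewrite -big_filter; have HP : perm_eq [seq y <- ball nbr 1 o | y \in nbr o] (nbr o).
  apply: uniq_perm; rewrite ?filter_uniq ?reach_uniq ?(nbr_uniq G) // => y.
  by rewrite mem_filter; case: (boolP (y \in nbr o)) => // /(nbr_ball G).
by rewrite (perm_big _ HP).
Qed.

Lemma Z_symmetrize : 2 * (\sum_(o <- O) mu o * \sum_(y <- nbr o) E p (Zf o y)) =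
  \sum_(o <- O) mu o * \sum_(y <- nbr o) (E p (Zf o y) + E p (Zf y o)).
Proof.
pose f x y : R := (y \in nbr x)%:R * E p (Zf x y).
have fg g : is_aut nbr g -> forall u w, f (g u) (g w) = f u w.
  by move=> Ag u w; rewrite /f Zf_aut // (aut_mem_nbr Ag).
have fB u w : w \notin ball nbr 1 u -> f u w = 0.
  move=> h; rewrite /f (_ : w \in nbr u = false) ?mul0r //.
  by apply/negbTE; apply: contra h; apply: nbr_ball.
have := mtp_fin G MT fg fB.
have e1 o : \sum_(w <- ball nbr 1 o) f o w = \sum_(y <- nbr o) E p (Zf o y).
  rewrite sum_ball1; last by move=> y /negbTE h; rewrite /f h mul0r.
  by rewrite big_seq [RHS]big_seq; apply: eq_bigr => y h; rewrite /f h mul1r.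
have e2 o : \sum_(w <- ball nbr 1 o) f w o = \sum_(y <- nbr o) E p (Zf y o).
  rewrite (sum_ball1 (F := fun w => f w o)); last by move=> y; rewrite (nbrC G) => /negbTE h; rewrite /f h mul0r.
  by rewrite big_seq [RHS]big_seq; apply: eq_bigr => y h; rewrite /f (nbrC G) h mul1r.
under eq_bigr do rewrite e1; under [in RHS]eq_bigr do rewrite e2.
move=> H; under [RHS]eq_bigr do rewrite big_split /= mulrDr.
by rewrite big_split /= -H mulr2n mulrDl mul1r.
Qed.

(** Mass transport inside clusters: [v] sends to each [x] of its cluster the weights around [x]
    times [psi] over the cluster size. What [o] receives comes from equally many vertices as the
    size, which cancels. *)
Lemma Z_flow : \sum_(o <- O) mu o * \sum_(y <- nbr o) E p (Zf o y) =
  \sum_(o <- O) mu o * E p (flow (nbr := nbr) p r lam o).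
Proof.
pose F v x om : R := (finr om v && (x \in K om v))%:R * (psil (csr om v) / (csr om v)%:R) *
  \sum_(y <- nbr x) wt om x y.
have cF v x : cyl (F v x).
  apply: cylM; last by apply: cyl_sum => y; apply: cyl_wt.
  apply: cylM; last exact: cyl_psi_size.
  by apply: cyl_natr; apply: cyl_and; [apply: cyl_fin|apply: cyl_tau].
pose f v x : R := E p (F v x).
have fg g : is_aut nbr g -> forall u w, f (g u) (g w) = f u w.
  move=> Ag u w; apply: (E_aut G Ag) => // om.
  rewrite /F (fin_aut Ag) (cs_aut Ag) (reach_ge G Ag) (sum_nbr_aut G Ag); congr (_ * _).
  by apply: eq_bigr => y _; rewrite (wt_aut Ag).
have fB u w : w \notin ball nbr r u -> f u w = 0.
  move=> h; rewrite /f (eq_E _ (g := fun=> 0)) ?E_cst // => om.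
  rewrite /F (_ : w \in K om u = false) ?andbF ?mul0r //.
  by apply/negbTE; apply: contra h; apply: reach_ball.
have H := mtp_fin G MT fg fB.
transitivity (\sum_(o <- O) mu o * \sum_(w <- ball nbr r o) f w o); last first.
  rewrite -H; apply: eq_bigr => o _; congr (_ * _).
  rewrite -E_sum //; apply: eq_E => om; rewrite /flow.
  case: (boolP (finr om o)) => fo; last first.
    by rewrite !mul0r big1 // => w _; rewrite /F (negbTE fo) !mul0r.
  rewrite mul1r -hfl_pairs // mulr_sumr.
  rewrite (bigID (fun w => w \in K om o)) /= [X in _ + X]big1 ?addr0; last first.
    by move=> w /negbTE h; rewrite /F h andbF !mul0r.
  rewrite -big_filter; have HP : perm_eq [seq w <- ball nbr r o | w \in K om o] (K om o).
    apply: uniq_perm; rewrite ?filter_uniq ?reach_uniq // => w.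
    by rewrite mem_filter; case: (boolP (w \in K om o)) => // /(reach_ball G).
  rewrite (perm_big _ HP) /= big_seq [RHS]big_seq; apply: eq_bigr => w wK.
  by rewrite /F fo wK mul1r.
apply: eq_bigr => o _; congr (_ * _).
rewrite -E_sum; last by move=> y; apply: cyl_Zf.
rewrite -E_sum //.
apply: eq_E => om; rewrite /Zf -mulr_sumr.
case: (boolP (finr om o)) => fo; last first.
  rewrite !mul0r big1 // => w _; rewrite /F; case: (boolP (finr om w && _)) => h; last by rewrite !mul0r.
  case/andP: h => fw /(mem_fin G _ fw) wo.
  by move: fo; rewrite /fin -(conn_big G _ wo) (fw : ~~ _).
have key w : F w o om = (w \in K om o)%:R * (psil (csr om o) / (csr om o)%:R * \sum_(y <- nbr o) wt om o y).
  rewrite /F; case: (boolP (w \in K om o)) => h.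
    have ow : conn om o w by apply/(mem_fin G _ fo).
    have fw : finr om w by rewrite /fin -(conn_big G _ ow).
    by rewrite fw (reach_sym G) h /cs (perm_size (fin_reach_eq G fo ow)) -mulrA.
  by rewrite (reach_sym G) (negbTE h) andbF !mul0r.
under [RHS]eq_bigr do rewrite key.
rewrite -mulr_suml -size_sum_mem ?reach_uniq //; last exact: reach_ball.
rewrite mulrA [_%:R * (_ / _)]mulrCA divff ?mulr1 ?mul1r //.
by rewrite pnatr_eq0 -lt0n cs_gt0.
Qed.

Hypothesis mu1 : \sum_(o <- O) mu o = 1.
Hypothesis mu0 : forall o, o \in O -> 0 <= mu o.

Lemma two_ghost_sum N k (eta beta : R) : 0 <= eta <= 1 -> 0 < p ->
  (forall v, Pr p (fun om => big om v r) <= beta) -> 0 <= beta ->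
  \sum_(o <- O) mu o * \sum_(y <- nbr o) (p * psil N ^+ 2 * Pr p (sg N o y)) <=
  2 * Phi M lam k eta + M%:R * (beta / p).
Proof.
move=> eta01 pgt hb b0.
apply: (@le_trans _ _ (\sum_(o <- O) mu o * \sum_(y <- nbr o) (E p (Zf o y) + E p (Zf y o)) +
   \sum_(o <- O) mu o * (M%:R * (beta / p)))).
  rewrite -big_split /= big_seq [leRHS]big_seq; apply: ler_sum => o oO; rewrite -mulrDr.
  apply: ler_wpM2l; first exact: mu0.
  apply: (@le_trans _ _ (\sum_(y <- nbr o) (E p (Zf o y) + E p (Zf y o) + beta / p))).
    rewrite big_seq [leRHS]big_seq; apply: ler_sum => y yo; rewrite -lerBlDr; exact: E_Z_ge.
  rewrite big_split /= lerD2l big_const_seq count_predT iter_addr_0.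
  rewrite -[leLHS]mulr_natl; apply: ler_wpM2r; rewrite ?divr_ge0 // ler_nat; exact: dM.
rewrite -Z_symmetrize Z_flow -mulr_suml mu1 mul1r lerD2r; apply: ler_wpM2l => //.
rewrite -[leRHS]mul1r -mu1 mulr_suml big_seq [leRHS]big_seq; apply: ler_sum => o oO.
by apply: ler_wpM2l; [exact: mu0|exact: E_flow].
Qed.

Lemma sg_aut N g x y : is_aut nbr g -> Pr p (sg N (g x) (g y)) = Pr p (sg N x y).
Proof.
move=> Ag; apply: (E_aut G Ag); first exact/cyl_natr/cyl_sg.
by move=> om; rewrite /sg !(fin_aut Ag) !(big_ge G Ag) (reach_ge G Ag).
Qed.

(* The cutoff [r] keeps all observables local; clusters larger than [r] are charged to [beta]. *)
Lemma two_ghost N k (eta beta eps : R) : 0 <= eta <= 1 -> 0 < p -> 0 < eps -> 1 / 2 <= psil N ->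
  (forall v, exists o, o \in O /\ same_orbit nbr o v) -> (forall o, o \in O -> eps <= mu o) ->
  (forall v, Pr p (fun om => big om v r) <= beta) -> 0 <= beta ->
  forall x y, y \in nbr x ->
  Pr p (sg N x y) <= 4 / (p * eps) * (2 * Phi M lam k eta + M%:R * (beta / p)).
Proof.
move=> eta01 pgt eps0 psN orb mue hb b0.
have S0 x y : 0 <= Pr p (sg N x y) by apply: Pr_ge0 => //; apply: cyl_sg.
suff H o y : o \in O -> y \in nbr o ->
    Pr p (sg N o y) <= 4 / (p * eps) * (2 * Phi M lam k eta + M%:R * (beta / p)).
  move=> x y yx; have [w [wO [g [Ag gx]]]] := orb x; rewrite -gx in yx *.
  have [y' yy'] := aut_surj Ag y; rewrite yy' (aut_mem_nbr Ag) in yx *.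
  by rewrite sg_aut //; apply: H.
move=> oO yo.
have := two_ghost_sum N k eta01 pgt hb b0; set RHS := (X in _ <= X).
have T0 x z : 0 <= p * psil N ^+ 2 * Pr p (sg N x z) by rewrite mulr_ge0 // mulr_ge0 ?sqr_ge0.
rewrite (big_rem o) //= (big_rem y) //=.
have r0 : 0 <= \sum_(z <- rem y (nbr o)) p * psil N ^+ 2 * Pr p (sg N o z) by apply: sumr_ge0.
have r1 : 0 <= \sum_(z <- rem o O) mu z * \sum_(y0 <- nbr z) p * psil N ^+ 2 * Pr p (sg N z y0).
  rewrite big_seq; apply: sumr_ge0 => z /mem_rem zO; rewrite mulr_ge0 ?mu0 //.
  exact: sumr_ge0.
move=> h; have {}h : mu o * (p * psil N ^+ 2 * Pr p (sg N o y)) <= RHS.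
  apply: le_trans h; rewrite mulrDr -addrA lerDl addr_ge0 // mulr_ge0 ?mu0 //.
(* Keeping the single term [(o, y)] of the sum costs [mu o >= eps], and [psi N >= 1 / 2] enters
   squared. *)
have h2 : eps * (p * (1 / 4) * Pr p (sg N o y)) <= RHS.
  apply: le_trans h; apply: ler_pM => //; first exact: ltW.
  - by rewrite !mulr_ge0.
  - exact: mue.
  - apply: ler_wpM2r => //; apply: ler_wpM2l => //.
    by rewrite (_ : 1 / 4 = (1 / 2) ^+ 2); [apply: lerXn2r; rewrite ?nnegrE //; lra|field => //].
rewrite mulrAC ler_pdivlMr ?mulr_gt0 //.
have h4 : (0 : R) <= 4 by [].
apply: le_trans (ler_wpM2l h4 h2); rewrite le_eqVlt; apply/orP; left; apply/eqP; field => //.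
Qed.

End TwoGhostIdentity.

(** * Random walk returns to the starting cluster *)

Section Doubling.
Context {R : realType} {V : countType} {nbr : V -> seq V}.
Hypothesis G : simple_graph nbr.
Hypothesis dpos : forall v, (0 < size (nbr v))%N.
Local Notation cfg := (Edge nbr -> bool).
Local Notation rw n u w := (@rw_p V nbr R n u w).
Local Notation deg v := ((size (nbr v))%:R : R).
Local Notation Ball k v := (ball nbr k v).
Implicit Types (om : cfg) (u v w x y z o : V) (e : Edge nbr).
Context {p : R}.
Hypothesis p01 : 0 <= p <= 1.
Context {O : seq V} {mu : V -> R}.
Hypothesis MT : mtp_measure nbr O mu.
Hypothesis mu0 : forall o, o \in O -> 0 <= mu o.
Context {N N' : nat}.

Lemma sum_subset (A B : seq V) (F : V -> R) : uniq A -> uniq B -> {subset A <= B} ->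
  (forall w, w \notin A -> F w = 0) -> \sum_(w <- B) F w = \sum_(w <- A) F w.
Proof.
move=> uA uB sAB FA; rewrite (bigID (fun w => w \in A)) /= [X in _ + X]big1 ?addr0 //.
rewrite -big_filter; have HP : perm_eq [seq w <- B | w \in A] A.
  apply: uniq_perm; rewrite ?filter_uniq // => w.
  by rewrite mem_filter; case: (boolP (w \in A)) => // /sAB.
by rewrite (perm_big _ HP).
Qed.

Lemma sum_ball_aut g k u (F : V -> R) : is_aut nbr g ->
  \sum_(w <- Ball k (g u)) F w = \sum_(w <- Ball k u) F (g w).
Proof.
move=> Ag; rewrite -(big_map g xpredT F).
have HP := reach_ge_perm G Ag k (fun=> true) u.
by rewrite -(perm_big _ HP).
Qed.

Definition midsize om v := big om v N && ~~ big om v N'.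

Definition kap u w om := midsize om u && (w \in reach N' om u).

Lemma cyl_midsize v : cyl (fun om => midsize om v).
Proof. by apply: cyl_and; [|apply: cyl_not]; apply: cyl_big. Qed.

Lemma cyl_kap u w : cyl (kap u w).
Proof. by apply: cyl_and (cyl_tau _ _ _ _) => //; apply: cyl_midsize. Qed.

Lemma kap_aut g u w : is_aut nbr g -> Pr p (kap (g u) (g w)) = Pr p (kap u w).
Proof.
move=> Ag; apply: (E_aut G Ag); first exact/cyl_natr/cyl_kap.
by move=> om; rewrite /kap /midsize !(big_ge G Ag) (reach_ge G Ag).
Qed.

(** The weight [deg o] is the reversing measure of the walk; it allows [tm2_le] to reverse the first
    half of the walk after transport. *)
Definition tm m : R :=
  \sum_(o <- O) mu o * (deg o * \sum_(w <- Ball m o) rw m o w * Pr p (kap o w)).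

Definition tm0 : R := \sum_(o <- O) mu o * (deg o * Pr p (fun om => midsize om o)).

Definition hit m o om : R := \sum_(w <- Ball m o) rw m o w * (w \in reach N' om o)%:R.

Definition tm2 m : R :=
  \sum_(o <- O) mu o * (deg o * E p (fun om => (midsize om o)%:R * hit m o om ^+ 2)).

Lemma cyl_hit m o : cyl (hit m o).
Proof.
apply: cyl_sum => w; apply: cylM; first exact: cyl_cst.
exact/cyl_natr/(cyl_tau G).
Qed.

Lemma cyl_mid o : cyl (fun om => (midsize om o)%:R : R).
Proof. exact/cyl_natr/cyl_midsize. Qed.

Lemma tm_hit m : tm m = \sum_(o <- O) mu o * (deg o * E p (fun om => (midsize om o)%:R * hit m o om)).
Proof.
apply: eq_bigr => o _; congr (_ * (_ * _)).
have ck w : cyl (fun om => rw m o w * (kap o w om)%:R).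
  by apply: cylM; [apply: cyl_cst|apply/cyl_natr/cyl_kap].
transitivity (\sum_(w <- Ball m o) E p (fun om => rw m o w * (kap o w om)%:R)).
  by apply: eq_bigr => w _; rewrite EZ //; apply/cyl_natr/cyl_kap.
rewrite -E_sum //; apply: eq_E => om; rewrite /hit mulr_sumr; apply: eq_bigr => w _.
by rewrite /kap -mulnb natrM mulrCA.
Qed.

Lemma quadratic_nonneg (a b c : R) : 0 <= a -> (forall s, 0 <= c - 2 * s * b + s ^+ 2 * a) ->
  b ^+ 2 <= c * a.
Proof.
move=> a0 H; have [a_eq|an0] := eqVneq a 0.
  have [b_eq|bn0] := eqVneq b 0; first by rewrite a_eq b_eq mulr0 expr2 mul0r.
  have := H ((c + 1) / (2 * b)); rewrite a_eq mulr0 addr0.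
  rewrite (_ : 2 * _ * b = c + 1); last by field.
  by rewrite opprD addrA subrr sub0r ler0N1.
have agt : 0 < a by rewrite lt0r an0.
have := H (b / a); rewrite (_ : _ - _ + _ = (c * a - b ^+ 2) / a); last by field.
by rewrite pmulr_lge0 ?invr_gt0 // subr_ge0.
Qed.

Lemma tm_cauchy m : tm m ^+ 2 <= tm2 m * tm0.
Proof.
apply: quadratic_nonneg.
  rewrite /tm0 big_seq; apply: sumr_ge0 => o oO; rewrite mulr_ge0 ?mu0 // mulr_ge0 //.
  by apply: Pr_ge0 => //; apply: cyl_midsize.
move=> s; rewrite tm_hit /tm2 /tm0 !mulr_sumr -sumrB -big_split /= big_seq.
apply: sumr_ge0 => o oO; have cm := cyl_mid o; have ch := cyl_hit m o.
have c1 : cyl (fun om => (midsize om o)%:R * hit m o om) by apply: cylM.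
have c2 : cyl (fun om => (midsize om o)%:R * hit m o om ^+ 2).
  by apply: cylM => //; exact: (cyl_comp (fun x : R => x ^+ 2) ch).
have -> : mu o * (deg o * E p (fun om => (midsize om o)%:R * hit m o om ^+ 2)) -
   2 * s * (mu o * (deg o * E p (fun om => (midsize om o)%:R * hit m o om))) +
   s ^+ 2 * (mu o * (deg o * Pr p (fun om => midsize om o))) =
   mu o * (deg o * (E p (fun om => (midsize om o)%:R * hit m o om ^+ 2) +
     ((- (2 * s)) * E p (fun om => (midsize om o)%:R * hit m o om) +
      s ^+ 2 * Pr p (fun om => midsize om o)))) by ring.
rewrite mulr_ge0 ?mu0 // mulr_ge0 // /Pr -!EZ //.
have c3 : cyl (fun om => - (2 * s) * ((midsize om o)%:R * hit m o om)).
  by apply: (cylM _ c1); apply: cyl_cst.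
have c4 : cyl (fun om => s ^+ 2 * (midsize om o)%:R) by apply: (cylM _ cm); apply: cyl_cst.
rewrite -!ED //; last exact: cylD.
apply: E_ge0 => //; first by apply: cylD => //; apply: cylD.
move=> om; rewrite (_ : _ + _ = (midsize om o)%:R * (hit m o om - s) ^+ 2); last by ring.
by rewrite mulr_ge0 // sqr_ge0.
Qed.

(* Mass transport moves the root to the midpoint of the walk, turning the
   two-step return into a sum of squares over clusters. *)
Lemma tm2_le m : tm2 m <= tm (m + m).
Proof.
pose f u z : R := deg u * rw m u z * \sum_(w <- Ball (m + m) u) rw m z w * Pr p (kap u w).
have fg g : is_aut nbr g -> forall u w, f (g u) (g w) = f u w.
  move=> Ag u w; rewrite /f (aut_deg G Ag) (rw_aut G Ag) (sum_ball_aut _ _ _ Ag); congr (_ * _).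
  by apply: eq_bigr => z _; rewrite (rw_aut G Ag) kap_aut.
have fB u w : w \notin Ball m u -> f u w = 0.
  by move=> h; rewrite /f (rw_supp G) // mulr0 mul0r.
have H := mtp_fin G MT fg fB.
have -> : tm (m + m) = \sum_(o <- O) mu o * \sum_(w <- Ball m o) f o w.
  apply: eq_bigr => o _; congr (_ * _); rewrite /f.
  rewrite [RHS](eq_bigr (fun z => deg o * (rw m o z * \sum_(w <- Ball (m + m) o) rw m z w * Pr p (kap o w)))); last first.
    by move=> z _; rewrite mulrA.
  rewrite -mulr_sumr; congr (_ * _).
  under [RHS]eq_bigr do rewrite mulr_sumr.
  rewrite exchange_big /=; apply: eq_bigr => w _.
  have uB : uniq (Ball m o) by apply: reach_uniq.
  rewrite (@rw_CK _ _ _ G m m o w _ uB) // mulr_suml.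
  by apply: eq_bigr => z _; rewrite mulrA.
rewrite H /tm2 big_seq [leRHS]big_seq; apply: ler_sum => o oO.
apply: ler_wpM2l; first exact: mu0.
have -> : \sum_(w <- Ball m o) f w o =
    deg o * \sum_(z <- Ball m o) rw m o z * \sum_(w <- Ball m o) rw m o w * Pr p (kap z w).
  rewrite mulr_sumr big_seq [RHS]big_seq; apply: eq_bigr => z zo.
  rewrite /f (rw_rev G dpos) -mulrA; congr (_ * (_ * _)).
  apply: sum_subset; rewrite ?reach_uniq //.
    move=> w /(reachP G)[s [ps [sw sm]]]; move: zo; rewrite /ball (reach_sym G) => /(reachP G)[t [pt [tz tm']]].
    apply/(reachP G); exists (t ++ s); rewrite size_cat leq_add // last_cat tz; split=> //.
    by apply/ppath_cat; rewrite tz.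
  by move=> w /(rw_supp G) -> ; rewrite mul0r.
apply: ler_wpM2l => //.
have ck z w : cyl (fun om => rw m o z * (rw m o w * (kap z w om)%:R)).
  by apply: cylM; [apply: cyl_cst|apply: cylM; [apply: cyl_cst|apply/cyl_natr/cyl_kap]].
have -> : \sum_(z <- Ball m o) rw m o z * \sum_(w <- Ball m o) rw m o w * Pr p (kap z w) =
   E p (fun om => \sum_(z <- Ball m o) \sum_(w <- Ball m o) rw m o z * (rw m o w * (kap z w om)%:R)).
  rewrite E_sum; last by move=> z; apply: cyl_sum.
  apply: eq_bigr => z _; rewrite mulr_sumr E_sum //; apply: eq_bigr => w _.
  rewrite EZ; last by apply: cylM; [apply: cyl_cst|apply/cyl_natr/cyl_kap].
  by rewrite EZ //; apply/cyl_natr/cyl_kap.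
apply: E_le => //.
- by apply: (cylM (cyl_mid o)); exact: (cyl_comp (fun x : R => x ^+ 2) (cyl_hit m o)).
- by apply: cyl_sum => z; apply: cyl_sum.
move=> om; case: (boolP (midsize om o)) => mid; last first.
  rewrite mul0r; apply: sumr_ge0 => z _; apply: sumr_ge0 => w _.
  by rewrite !mulr_ge0 ?rw_ge0.
rewrite mul1r expr2 /hit mulr_suml; apply: ler_sum => z _.
rewrite mulr_sumr; apply: ler_sum => w _.
rewrite -mulrA; apply: ler_wpM2l; first exact: rw_ge0.
rewrite mulrCA; apply: ler_wpM2l; first exact: rw_ge0.
rewrite -natrM mulnb ler_nat; case: (boolP (_ && _)) => // /andP[hz hw].
case/andP: (mid) => _ fo; have oz := reach_conn G hz; have ow := reach_conn G hw.
have zw : conn om z w by apply: conn_trans (conn_sym oz) ow.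
have mz : midsize om z by rewrite /midsize -!(conn_big G _ oz).
rewrite /kap mz /=; case/andP: mz => _ fz.
by rewrite (_ : w \in _ = true) //; apply/(mem_fin G _ fz).
Qed.

Lemma tm_double m : tm m ^+ 2 <= tm (m + m) * tm0.
Proof.
apply: le_trans (tm_cauchy m) _; apply: ler_wpM2r; last exact: tm2_le.
rewrite /tm0 big_seq; apply: sumr_ge0 => o oO; rewrite mulr_ge0 ?mu0 // mulr_ge0 //.
by apply: Pr_ge0 => //; apply: cyl_midsize.
Qed.

Lemma tm0_ge0 : 0 <= tm0.
Proof.
rewrite /tm0 big_seq; apply: sumr_ge0 => o oO; rewrite mulr_ge0 ?mu0 // mulr_ge0 //.
by apply: Pr_ge0 => //; apply: cyl_midsize.
Qed.

Lemma tm_ge0 m : 0 <= tm m.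
Proof.
rewrite /tm big_seq; apply: sumr_ge0 => o oO; rewrite mulr_ge0 ?mu0 // mulr_ge0 //.
by apply: sumr_ge0 => w _; rewrite mulr_ge0 ?rw_ge0 //; apply: Pr_ge0 => //; apply: cyl_kap.
Qed.

(** The law of the walk gives mass at most [b] to each of the fewer than [N'] vertices of the
    cluster. *)
Lemma tm_upper m (b : R) : 0 <= b -> (forall u w, rw m u w <= b) -> tm m <= tm0 * (N'%:R * b).
Proof.
move=> b0 hb; rewrite /tm0 mulr_suml /tm big_seq [leRHS]big_seq; apply: ler_sum => o oO.
rewrite -!mulrA; apply: ler_wpM2l; first exact: mu0.
apply: ler_wpM2l => //.
apply: (@le_trans _ _ (\sum_(w <- Ball m o) b * Pr p (kap o w))).
  apply: ler_sum => w _; apply: ler_wpM2r => //; apply: Pr_ge0 => //; exact: cyl_kap.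
rewrite -mulr_sumr mulrA [leRHS]mulrC; apply: ler_wpM2l => //.
rewrite -E_sum; last by move=> w; apply/cyl_natr/cyl_kap.
rewrite mulrC -EZ; last exact: cyl_mid.
apply: E_le => //; first by apply: cyl_sum => w; apply/cyl_natr/cyl_kap.
  by apply: (cylM _ (cyl_mid o)); apply: cyl_cst.
move=> om; rewrite /kap; case: (boolP (midsize om o)) => mid /=; last first.
  by rewrite big1 ?mulr0.
rewrite mulr1; apply: (@le_trans _ _ (size (reach N' om o))%:R).
  by apply: sum_mem_le; apply: reach_uniq.
by rewrite ler_nat; case/andP: mid => _; rewrite /big -ltnNge => /ltnW.
Qed.

(** Each use of [tm_double] takes a square root of [tm / tm0], so after [k] doublings only
    [rh ^+ (2 ^ k)] has to dominate the crude bound of [tm_upper]. *)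
Lemma tm_iterate k m (b rh : R) : 0 <= rh -> 0 <= b -> (forall u w, rw (2 ^ k * m) u w <= b) ->
  N'%:R * b <= rh ^+ (2 ^ k) -> tm m <= tm0 * rh.
Proof.
elim: k m rh => [|k IH] m rh rh0 b0 hb hrh.
  rewrite expr1 in hrh; rewrite mul1n in hb.
  by apply: (le_trans (tm_upper b0 hb)); apply: ler_wpM2l hrh; apply: tm0_ge0.
have := IH (m + m)%N (rh ^+ 2); rewrite sqr_ge0 -exprM -expnS => /(_ isT b0).
have -> : (2 ^ k * (m + m) = 2 ^ k.+1 * m)%N by rewrite expnS addnn -muln2; lia.
move=> /(_ hb hrh) h.
have := le_trans (tm_double m) (ler_wpM2r tm0_ge0 h).
rewrite (_ : tm0 * rh ^+ 2 * tm0 = (tm0 * rh) ^+ 2); last by ring.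
by rewrite ler_pXn2r // nnegrE ?tm_ge0 // mulr_ge0 // tm0_ge0.
Qed.

End Doubling.

(** * A recursive inequality for the cluster tail *)

Section MainInequality.
Context {R : realType} {V : countType} {nbr : V -> seq V}.
Hypothesis G : simple_graph nbr.
Hypothesis dpos : forall v, (0 < size (nbr v))%N.
Local Notation cfg := (Edge nbr -> bool).
Local Notation rw n u w := (@rw_p V nbr R n u w).
Local Notation deg v := ((size (nbr v))%:R : R).
Local Notation Ball k v := (ball nbr k v).
Local Notation sgr r N x y := (@sg V nbr r N x y).
Local Notation kapp N N' x y := (@kap V nbr N N' x y).
Implicit Types (om : cfg) (u v w x y z o : V) (e : Edge nbr).
Context {p : R}.
Hypothesis p01 : 0 <= p <= 1.
Hypothesis pgt : 0 < p.

(** Suppose the cluster of [x] stays below the cutoff after opening [ux]. If it contains [w], then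
    [x] and [w] were already joined before, and the event holds for [u], [x]. If not, the cluster of
    [w] is unchanged while [x] has joined that of [u], so the event passes to [x], [w]. *)
Lemma sg_step r N u x w om e : ed nbr u x = Some e ->
  sgr r N u w om -> [|| sgr r N u x om, sgr r N x w (upd om e true) |
    big (upd om e true) x r].
Proof.
set om1 := upd om e true => E /and5P[bu bw fu fw wu].
have le : forall e', om e' ==> om1 e'.
  by move=> e'; rewrite /om1 /upd; case: eqP => [_|_]; rewrite ?implybT ?implybb.
have nuw : ~ conn om u w by move=> h; move: wu; rewrite (mem_fin G _ fu).2.
have e1 : eo om1 u x by rewrite /eo E /om1 upd_same.
case: (boolP (big om1 x r)) => bx; first by rewrite !orbT.
have fx1 : fin r om1 x by [].
rewrite orbF; apply/orP.
have omE : (exists2 z, conn om1 u z & ~ conn om u z) -> om = upd om e false.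
  move=> [z h nh]; rewrite -[LHS](upd_id om e); case oe : (om e) => //.
  by exfalso; apply: nh; move: h; rewrite /om1 -oe upd_id.
case: (pselect (conn om1 x w)) => xw.
  left; have uw1 : conn om1 u w by apply: conn_trans (conn_eo e1) xw.
  have omf := omE (ex_intro2 _ _ w uw1 nuw).
  have xw0 : conn om x w by have /(conn_upd om w E) := uw1; rewrite -omf; case.
  have fx : fin r om x by rewrite /fin (conn_big G _ xw0).
  apply/and5P; split=> //; first by rewrite (conn_big G _ xw0).
  by apply: contraNN wu => xu; apply/(mem_fin G _ fu); apply: conn_trans xw0; apply/(mem_fin G _ fu).
right.
have same z : conn om1 w z -> conn om w z.
  move: z; apply: conn_ind; first exact: conn_refl.
  move=> a b wa IH; rewrite {1}/eo; case Eab : (ed nbr a b) => [e'|//] oe'.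
  apply: (conn_trans IH); apply: conn_eo; rewrite /eo Eab.
  move: oe'; rewrite /om1 /upd; case: eqP => // ee _; exfalso; apply: xw.
  rewrite ee in Eab; have ax : conn om1 a x.
    by case: (ed_eq Eab E) => -[-> _]; [apply: conn_eo|apply: conn_refl].
  exact: conn_sym (conn_trans wa ax).
have fw1 : fin r om1 w.
  apply: contraNN fw => /(bigP G)[s [us sN sc]]; apply/(bigP G); exists s; split=> // z /sc.
  exact: same.
apply/and5P; split=> //.
- rewrite -(conn_big G _ (conn_eo e1)); exact: (big_mono G le).
- exact: (big_mono G le).
- by apply/negP => /(mem_fin G _ fx1).
Qed.

(** Along a path, [sg_step] produces at most one adjacent two-ghost event and one cutoff event per
    edge, and each edge opened by force costs a factor [p^-1]. *)
Lemma sg_ball r N (sigma beta : R) k u w : 0 <= sigma -> 0 <= beta ->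
  (forall x y, y \in nbr x -> Pr p (sgr r N x y) <= sigma) ->
  (forall v, Pr p (fun om => big om v r) <= beta) ->
  w \in Ball k u -> Pr p (sgr r N u w) <= k%:R * (p^-1) ^+ k * (sigma + beta).
Proof.
move=> s0 b0 hs hb; have p1 : p <= 1 by case/andP: p01.
have pi1 : 1 <= p^-1 by rewrite invf_ge1.
have pi0 : 0 <= p^-1 by apply: le_trans pi1.
elim: k u => [|k IH] u.
  rewrite inE => /eqP ->; rewrite !mul0r.
  rewrite (_ : Pr p _ = 0) // /Pr -(E_cst (T := Edge nbr) p 0); apply: eq_E => om.
  by rewrite /sg mem_reach0 // !andbF.
rewrite /ball (reach_sym G) => /(mem_reachS G)[|[x]].
  rewrite -(reach_sym G) => /IH h; apply: (le_trans h); apply: ler_wpM2r; first exact: addr_ge0.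
  apply: ler_pM; rewrite ?exprn_ge0 ?ler_nat //.
  by apply: ler_weXn2l.
rewrite -(reach_sym G) eoC (eo_all G) => wx xu.
have [e Ee] := adj_ed G xu.
have cs a b : cyl (fun om => (sgr r N a b om)%:R : R) by apply: cyl_natr; apply: cyl_sg.
have cb : cyl (fun om => (big om x r)%:R : R) by apply/cyl_natr/(cyl_big G).
have h1 : Pr p (sgr r N u w) <= Pr p (sgr r N u x) +
    (E p (fun om => (sgr r N x w (upd om e true))%:R) + E p (fun om => (big (upd om e true) x r)%:R)).
  have c1 : cyl (fun om => (sgr r N x w (upd om e true))%:R : R) by apply: (cyl_upd (f := fun om => (sgr r N x w om)%:R)); apply: cs.
  have c2 : cyl (fun om => (big (upd om e true) x r)%:R : R) by apply: (cyl_upd (f := fun om => (big om x r)%:R)).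
  rewrite /Pr -!ED //; try exact: cylD; try exact: cs.
  apply: E_le => //.
  by apply: cylD; [apply: cs|apply: cylD].
  move=> om; case: (boolP (sgr r N u w om)) => h; last by rewrite !addr_ge0.
  by rewrite -!natrD ler1n !addn_gt0; case/or3P: (sg_step Ee h) => ->; rewrite ?orbT.
apply: (le_trans h1).
have h2 : E p (fun om => (sgr r N x w (upd om e true))%:R) <= p^-1 * (k%:R * p^-1 ^+ k * (sigma + beta)).
  rewrite ler_pdivlMl //; apply: le_trans (IH x wx).
  by apply: (@E_surgery _ _ p e (fun om => (sgr r N x w om)%:R)) => //; apply: cs.
have h3 : E p (fun om => (big (upd om e true) x r)%:R) <= p^-1 * beta.
  rewrite ler_pdivlMl //; apply: le_trans (hb x).
  by apply: (@E_surgery _ _ p e (fun om => (big om x r)%:R)).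
apply: (le_trans (lerD (hs _ _ xu) (lerD h2 h3))).
have pk1 : 1 <= p^-1 ^+ k.+1 by apply: exprn_ege1.
rewrite exprS -natr1 in pk1 *.
have pk2 : p^-1 <= p^-1 * p^-1 ^+ k by rewrite ler_peMr // exprn_ege1.
set A := p^-1 ^+ k in pk1 pk2 *; set q := p^-1 in pk1 pk2 *.
have e1 : sigma <= q * A * sigma by rewrite ler_peMl.
have e2 : q * beta <= q * A * beta by apply: ler_wpM2r.
rewrite -subr_ge0.
have -> : (k%:R + 1) * (q * A) * (sigma + beta) - (sigma + (q * (k%:R * A * (sigma + beta)) + q * beta)) =
  (q * A * sigma - sigma) + (q * A * beta - q * beta) by ring.
by rewrite addr_ge0 // subr_ge0.
Qed.

Lemma big_nbr N x y : y \in nbr x ->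
  p * Pr p (fun om => big om y N) <= Pr p (fun om => big om x N).
Proof.
move=> yx; have [e Ee] := adj_ed G yx.
have cb v : cyl (fun om => (big om v N)%:R : R) by apply/cyl_natr/(cyl_big G).
apply: le_trans (@E_surgery _ _ p e _ p01 (cb x) _) => //.
apply: ler_wpM2l; first exact: ltW.
apply: E_le => //; first exact: (cyl_upd (f := fun om => (big om x N)%:R)).
move=> om; rewrite ler_nat; case: (boolP (big om y N)) => // h.
have e1 : eo (upd om e true) x y by rewrite /eo Ee upd_same.
rewrite (conn_big G _ (conn_eo e1)) (big_mono G _ h) // => e'.
by rewrite /upd; case: eqP => [_|_]; rewrite ?implybT ?implybb.
Qed.

Lemma big_dist N u v rad : dist_le nbr u v rad ->
  p ^+ rad * Pr p (fun om => big om v N) <= Pr p (fun om => big om u N).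
Proof.
have p1 : p <= 1 by case/andP: p01.
have p0 : 0 <= p by apply: ltW.
have q0 w : 0 <= Pr p (fun om => big om w N) by apply: Pr_ge0 => //; apply: cyl_big.
move=> [s [ps [sv sr]]].
apply: (@le_trans _ _ (p ^+ size s * Pr p (fun om => big om v N))).
  by apply: ler_wpM2r => //; apply: ler_wiXn2l.
elim: s u ps sv {sr} => [|y s IH] u /=; first by move=> _ ->; rewrite mul1r.
move=> [uy ps] sv; rewrite exprS -mulrA.
apply: le_trans (big_nbr N (uy : y \in nbr u)); apply: ler_wpM2l => //; exact: IH.
Qed.

Lemma big_orbit N u v : same_orbit nbr u v ->
  Pr p (fun om => big om u N) = Pr p (fun om => big om v N).
Proof.
move=> [g [Ag <-]]; symmetry; apply: (E_aut G Ag); first exact/cyl_natr/(cyl_big G).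
by move=> om; rewrite (big_ge G Ag).
Qed.

Context {O : seq V} {mu : V -> R}.
Hypothesis MT : mtp_measure nbr O mu.
Hypothesis mu0 : forall o, o \in O -> 0 <= mu o.
Hypothesis mu1 : \sum_(o <- O) mu o = 1.

(** When both ends of the walk lie in clusters of size at least [N], one of four things happens:
    they share a cluster smaller than [N'], which [tm] counts; the first cluster reaches [N']; the
    clusters differ; or the cutoff is reached. These are the four terms on the right. The powers
    [p ^+ rad] transfer tails between [v0] and other vertices. *)
Lemma squared_tail_le (rad N N' r m k : nat) (v0 : V) (sigma beta b rh : R) :
  (forall u v, exists w z, same_orbit nbr u w /\ same_orbit nbr v z /\ dist_le nbr w z rad) ->
  0 <= sigma -> 0 <= beta ->
  (forall x y, y \in nbr x -> Pr p (sgr r N x y) <= sigma) ->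
  (forall v, Pr p (fun om => big om v r) <= beta) ->
  0 <= rh -> 0 <= b -> (forall u w, rw (2 ^ k * m) u w <= b) -> N'%:R * b <= rh ^+ (2 ^ k) ->
  (p ^+ rad * Pr p (fun om => big om v0 N)) ^+ 2 <=
  rh + Pr p (fun om => big om v0 N') / p ^+ rad +
  m%:R * p^-1 ^+ m * (sigma + beta) + 2 * beta.
Proof.
move=> qt s0 b0 hs hb rh0 bb0 hrw hrh.
set q := fun n v => Pr p (fun om => big om v n).
have q0 n v : 0 <= q n v by apply: Pr_ge0 => //; apply: cyl_big.
have comp n u v : p ^+ rad * q n v <= q n u.
  have [w [z [uw [vz dwz]]]] := qt u v.
  by rewrite /q (big_orbit n uw) (big_orbit n vz); apply: big_dist.
have pr0 : 0 < p ^+ rad by apply: exprn_gt0.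
(* [tm] carries the weights [mu o * deg o], so the comparison is made after multiplication by their
   total [W], which cancels at the end. *)
pose W := \sum_(o <- O) mu o * deg o.
have W1 : 1 <= W.
  rewrite -mu1 /W big_seq [leRHS]big_seq; apply: ler_sum => o oO.
  by rewrite ler_peMr ?mu0 // ler1n.
pose D := q N' v0 / p ^+ rad + m%:R * p^-1 ^+ m * (sigma + beta) + 2 * beta.
have key o w : w \in Ball m o -> (p ^+ rad * q N v0) ^+ 2 <= Pr p (kapp N N' o w) + D.
  move=> wo; apply: (@le_trans _ _ (q N o * q N w)).
    by rewrite expr2; apply: ler_pM; rewrite ?mulr_ge0 // ltW.
  have cb n v : cyl (fun om => (big om v n)%:R : R) by apply/cyl_natr/(cyl_big G).
  have ib n v : incr (fun om => (big om v n)%:R : R).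
    move=> om om' H; rewrite ler_nat; case: (boolP (big om v n)) => // h.
    by rewrite (big_mono G H h).
  apply: (le_trans (E_harris p01 (cb N o) (cb N w) (ib N o) (ib N w))).
  have csg : cyl (fun om => (sgr r N o w om)%:R : R) by apply: cyl_natr; apply: cyl_sg.
  have ck : cyl (fun om => (kapp N N' o w om)%:R : R) by apply: cyl_natr; apply: cyl_kap.
  apply: (@le_trans _ _ (E p (fun om => (kapp N N' o w om)%:R + ((big om o N')%:R +
     ((sgr r N o w om)%:R + ((big om o r)%:R + (big om w r)%:R)))))).
    apply: E_le => //; first exact: cylM.
      by do 3 (apply: cylD => //); apply: cylD.
    move=> om; rewrite -natrM -!natrD ler_nat mulnb.
    case: (boolP (big om o N && big om w N)) => // /andP[bo bw].
    rewrite !addn_gt0; case: (boolP (big om o N')) => bo'; first by rewrite orbT.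
    case: (boolP (big om o r)) => fo; first by rewrite !orbT.
    case: (boolP (big om w r)) => fw; first by rewrite !orbT.
    case: (boolP (w \in reach r om o)) => wr.
      have ow : conn om o w by apply/(mem_fin G _ fo).
      rewrite /kap /midsize bo bo' /= (_ : w \in _ = true) //.
      by apply/(mem_fin G _ bo').
    by rewrite /sg bo bw wr /fin fo fw !orbT.
  rewrite !ED //; try by do ?[apply: cylD => //].
  rewrite lerD2l /D -addrA; apply: lerD.
    by rewrite ler_pdivlMr // mulrC; apply: comp.
  apply: lerD; first exact: (sg_ball s0 b0 hs hb wo).
  by rewrite mulr_natl mulr2n; apply: lerD; apply: hb.
have uB o : uniq (Ball m o) by apply: reach_uniq.
have sw o : \sum_(w <- Ball m o) rw m o w = 1 by apply: rw_sum.
have W0 : 0 < W by apply: lt_le_trans W1.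
suff H : W * (p ^+ rad * q N v0) ^+ 2 <= W * (rh + D).
  by move: H; rewrite ler_pM2l // /D !addrA.
have tmle : tm (nbr := nbr) (p := p) (O := O) (mu := mu) (N := N) (N' := N') m <= W * rh.
  apply: le_trans (tm_iterate G dpos p01 MT mu0 rh0 bb0 hrw hrh) _.
  apply: ler_wpM2r => //; rewrite /tm0 /W big_seq [leRHS]big_seq; apply: ler_sum => o oO.
  apply: ler_wpM2l; first exact: mu0.
  by rewrite ler_piMr // Pr_le1 //; apply: cyl_midsize.
rewrite mulrDr; apply: le_trans (lerD tmle (lexx _)).
rewrite /tm /W !mulr_suml -big_split /= big_seq [leRHS]big_seq; apply: ler_sum => o oO.
rewrite -!mulrA -mulrDr; apply: ler_wpM2l; first exact: mu0.
rewrite -mulrDr; apply: ler_wpM2l => //.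
rewrite -[leLHS]mul1r -[X in _ + X]mul1r -(sw o).
rewrite !mulr_suml -big_split /= big_seq [leRHS]big_seq; apply: ler_sum => w wo.
rewrite -mulrDr; apply: ler_wpM2l; first exact: rw_ge0.
exact: key.
Qed.

End MainInequality.

(** * Propagation of stretched exponential lower bounds *)

Section Analysis.
Context {R : realType}.
Implicit Types (x y a b K A : R).

Lemma powR_ge1 a x : 1 <= x -> 0 <= a -> 1 <= x `^ a.
Proof. by move=> x1 a0; rewrite -(powRr0 x); apply: ler_powR. Qed.

Lemma powR_dominates a b A K : 0 <= a -> a < b -> 0 <= A -> 0 < K ->
  exists2 x0 : R, 1 <= x0 & forall x, x0 <= x -> A * x `^ a + A <= K * x `^ b.
Proof.
move=> a0 ab A0 K0; pose t := (2 * A / K) `^ ((b - a)^-1).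
have ba : 0 < b - a by rewrite subr_gt0.
exists (1 + t); first by rewrite lerDl powR_ge0.
move=> x hx; have x1 : 1 <= x by apply: le_trans hx; rewrite lerDl powR_ge0.
have x0 : 0 < x by apply: lt_le_trans x1.
have tx : t <= x by apply: le_trans hx; rewrite lerDr.
have xa1 : 1 <= x `^ a by apply: powR_ge1.
have s0 : 0 <= 2 * A / K by rewrite divr_ge0 ?mulr_ge0 // ltW.
have h : 2 * A / K <= x `^ (b - a).
  have -> : 2 * A / K = t `^ (b - a) by rewrite /t -powRrM mulVf ?gt_eqF // powRr1.
  by apply: ge0_ler_powR; rewrite ?nnegrE ?powR_ge0 // ltW.
have -> : x `^ b = x `^ a * x `^ (b - a).
  by rewrite -powRD ?(gt_eqF x0) ?implybT //; congr (_ `^ _); ring.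
apply: (@le_trans _ _ (K * (x `^ a * (2 * A / K)))); last first.
  by rewrite ler_pM2l // ler_pM2l // (lt_le_trans _ xa1).
have -> : K * (x `^ a * (2 * A / K)) = A * x `^ a + A * x `^ a by field; rewrite gt_eqF.
by rewrite lerD2l ler_peMr.
Qed.

Lemma expRN_le_inv y : 0 < y -> expR (- y) <= y^-1.
Proof.
move=> y0; rewrite expRN lef_pV2 ?posrE ?expR_gt0 //.
by apply: le_trans (expR_ge1Dx y); rewrite lerDr.
Qed.

(** The least [k] with [Y <= 2 ^ k * m] overshoots by at most a factor 2. It is raised to 1 when it
    vanishes, because [rw_offdiag] needs an even number of steps; hence the exceptional alternative
    [2 ^ k = 2]. *)
Lemma doubling_scale (Y : R) (m : nat) : (0 < m)%N ->
  exists2 k, (0 < k)%N & Y <= (2 ^ k * m)%:R /\ ((2 ^ k)%N = 2 \/ (2 ^ k * m)%:R <= 2 * Y).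
Proof.
move=> m0; have exk : exists k, Y <= (2 ^ k * m)%:R.
  exists (Num.truncn Y).+1; apply: ltW; apply: lt_le_trans (truncnS_gt Y) _.
  rewrite ler_nat; apply: leq_trans (ltnW (ltn_expl _ (ltnSn 1))) _.
  by rewrite leq_pmulr.
have [k hk kmin] := ex_minnP exk.
case: k hk kmin => [|[|k]] hk kmin.
- exists 1%N => //; split; last by left.
  by apply: (le_trans hk); rewrite ler_nat leq_mul2r orbT.
- by exists 1%N => //; split=> //; left.
- exists k.+2 => //; split=> //; right.
  have : ~~ (Y <= (2 ^ k.+1 * m)%:R) by apply/negP => /kmin; rewrite ltnn.
  rewrite -ltNge => /ltW h; rewrite expnS -mulnA natrM; exact: ler_wpM2l.
Qed.

(** The three terms are at most [n ^ -4], [1 / n] and [8 / n ^ 2], whence [10 = 1 + 1 + 8]. *)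
Lemma Phi_le (M n : nat) : (0 < n)%N ->
  Phi M (1 - (n ^ 8)%:R^-1) (n ^ 4) (n%:R^-1) <= 10 * M%:R / n%:R :> R.
Proof.
move=> n0; have nR : 1 <= n%:R :> R by rewrite ler1n.
have ngt : 0 < n%:R :> R by rewrite ltr0n.
rewrite /Phi (_ : 10 * M%:R / n%:R = M%:R * (10 / n%:R)); last by ring.
apply: ler_wpM2l => //.
have e1 : (n ^ 4)%:R * (1 - (1 - (n ^ 8)%:R^-1)) <= n%:R^-1 :> R.
  rewrite subKr !natrX (_ : n%:R ^+ 4 / n%:R ^+ 8 = n%:R ^- 4 :> R); last first.
    by field; rewrite gt_eqF.
  by rewrite lef_pV2 ?posrE ?exprn_gt0 // -[leLHS]expr1 ler_weXn2l.
have e2 : expR (- (n%:R^-1 ^+ 2 * (n ^ 4)%:R / 8)) <= 8 / n%:R :> R.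
  rewrite natrX (_ : n%:R^-1 ^+ 2 * n%:R ^+ 4 / 8 = n%:R ^+ 2 / 8 :> R); last first.
    by field; rewrite gt_eqF.
  apply: le_trans (expRN_le_inv _) _; first by rewrite divr_gt0 // exprn_gt0.
  rewrite invf_div ler_pM2l // lef_pV2 ?posrE ?exprn_gt0 // -[leLHS]expr1 ler_weXn2l //.
apply: (le_trans (lerD (lerD e1 (lexx _)) e2)).
by rewrite le_eqVlt; apply/orP; left; apply/eqP; field; rewrite gt_eqF.
Qed.

(* With [x = ln n], a walk of length [m ~ x / (4 ln (2 M))] keeps [p ^ -m] a small power of [n];
   it is doubled [k] times until the heat kernel bound beats [n ^ (8 C)], which happens at
   [2 ^ k m ~ x ^ (1 / gamma)]. Then [rh = exp (- x / 2 ^ k) ~ exp (- x ^ (2 - 1 / gamma))]. *)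
Lemma stretched_exponential_step (gamma c eps b : R) (M rad : nat) :
  1 / 2 < gamma -> gamma <= 1 -> 0 < c -> 0 < eps -> 0 < b -> b < (2 * gamma - 1) / gamma ->
  (0 < M)%N ->
  exists C n0 : nat, [/\ (1 < C)%N, (1 < n0)%N & forall (n : nat) (p q q' : R),
    (n0 <= n)%N -> (2 * M%:R)^-1 <= p -> p <= 1 -> 0 <= q' ->
    (forall m k (rh : R), (0 < m)%N -> (0 < k)%N -> 0 <= rh ->
       ((n ^ 8) ^ C)%:R * (M%:R * expR (- (c * (2 ^ k * m)%:R `^ gamma))) <= rh ^+ (2 ^ k) ->
       (p ^+ rad * q) ^+ 2 <= rh + q' / p ^+ rad +
         m%:R * p^-1 ^+ m * (8 / (p * eps) * Phi M (1 - (n ^ 8)%:R^-1) (n ^ 4) (n%:R^-1))) ->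
    expR (- ((8 * ln n%:R) `^ b)) <= q -> expR (- ((8 * ln (n ^ C)%:R) `^ b)) <= q'].
Proof.
move=> g2 g1 c0 eps0 b0 bth M0.
have g0 : 0 < gamma by lra.
set th := (2 * gamma - 1) / gamma in bth.
have th1 : th <= 1 by rewrite ler_pdivrMr // mul1r; lra.
have gth : gamma^-1 + th = 2 by rewrite /th; field; rewrite gt_eqF.
set D0 : R := 2 * M%:R.
have D2 : 2 <= D0 by rewrite ler_peMr // ler1n.
have D0gt : 0 < D0 by lra.
set l := ln D0; have l0 : 0 < l by rewrite ln_gt0 //; lra.
have Dl : D0 = expR l by rewrite lnK.
(* The choice ensures [3 <= C ^ b]: squaring the tail doubles the exponent, and a third copy of it
   absorbs the constants. *)
set C := (Num.truncn ((3 : R) `^ b^-1)).+2.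
have Cb : 3 <= C%:R `^ b.
  have -> : 3 = ((3 : R) `^ b^-1) `^ b by rewrite -powRrM mulVf ?gt_eqF // powRr1.
  apply: ge0_ler_powR; rewrite ?nnegrE ?powR_ge0 //; first exact: ltW.
  by apply: le_trans (ltW (truncnS_gt _)) _; rewrite ler_nat.
set lM := ln (M%:R : R); have lM0 : 0 <= lM by rewrite ln_ge0 // ler1n.
have MlM : M%:R = expR lM by rewrite lnK // posrE ltr0n.
(* The heat kernel exponent [c * K2 * x] must beat [n ^ (8 C)], the degree factor [M], and still
   leave [expR (- x)]. *)
set K2 := (8 * C%:R + 1 + lM) / c.
have C8 : 0 <= C%:R :> R by [].
have K20 : 0 < K2 by rewrite divr_gt0 //; lra.
set K3 := K2 `^ gamma^-1; have K30 : 0 < K3 by rewrite powR_gt0.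
set K4 := (16 * l * K3)^-1; have K40 : 0 < K4 by rewrite invr_gt0 !mulr_gt0.
(* [1 / 2] serves the case [2 ^ k = 2] and [K4] the other case of [doubling_scale]. The bound
   [K5 <= 1 / 2] also lets the two-ghost error be absorbed in [E52]. *)
set K5 := Num.min (1 / 2) K4; have K50 : 0 < K5 by rewrite lt_min K40 andbT.
have K5h : K5 <= 1 / 2 by rewrite ge_min lexx.
have K54 : K5 <= K4 by rewrite ge_min lexx orbT.
set K1 := 80 * D0 * M%:R / eps; have K10 : 0 <= K1 by rewrite divr_ge0 ?mulr_ge0 // ltW.
set a0 := D0^-1 ^+ rad; have a00 : 0 < a0 by rewrite exprn_gt0 // invr_gt0.
(* Here [b < th] enters: for large [x], [K5 * x ^ th] exceeds twice [(8 x) ^ b] plus a constant, so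
   [rh] is negligible against the squared tail. *)
have [x1 x11 H1] : exists2 x0 : R, 1 <= x0 & forall x, x0 <= x ->
    Num.max (2 * 8 `^ b) `|ln (2 * (1 + K1) / a0 ^+ 2)| * x `^ b +
    Num.max (2 * 8 `^ b) `|ln (2 * (1 + K1) / a0 ^+ 2)| <= K5 * x `^ th.
  by apply: powR_dominates => //; rewrite ?(ltW b0) // le_max normr_ge0 orbT.
have [x2 x21 H2] : exists2 x0 : R, 1 <= x0 & forall x, x0 <= x ->
    `|ln (2 / a0 ^+ 3)| * x `^ 0 + `|ln (2 / a0 ^+ 3)| <= 8 `^ b * x `^ b.
  by apply: powR_dominates => //; rewrite powR_gt0.
set X := x1 + x2 + 8 * l.
exists C, (Num.truncn (expR X)).+2; split=> // n p q q' hn pD p1 q'0 main hq.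
set x := ln (n%:R : R).
have n0 : (0 < n)%N by apply: leq_trans hn.
have ngt : 0 < n%:R :> R by rewrite ltr0n.
have nx : n%:R = expR x by rewrite lnK.
have Xx : X <= x.
  rewrite -ler_expR -nx; apply: le_trans (ltW (truncnS_gt _)) _.
  by rewrite ler_nat; apply: leq_trans hn.
have xx1 : x1 <= x by apply: le_trans Xx; rewrite /X; clear -x21 l0; lra.
have xx2 : x2 <= x by apply: le_trans Xx; rewrite /X; clear -x11 l0; lra.
have xl : 8 * l <= x by apply: le_trans Xx; rewrite /X; clear -x11 x21; lra.
have x1' : 1 <= x by apply: le_trans xx1.
have x0 : 0 < x by clear -x1'; lra.
have pgt : 0 < p by apply: lt_le_trans pD; rewrite invr_gt0.
have piD : p^-1 <= D0 by rewrite -[leRHS]invrK lef_pV2 // posrE ?invr_gt0.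
(* With this length, [m * p ^ -m <= D0 ^ (2 m) <= expR (x / 2)], which uses up only half of the gain
   [1 / n = expR (- x)] of the two-ghost bound. *)
set t := x / (4 * l); have t2 : 2 <= t by rewrite ler_pdivlMr ?mulr_gt0 //; clear -xl; lra.
set m := Num.truncn t.
have mt : m%:R <= t by rewrite truncn_le; clear -t2; lra.
have tm1 : t < m.+1%:R by apply: truncnS_gt.
have mt2 : t / 2 <= m%:R by rewrite -natr1 in tm1; clear -t2 tm1; lra.
have m0 : (0 < m)%N by rewrite -(ltr_nat R); clear -t2 mt2; lra.
have [k k0 [hY hk]] := doubling_scale ((K2 * x) `^ gamma^-1) m0.
have Yx : (K2 * x) `^ gamma^-1 = K3 * x `^ gamma^-1 by rewrite powRM // ltW.
set rh := expR (- (x / (2 ^ k)%:R)).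
have rhk : rh ^+ (2 ^ k) = expR (- x).
  by rewrite /rh -expRM_natl mulrN mulrC divfK // gt_eqF.
have rh_ok : ((n ^ 8) ^ C)%:R * (M%:R * expR (- (c * (2 ^ k * m)%:R `^ gamma))) <= rh ^+ (2 ^ k).
  rewrite rhk !natrX nx MlM -!expRM_natl -!expRD ler_expR.
  have h : K2 * x <= (2 ^ k * m)%:R `^ gamma.
    have -> : K2 * x = ((K2 * x) `^ gamma^-1) `^ gamma.
      by rewrite -powRrM mulVf ?gt_eqF // powRr1 // mulr_ge0 ?ltW.
    by apply: ge0_ler_powR; rewrite ?nnegrE ?powR_ge0 // ltW.
  have h2 : c * (K2 * x) <= c * (2 ^ k * m)%:R `^ gamma by rewrite ler_pM2l.
  have e : c * (K2 * x) = (8 * C%:R + 1 + lM) * x by rewrite /K2; field; rewrite gt_eqF.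
  have h3 : lM <= lM * x by rewrite ler_peMr.
  rewrite e mulrDl mulrDl mul1r in h2; clear -h2 h3; lra.
have xth1 : x `^ th <= x by apply: ler1_powR.
have xth0 : 0 < x `^ th by apply: powR_gt0.
have rh_le : rh <= expR (- (K5 * x `^ th)).
  rewrite ler_expR lerN2 ler_pdivlMr //.
  case: hk => [k_eq|hk2].
    rewrite k_eq; have h := ler_pM (ltW K50) (ltW xth0) K5h xth1.
    by move: h; set z := K5 * _; clear; lra.
  have mgt : 0 < m%:R :> R by rewrite ltr0n.
  rewrite -(ler_pM2r mgt) -mulrA -natrM.
  apply: (@le_trans _ _ (K4 * x `^ th * (2 * (K3 * x `^ gamma^-1)))).
    by apply: ler_pM => //; rewrite ?mulr_ge0 ?(ltW K50) ?(ltW xth0) ?ler_pM2r // -Yx.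
  have e : x `^ gamma^-1 * x `^ th = x ^+ 2.
    by rewrite -powRD ?gth ?(gt_eqF x0) ?implybT // powR_mulrn // ltW.
  have -> : K4 * x `^ th * (2 * (K3 * x `^ gamma^-1)) = x ^+ 2 / (8 * l).
    rewrite -e /K4; field; by rewrite !gt_eqF.
  rewrite expr2 -mulrA ler_pM2l //; apply: le_trans mt2; rewrite /t.
  by rewrite le_eqVlt; apply/orP; left; apply/eqP; field; rewrite gt_eqF.
have := main m k rh m0 k0 (expR_ge0 _) rh_ok.
set err := _ * (_ / _ * Phi _ _ _ _).
have Phi0 : 0 <= Phi M (1 - (n ^ 8)%:R^-1) (n ^ 4) (n%:R^-1) :> R.
  by rewrite /Phi subKr mulr_ge0 // !addr_ge0 ?expR_ge0 // divr_ge0.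
have err_le : err <= K1 * expR (- (x / 2)).
  have h1 : m%:R * p^-1 ^+ m <= expR (x / 2).
    apply: (@le_trans _ _ (D0 ^+ m * D0 ^+ m)).
      have pi0 : 0 <= p^-1 by rewrite invr_ge0 ltW.
      apply: ler_pM => //; first exact: exprn_ge0.
        apply: (@le_trans _ _ (2 ^+ m)).
          by rewrite -natrX ler_nat ltnW // ltn_expl.
        by apply: lerXn2r; rewrite ?nnegrE // ltW.
      by apply: lerXn2r; rewrite ?nnegrE // ltW.
    rewrite -exprD Dl -expRM_natl ler_expR natrD.
    have h : m%:R * (4 * l) <= x by rewrite -ler_pdivlMr // mulr_gt0.
    clear -h; lra.
  have h2 : 8 / (p * eps) * Phi M (1 - (n ^ 8)%:R^-1) (n ^ 4) (n%:R^-1) <= K1 * expR (- x).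
    have -> : K1 * expR (- x) = 8 * (D0 / eps) * (10 * M%:R / n%:R).
      by rewrite expRN -nx /K1; field; rewrite !gt_eqF.
    apply: ler_pM => //; last exact: Phi_le.
      by rewrite divr_ge0 // mulr_ge0 ?ltW.
    rewrite ler_pM2l // invfM; apply: ler_wpM2r => //; rewrite invr_ge0 ltW //.
  apply: le_trans (ler_pM _ _ h1 h2) _.
  - by rewrite mulr_ge0 // exprn_ge0 // invr_ge0 ltW.
  - by rewrite mulr_ge0 // divr_ge0 // mulr_ge0 ?ltW.
  - rewrite mulrCA -expRD; apply: ler_wpM2l => //; rewrite ler_expR; clear; lra.
move=> hmain.
set E5 := expR (- (K5 * x `^ th)) in rh_le.
have E52 : expR (- (x / 2)) <= E5.
  rewrite ler_expR lerN2 mulrC; apply: ler_pM => //; [exact: ltW|exact: ltW|by rewrite -[2^-1]mul1r].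
set Q := expR (- ((8 * x) `^ b)).
have Q0 : 0 < Q by apply: expR_gt0.
have ap : a0 <= p ^+ rad.
  by apply: lerXn2r; rewrite ?nnegrE ?invr_ge0 // ltW.
have pr0 : 0 < p ^+ rad by apply: exprn_gt0.
have hA : a0 ^+ 2 * Q ^+ 2 <= (1 + K1) * E5 + q' / a0.
  apply: (@le_trans _ _ ((p ^+ rad * q) ^+ 2)).
    rewrite -exprMn; apply: lerXn2r; rewrite ?nnegrE ?mulr_ge0 ?(ltW Q0) ?(ltW a00) ?(ltW pr0) //.
      by apply: le_trans hq; apply: ltW.
    by apply: ler_pM => //; apply: ltW.
  apply: (le_trans hmain); rewrite mulrDl mul1r addrAC; apply: lerD.
    by apply: lerD => //; apply: (le_trans err_le); apply: ler_wpM2l.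
  by apply: ler_wpM2l => //; rewrite lef_pV2.
have P8 : (8 * x) `^ b = 8 `^ b * x `^ b by rewrite powRM // ltW.
have K1p : 0 < 1 + K1 by apply: ltr_wpDr.
have hB : (1 + K1) * E5 <= a0 ^+ 2 / 2 * Q ^+ 2.
  have e : a0 ^+ 2 / 2 * Q ^+ 2 = (1 + K1) * expR (- ((8 * x) `^ b + (8 * x) `^ b + ln (2 * (1 + K1) / a0 ^+ 2))).
    rewrite !opprD !expRD expRN [expR (- ln _)]expRN lnK; last first.
      rewrite posrE; apply: divr_gt0; [apply: mulr_gt0; [exact: ltr0n|exact: K1p]|exact: exprn_gt0].
    rewrite /Q expRN; field; by rewrite (gt_eqF a00) ?(gt_eqF K1p) (gt_eqF (expR_gt0 _)).
  rewrite e ler_pM2l // ler_expR lerN2; apply: le_trans (H1 x xx1).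
  apply: lerD; last by apply: le_trans (ler_norm _) _; rewrite le_max lexx orbT.
  rewrite P8 -mulrDl; apply: ler_wpM2r; first exact: powR_ge0.
  by rewrite le_max; apply/orP; left; rewrite mulr_natl mulr2n.
have hC : a0 ^+ 3 / 2 * Q ^+ 2 <= q'.
  have h : a0 ^+ 2 / 2 * Q ^+ 2 <= q' / a0.
    move: hA hB; set X1 := (1 + K1) * E5; set X2 := q' / a0; set X3 := Q ^+ 2; clear => hA hB; lra.
  rewrite ler_pdivlMr // in h; apply: le_trans h; rewrite le_eqVlt; apply/orP; left; apply/eqP; ring.
apply: le_trans hC.
have -> : a0 ^+ 3 / 2 * Q ^+ 2 = expR (- ((8 * x) `^ b + (8 * x) `^ b + ln (2 / a0 ^+ 3))).
  rewrite !opprD !expRD expRN [expR (- ln _)]expRN lnK; last first.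
    by rewrite posrE; apply: divr_gt0; [exact: ltr0n|exact: exprn_gt0].
  rewrite /Q expRN; field; by rewrite (gt_eqF a00) ?(gt_eqF K1p) (gt_eqF (expR_gt0 _)).
rewrite ler_expR lerN2 natrX lnXn // -/x -[x *+ C]mulr_natl mulrCA [leRHS]powRM ?mulr_ge0 ?(ltW x0) //.
have h2 := H2 x xx2; rewrite powRr0 mulr1 -P8 in h2.
have h3 : ln (2 / a0 ^+ 3) <= `|ln (2 / a0 ^+ 3)| by apply: ler_norm.
have h4 : 0 <= `|ln (2 / a0 ^+ 3)| by [].
have h5 : 3 * (8 * x) `^ b <= C%:R `^ b * (8 * x) `^ b by apply: ler_wpM2r => //; apply: powR_ge0.
clear -h2 h3 h4 h5; lra.
Qed.

End Analysis.

(** * The cluster tail *)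

Section Subcritical.
Context {R : realType} {V : countType} {nbr : V -> seq V}.
Hypothesis G : simple_graph nbr.
Implicit Types (u v w x y z : V) (p : R) (S : seq V).

Lemma mem_cS_aut g S v x (om : Edge nbr -> bool) : is_aut nbr g ->
  (x \in cS S (om \o ge g) v) = (g x \in cS (map g S) om (g v)).
Proof.
move=> Ag; rewrite /cS size_map -(reach_ge G Ag); congr (x \in reach _ _ _).
apply/funext => e; rewrite /rs /=; congr (_ && _).
have mg z : (g z \in map g S) = (z \in S) by rewrite mem_map //; apply: (aut_inj Ag).
have := ed_ge G Ag (ed_fst_snd e).
by case/ed_val => -> /=; rewrite !mg // andbC.
Qed.

Lemma phi_aut g S v p : is_aut nbr g -> phi (nbr := nbr) p (map g S) (g v) = phi (nbr := nbr) p S v.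
Proof.
move=> Ag; rewrite /phi big_map; congr (_ * _); apply: eq_bigr => x _.
have eqP x' : Pr p (fun om : Edge nbr -> bool => g x' \in cS (map g S) om (g v)) = Pr p (fun om : Edge nbr -> bool => x' \in cS S om v).
  apply: (E_aut G Ag); first exact/cyl_natr/cyl_cS_mem.
  by move=> om; rewrite mem_cS_aut.
rewrite -big_filter -[RHS]big_filter eqP.
rewrite !big_const_seq !count_predT; congr (iter _ _ _).
have inj := aut_inj Ag.
rewrite -(size_map g [seq y <- nbr x | y \notin S]); apply: perm_size; apply: uniq_perm.
- by rewrite filter_uniq // (nbr_uniq G).
- by rewrite map_inj_uniq ?filter_uniq ?(nbr_uniq G).
- move=> z; have [z' ->] := aut_surj Ag z.
  by rewrite mem_map // !mem_filter mem_map // (aut_mem_nbr Ag).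
Qed.

Lemma p_c_le1 : p_c nbr <= 1 :> R.
Proof.
apply: ge_inf; last by right.
by exists 0 => x [[/andP[]]|->].
Qed.

Lemma subcritical p : 0 <= p -> p < p_c nbr -> ~ percolates nbr p.
Proof.
move=> p0 ppc perc; have p1 : p <= 1 by apply: le_trans (ltW ppc) p_c_le1.
move: ppc; rewrite ltNge => /negP; apply; apply: ge_inf.
  by exists 0 => x [[/andP[]]|->].
by left; split=> //; rewrite p0.
Qed.

(** If some [v0] had [phi >= 1] for every [S], [big_lower] would give non-vanishing tails at a [p']
    still below [p_c]. So every vertex has a set with [phi < 1], and finitely many orbits make the
    gap and the size of the sets uniform. *)
Lemma subcritical_chi (O : seq V) p :
  (forall v, exists o, o \in O /\ same_orbit nbr o v) -> 0 <= p -> p < p_c nbr ->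
  exists2 B : R, 1 <= B & forall n v, chi (nbr := nbr) p n v <= B.
Proof.
move=> orb p0 ppc; set p' := (p + p_c nbr) / 2.
have pp' : p < p' by rewrite /p'; lra.
have p'c : p' < p_c nbr by rewrite /p'; lra.
have p'1 : p' <= 1 by apply: le_trans (ltW p'c) p_c_le1.
have p'0 : 0 <= p' by lra.
have p01 : 0 <= p <= 1 by rewrite p0; lra.
have np := subcritical p'0 p'c.
case: (pselect (exists v0, forall S, v0 \in S -> 1 <= phi (nbr := nbr) p S v0)) => [[v0 H]|H].
  exfalso; have e0 : 0 < 1 - expR (p - p') by rewrite subr_gt0 expR_lt1; lra.
  have [N hN] := not_percolates_small v0 G np e0.
  by have := big_lower G N p0 (ltW pp') p'1 H; rewrite leNgt hN.
have {}H v : exists2 S, v \in S & phi (nbr := nbr) p S v < 1.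
  apply: contrapT => H2; apply: H; exists v => S vS; rewrite leNgt; apply/negP => h.
  by apply: H2; exists S.
have [rho [L [rho1 HO]]] : exists rho : R, exists L : nat, rho < 1 /\
    forall o, o \in O -> exists S, [/\ o \in S, (size S <= L)%N & phi (nbr := nbr) p S o <= rho].
  elim: (O) => [|o s [rho [L [rho1 IH]]]]; first by exists 0, 0%N; split.
  have [S oS ph] := H o.
  exists (Num.max rho (phi (nbr := nbr) p S o)), (maxn L (size S)); split; first by rewrite gt_max rho1.
  move=> o'; rewrite inE => /orP[/eqP ->|/IH[S' [oS' sS' ph']]].
    by exists S; split; rewrite ?leq_maxr // le_max lexx orbT.
  by exists S'; split; rewrite ?leq_max ?sS' // le_max ph'.
exists (Num.max 1 (L%:R / (1 - rho))); first by rewrite le_max lexx.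
move=> n v; apply: (@le_trans _ _ (L%:R / (1 - rho))); last by rewrite le_max lexx orbT.
apply: (chi_bound G p01 rho1) => {}v.
have [w [wO [g [Ag <-]]]] := orb v; have [S [wS sS ph]] := HO w wO.
exists (map g S); split; [exact: map_f|by rewrite size_map|by rewrite phi_aut].
Qed.

(** The singleton [[:: v]] already has [phi <= p * M <= 1 / 2]. *)
Lemma small_p_chi M p : max_degree_le nbr M -> 0 <= p -> p <= (2 * M%:R)^-1 -> p <= 1 ->
  (0 < M)%N -> forall n v, chi (nbr := nbr) p n v <= 2.
Proof.
move=> dM p0 pM p1 M0 n v; have p01 : 0 <= p <= 1 by rewrite p0.
have -> : (2 : R) = 1%:R / (1 - 1 / 2) by field; lra.
apply: (chi_bound G p01); first by lra.
move=> {}v; exists [:: v]; split=> //; first exact: mem_head.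
rewrite /phi big_seq1.
apply: (@le_trans _ _ (p * (\sum_(y <- nbr v) 1%:R))).
  apply: ler_wpM2l => //; rewrite big_mkcond; apply: ler_sum => y _.
  case: ifP => // _; apply: Pr_le1 => //; exact: cyl_cS_mem.
rewrite -natr_sum sum1_size; have Mgt : 0 < M%:R :> R by rewrite ltr0n.
apply: (@le_trans _ _ ((2 * M%:R)^-1 * M%:R)); last first.
  by rewrite le_eqVlt; apply/orP; left; apply/eqP; field; rewrite gt_eqF.
by apply: ler_pM => //; rewrite ler_nat.
Qed.

End Subcritical.

Lemma psi_half {R : realType} N : (0 < N)%N -> 1 / 2 <= psi (1 - N%:R^-1 : R) N.
Proof.
move=> N0; rewrite /psi; have Ngt : 0 < N%:R :> R by rewrite ltr0n.
have h : (1 - N%:R^-1) ^+ N <= expR (-1) :> R.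
  have -> : expR (-1) = expR (- N%:R^-1) ^+ N :> R by rewrite -expRM_natl mulrN divff ?gt_eqF.
  apply: lerXn2r; rewrite ?nnegrE ?expR_ge0 ?subr_ge0 ?invf_le1 ?ler1n //.
  exact: expR_ge1Dx.
have : expR (-1) <= 1 / 2 :> R.
  rewrite expRN mul1r lef_pV2 ?posrE ?expR_gt0 //.
  by apply: le_trans (expR_ge1Dx 1); lra.
lra.
Qed.

(** The field [uwg_dpos] excludes the one-vertex graph, which [theorem4p1] treats separately. *)
Record unimodular_walk_graph {R : realType} (gamma c eps : R) (M rad : nat)
    (V : countType) (nbr : V -> seq V) (O : seq V) (mu : V -> R) : Prop := UWG {
  uwg_simple : simple_graph nbr;
  uwg_dpos : forall v, (0 < size (nbr v))%N;
  uwg_deg : max_degree_le nbr M;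
  uwg_orb : forall v, exists o, o \in O /\ same_orbit nbr o v;
  uwg_mtp : mtp_measure nbr O mu;
  uwg_HK : HK nbr gamma c;
  uwg_QT : QT nbr O mu rad eps }.

Section Tail.
Context {R : realType} {gamma c eps : R} {M rad : nat}.
Hypothesis eps0 : 0 < eps.
Context {V : countType} {nbr : V -> seq V} {O : seq V} {mu : V -> R}.
Hypothesis U : unimodular_walk_graph gamma c eps M rad nbr O mu.
Let G := uwg_simple U.
Let dpos := uwg_dpos U.
Let dM := uwg_deg U.
Let q (p : R) n v := Pr p (fun om : Edge nbr -> bool => big om v n).

Lemma big_le_chi p B r v : 0 <= p <= 1 -> (0 < r)%N -> (forall n v, chi (nbr := nbr) p n v <= B) ->
  q p r v <= B / r%:R.
Proof.
move=> p01 r0 HB; rewrite ler_pdivlMr ?ltr0n // mulrC.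
exact: le_trans (big_chi G r v p01) (HB r v).
Qed.

(** The cutoff disappears here: [Kc * beta] collects its whole contribution, with [beta = B / r] and
    [r] still free, so [B] does not enter the conclusion. *)
Lemma bootstrap_inequality (p B : R) (v : V) (C n m k : nat) (rh : R) :
  0 < p -> p <= 1 -> 0 <= B -> (forall n v, chi (nbr := nbr) p n v <= B) -> (0 < n)%N ->
  (0 < m)%N -> (0 < k)%N -> 0 <= rh ->
  ((n ^ 8) ^ C)%:R * (M%:R * expR (- (c * (2 ^ k * m)%:R `^ gamma))) <= rh ^+ (2 ^ k) ->
  (p ^+ rad * q p (n ^ 8) v) ^+ 2 <= rh + q p ((n ^ C) ^ 8) v / p ^+ rad +
    m%:R * p^-1 ^+ m * (8 / (p * eps) * Phi M (1 - (n ^ 8)%:R^-1) (n ^ 4) (n%:R^-1)).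
Proof.
move=> pgt p1 B0 HB n0 m0 k0 rh0 hrh; have p01 : 0 <= p <= 1 by rewrite ltW.
have [mu0 [mu1 _]] := uwg_mtp U; have [mue qt] := uwg_QT U.
set Ph := Phi M _ _ _.
have ngt : 1 <= n%:R :> R by rewrite ler1n.
have n8 : (0 < n ^ 8)%N by rewrite expn_gt0 n0.
have lam01 : 0 <= (1 - (n ^ 8)%:R^-1 : R) <= 1.
  by rewrite subr_ge0 invf_le1 ?ler1n ?ltr0n // gerBl invr_ge0 ler0n n8.
have eta01 : 0 <= (n%:R^-1 : R) <= 1 by rewrite invr_ge0 ler0n invf_le1 // ltr0n.
set Kc := m%:R * p^-1 ^+ m * (4 / (p * eps) * (M%:R / p) + 1) + 2.
have pi0 : 0 <= p^-1 by rewrite invr_ge0 ltW.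
have pe0 : 0 <= 4 / (p * eps) by rewrite divr_ge0 // mulr_ge0 // ltW.
apply/ler_addgt0Pr => d d0.
set r := (Num.truncn (Kc * B / d)).+1.
set beta := B / r%:R.
have b0 : 0 <= beta by rewrite divr_ge0.
have hd : Kc * beta <= d.
  rewrite /beta mulrA ler_pdivrMr // [leRHS]mulrC -ler_pdivrMr //; apply: ltW; exact: truncnS_gt.
have hb w : Pr p (fun om : Edge nbr -> bool => big om w r) <= beta by apply: big_le_chi.
set sigma := 4 / (p * eps) * (2 * Ph + M%:R * (beta / p)).
have s0 : 0 <= sigma.
  by rewrite mulr_ge0 // addr_ge0 ?mulr_ge0 // divr_ge0 // ltW.
have hs x y : y \in nbr x -> Pr p (sg (nbr := nbr) (r := r) (n ^ 8) x y) <= sigma.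
  move=> yx; exact: (two_ghost G dpos dM p01 lam01 (uwg_mtp U) mu1 mu0 (n ^ 4)%N eta01 pgt eps0
    (psi_half n8) (uwg_orb U) mue hb b0).
have hrw u w : @rw_p V nbr R (2 ^ k * m) u w <= M%:R * expR (- (c * (2 ^ k * m)%:R `^ gamma)).
  have -> : (2 ^ k * m = 2 ^ k.-1 * m + 2 ^ k.-1 * m)%N.
    by rewrite addnn -mul2n mulnA -expnS prednK.
  apply: (rw_offdiag G dpos _ _ dM) => z; apply: (uwg_HK U).
  by rewrite addn_gt0 muln_gt0 expn_gt0 m0.
have bb0 : 0 <= M%:R * expR (- (c * (2 ^ k * m)%:R `^ gamma)) by rewrite mulr_ge0 ?expR_ge0.
have := squared_tail_le G dpos p01 pgt (uwg_mtp U) mu0 mu1 v qt s0 b0 hs hb rh0 bb0 hrw hrh.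
move=> h; apply: (le_trans h); rewrite -!addrA lerD2l.
rewrite (_ : (n ^ C) ^ 8 = (n ^ 8) ^ C)%N; last by rewrite -!expnM mulnC.
rewrite lerD2l.
have -> : m%:R * p^-1 ^+ m * (sigma + beta) + 2 * beta =
  m%:R * p^-1 ^+ m * (8 / (p * eps) * Ph) + Kc * beta.
  by rewrite /sigma /Kc; field; rewrite !gt_eqF.
by rewrite lerD2l.
Qed.

End Tail.

(** A violation at [n] propagates to the scales [n ^ (C ^ j)], where Markov's inequality gives [B]
    over the eighth power of the scale; since [b < 1], this is eventually too small. The threshold
    is fixed before the graph, and [B] only decides how far to iterate. *)
Lemma subcritical_tail_bound {R : realType} (gamma c eps b : R) (M rad : nat) :
  1 / 2 < gamma -> gamma <= 1 -> 0 < c -> 0 < eps -> 0 < b -> b < (2 * gamma - 1) / gamma ->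
  (0 < M)%N ->
  exists n0 : nat, forall (V : countType) (nbr : V -> seq V) (O : seq V) (mu : V -> R),
    unimodular_walk_graph gamma c eps M rad nbr O mu ->
    forall p : R, 0 <= p <= 1 -> p < p_c nbr \/ p <= (2 * M%:R)^-1 -> forall n (v : V), (n0 <= n)%N ->
    Pr p (fun om : Edge nbr -> bool => big om v (n ^ 8)) <= expR (- ((8 * ln n%:R) `^ b)).
Proof.
move=> g2 g1 c0 eps0 b0 bth M0.
have [C [n1 [C1 n11 step]]] := stretched_exponential_step rad g2 g1 c0 eps0 b0 bth M0.
have b1 : b < 1 by apply: lt_le_trans bth _; rewrite ler_pdivrMr ?mul1r; lra.
have tail_exp (B : R) : 1 <= B -> exists y0 : R, forall y, y0 <= y ->
    B * expR (- (8 * y)) < expR (- ((8 * y) `^ b)).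
  move=> B1; set A := Num.max (8 `^ b) (ln B + 1).
  have A0 : 0 <= A by apply: le_trans (powR_ge0 8 b) _; rewrite /A le_max lexx.
  have [y0 y01 H] := powR_dominates (ltW b0) b1 A0 (ltr0n R 8).
  exists y0 => y hy; have y1 := le_trans y01 hy; have y0' : 0 <= y by lra.
  rewrite -[B]lnK ?posrE; last by lra.
  rewrite -expRD ltr_expR powRM //.
  have := H y hy; rewrite powRr1 //.
  have h1 : 8 `^ b * y `^ b <= A * y `^ b by apply: ler_wpM2r; rewrite ?powR_ge0 // /A le_max lexx.
  have h2 : ln B + 1 <= A by rewrite /A le_max lexx orbT.
  lra.
have [y2 Hy2] := tail_exp 2 (ler1n _ 2).
exists (maxn n1 (Num.truncn (expR y2)).+1) => V nbr O mu U p /[dup] p01 /andP[p0 p1] ppc n v.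
rewrite geq_max => /andP[n1n n2n].
have G := uwg_simple U.
have nge0 n' : (n1 <= n')%N -> (0 < n')%N by move=> h; apply: leq_trans h; apply: ltnW.
have ex8 n' : (0 < n')%N -> (n' ^ 8)%:R^-1 = expR (- (8 * ln n'%:R)) :> R.
  move=> n'0; rewrite expRN mulrC expRM_natr lnK ?posrE ?ltr0n // natrX //.
have [pM|pM] := leP p (2 * M%:R)^-1.
  have HB := small_p_chi G (uwg_deg U) p0 pM p1 M0.
  have n0 := nge0 n n1n.
  apply: le_trans (big_le_chi U v p01 _ HB) _; first by rewrite expn_gt0 n0.
  rewrite ex8 //; apply/ltW/Hy2.
  rewrite -ler_expR lnK ?posrE ?ltr0n //; apply: le_trans (ltW (truncnS_gt _)) _.
  by rewrite ler_nat.
have {}ppc : p < p_c nbr by case: ppc => // /(lt_le_trans pM); rewrite ltxx.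
rewrite leNgt; apply/negP => contr.
have [B B1 HB] := subcritical_chi G (uwg_orb U) p0 ppc.
have B0 : 0 <= B by lra.
have pgt : 0 < p by apply: lt_trans pM; rewrite invr_gt0 mulr_gt0 // ltr0n.
have iter j : (n <= n ^ (C ^ j))%N /\
    expR (- ((8 * ln (n ^ (C ^ j))%:R) `^ b)) <= Pr p (fun om : Edge nbr -> bool => big om v ((n ^ (C ^ j)) ^ 8)).
  elim: j => [|j [IHn IH]]; first by rewrite expn0 expn1; split=> //; apply: ltW.
  rewrite expnSr expnM; have n1' := leq_trans n1n IHn; have n0' := nge0 _ n1'.
  split; first by apply: (leq_trans IHn); rewrite -[leqLHS]expn1 leq_pexp2l // ltnW.
  apply: (step _ p _ _ n1' (ltW pM) p1 _ _ IH).
    by apply: Pr_ge0 => //; apply: (cyl_big G).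
  move=> m k rh m0 k0 rh0 hrh.
  exact: (bootstrap_inequality eps0 U v pgt p1 B0 HB n0' m0 k0 rh0 hrh).
have [y0 Hy0] := tail_exp B B1.
have n0 := nge0 n n1n.
have n2 : 1 < n%:R :> R by rewrite ltr1n; apply: leq_trans n1n.
have ln0 : 0 < ln (n%:R : R) by apply: ln_gt0.
set j := (Num.truncn (y0 / ln (n%:R : R))).+1.
have [nj hj] := iter j.
set n' := (n ^ C ^ j)%N in nj hj.
have n'0 : (0 < n')%N by apply: leq_trans nj.
have yy : y0 <= ln (n'%:R : R).
  rewrite /n' (natrX _ n (C ^ j)) lnXn ?ltr0n // -[leRHS]mulr_natl -ler_pdivrMr //.
  apply: le_trans (ltW (truncnS_gt _)) _; rewrite ler_nat; exact/ltnW/ltn_expl.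
have := Hy0 _ yy; rewrite ltNge => /negP; apply; apply: (le_trans hj).
apply: le_trans (big_le_chi U v p01 _ HB) _; first by rewrite expn_gt0 n'0.
by rewrite ex8.
Qed.

(** * The critical point and the range of [gamma] *)

Lemma Pr_continuous {R : realType} {T : choiceType} (A : (T -> bool) -> bool) : cyl A ->
  continuous (fun p : R => Pr p A).
Proof.
move=> cA q; have [L dL] := cyl_natr (R := R) cA.
apply: differentiable_continuous; apply/derivable1_diffP.
have dL' : dep [pred e in undup L] (fun om : T -> bool => (A om)%:R : R).
  by move: dL; congr dep; apply/funext => e /=; rewrite mem_undup.
by have [] := E_russo q (undup_uniq L) dL'.
Qed.

Lemma Pr_le_left_limit {R : realType} {T : choiceType} (A : (T -> bool) -> bool) (a p t : R) :
  cyl A -> a < p -> (forall q, a < q -> q < p -> Pr q A <= t) -> Pr p A <= t.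
Proof.
move=> cA ap H; rewrite leNgt; apply/negP => lt.
have := cvgr_gt _ (cvg_at_left_filter (Pr_continuous cA (x := p))) _ lt.
move=> near_gt.
have [q [tq [aq qp]]] := filter_ex (filterI (near_gt _) (filterI (nbhs_left_gt ap) (nbhs_left_lt p))).
by move: tq; rewrite ltNge H.
Qed.

Lemma tail_bound {R : realType} (gamma c eps b : R) (M rad : nat) :
  1 / 2 < gamma -> gamma <= 1 -> 0 < c -> 0 < eps -> 0 < b -> b < (2 * gamma - 1) / gamma ->
  (0 < M)%N ->
  exists n0 : nat, forall (V : countType) (nbr : V -> seq V) (O : seq V) (mu : V -> R),
    unimodular_walk_graph gamma c eps M rad nbr O mu ->
    forall p : R, 0 <= p -> p <= p_c nbr -> forall n (v : V), (n0 <= n)%N ->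
    Pr p (fun om : Edge nbr -> bool => big om v (n ^ 8)) <= expR (- ((8 * ln n%:R) `^ b)).
Proof.
move=> g2 g1 c0 eps0 b0 bth M0.
have [n0 H] := subcritical_tail_bound rad g2 g1 c0 eps0 b0 bth M0.
exists n0 => V nbr O mu U p p0 ppc n v n0n; have p1 := le_trans ppc (p_c_le1 (nbr := nbr)).
(* The small range contains [p = 0], where there is no room to approach from the left. *)
have [pM|pM] := leP p (2 * M%:R)^-1; first by apply: (H _ _ _ _ U); rewrite ?p0 //; right.
have pgt : 0 < p by apply: le_lt_trans pM; rewrite invr_ge0.
apply: (Pr_le_left_limit _ pgt); first exact: (cyl_big (uwg_simple U)).
move=> q q0 qp; apply: (H _ _ _ _ U) => //; last by left; apply: lt_le_trans ppc.
by rewrite !ltW // (lt_le_trans qp).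
Qed.

(** Return probabilities at even times [2 n] are at least [M ^ - (2 n)], which a decay
    [expR (- c (2 n) ^ gamma)] with [gamma > 1] would violate for large [n]. *)
Lemma HK_le1 {R : realType} (V : countType) (nbr : V -> seq V) (gamma c : R) (M : nat) (v : V) :
  simple_graph nbr -> max_degree_le nbr M -> (0 < M)%N -> (forall x, (0 < size (nbr x))%N) -> 0 < c ->
  HK nbr gamma c -> gamma <= 1.
Proof.
move=> G dM M0 dpos c0 hk; rewrite leNgt; apply/negP => g1.
have Mge : 1 <= M%:R :> R by rewrite ler1n.
have lM : 0 <= ln (M%:R : R) by apply: ln_ge0.
have [x0 x01 H] := powR_dominates ler01 g1 (addr_ge0 lM ler01) c0.
set n := (Num.truncn x0).+1.
have hx : x0 <= (n + n)%:R.
  apply: le_trans (ltW (truncnS_gt _)) _; rewrite ler_nat; exact: leq_addr.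
have := H _ hx; rewrite powRr1 ?ler0n //.
have := le_trans (rw_return_lower G dpos n v dM) (hk v (n + n)%N isT).
rewrite -[M%:R]lnK ?posrE ?(lt_le_trans ltr01) // -expRN -expRM_natl ler_expR.
rewrite mulrN lerN2 expRK => h1 h2.
have : 0 <= (n + n)%:R :> R by [].
lra.
Qed.

(** * Exponential moments *)

(** The integral of a nonnegative function is a supremum over the simple functions below it. The
    comparison thus applies directly to [exp_log_pow] of the cluster size, with a measurable
    majorant. *)
Lemma integral_le_pointwise {R : realType} {d : measure_display} {T : measurableType d}
    (mu : {measure set T -> \bar R}) (f g : T -> \bar R) :
  (forall x, 0 <= f x)%E -> (forall x, f x <= g x)%E -> (\int[mu]_x f x <= \int[mu]_x g x)%E.
Proof.
move=> f0 fg; rewrite !ge0_integralTE //; last by move=> x; apply: le_trans (fg x).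
apply: le_ereal_sup => _ [h hf <-]; exists h => // x; exact: le_trans (hf x) (fg x).
Qed.

Section Moment.
Context {R : realType} {V : countType} {nbr : V -> seq V}.
Hypothesis G : simple_graph nbr.
Context {beta : R} {N : nat -> nat} {w : nat -> R}.
Hypotheses (jN : forall j, (j < N j)%N) (w1 : forall j, 1 <= w j).
Hypothesis sw : forall j s, (0 < s)%N -> (s < N j)%N -> expR (ln s%:R `^ beta) <= w j.

Lemma cluster_size_fin (om : Edge nbr -> bool) v N0 : ~~ big om v N0 ->
  cluster_size om v = (size (reach N0 om v))%:R%:E :> \bar R.
Proof.
move=> nb; rewrite /cluster_size.
have fin : finite_set (Defs.cluster om v) by apply/(finite_clusterP G); exists N0.
rewrite asboolT //; congr (_%:R%:E).
have -> : fset_set (Defs.cluster om v) = [fset x in reach N0 om v]%fset.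
  apply/fsetP => x; rewrite in_fset_set // in_fset /=.
  apply/idP/idP; first by move=> /set_mem /clusterE /(mem_fin G _ nb).
  by move=> /(mem_fin G _ nb) /clusterE /mem_set.
by rewrite card_fseq undup_id // reach_uniq.
Qed.

(** If [j] is least with [|K_v| < N j], the value is at most [w j], and for [j > 0] this is the term
    of index [j - 1] of the series. For an infinite cluster every indicator is 1 and the series
    diverges because [w >= 1]. *)
Lemma exp_log_cluster_le (om : Edge nbr -> bool) v :
  (exp_log_pow beta (cluster_size om v) <=
   (w 0)%:E + \sum_(j <oo) (w j.+1 * (big om v (N j))%:R)%:E)%E.
Proof.
have w0 j : 0 <= w j by apply: le_trans (w1 j).
have t0 j : (0 <= (w j.+1 * (big om v (N j))%:R)%:E)%E by rewrite lee_fin mulr_ge0.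
have partial k := @nneseries_lim_ge R (fun j => (w j.+1 * (big om v (N j))%:R)%:E) xpredT 0 k (fun j _ _ => t0 j).
have [[N0 nb]|allbig] := pselect (exists N0, ~~ big om v N0); last first.
  rewrite [X in (_ + X)%E](_ : _ = +oo%E) ?addey ?leey //.
  apply/eq_infty => t; apply: le_trans (partial (Num.truncn t).+1).
  rewrite sumEFin lee_fin; apply: le_trans (ltW (truncnS_gt _)) _.
  rewrite -[X in X%:R]muln1 -[X in (X * 1)%N]subn0 -sum_nat_const_nat natr_sum; apply: ler_sum => j _.
  suff -> : big om v (N j) by rewrite mulr1.
  by apply: contrapT => /negP nb; apply: allbig; exists (N j).
rewrite (cluster_size_fin nb) /=; set s := size _.
have s0 : (0 < s)%N by rewrite /s; have := mem_reach0 G N0 om v; case: reach.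
have bigE j : big om v (N j) = (N j <= s)%N by apply: (big_size G).
have ex : exists j, (s < N j)%N by exists s.
case: (ex_minnP ex) => -[|j] sj jmin.
  apply: (@le_trans _ _ (w 0)%:E); first by rewrite lee_fin; apply: sw.
  by rewrite leeDl //; apply: nneseries_ge0.
apply: (@le_trans _ _ (\sum_(0 <= i < j.+1) (w i.+1 * (big om v (N i))%:R)%:E)%E); last first.
  by apply: le_trans (partial j.+1) _; rewrite leeDr // lee_fin.
rewrite big_nat_recr //= bigE.
have -> : (N j <= s)%N by rewrite leqNgt; apply/negP => /jmin; rewrite ltnn.
rewrite mulr1; apply: (@le_trans _ _ (w j.+1)%:E); first by rewrite lee_fin; apply: sw.
by rewrite leeDr // sume_ge0.
Qed.

Context {d : measure_display} {Omega : measurableType d} {P : probability Omega R}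
  {p : R} {omega : Omega -> Edge nbr -> bool}.
Hypothesis B : bernoulli_perc p P omega.

Lemma integral_exp_log_le (v : V) (t : R) :
  (forall j, w j.+1 * Pr p (fun om : Edge nbr -> bool => big om v (N j)) <= t / (2 ^ (j + 1))%:R) ->
  (\int[P]_x exp_log_pow beta (cluster_size (omega x) v) <= (w 0 + t)%:E)%E.
Proof.
move=> H; have w0 j : 0 <= w j by apply: le_trans (w1 j).
pose A j := [set x | big (omega x) v (N j)].
have mA j : measurable (A j) by have /= := measurable_cyl B (cyl_big G (N j) v).
have t0 j x : (0 <= (w j.+1 * (big (omega x) v (N j))%:R)%:E)%E by rewrite lee_fin mulr_ge0.
have tE j : (fun x => (w j.+1 * (big (omega x) v (N j))%:R)%:E) = (fun x => (w j.+1)%:E * (\1_(A j) x)%:E)%E.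
  apply/funext => x; rewrite -EFinM indicE; congr (_ * (nat_of_bool _)%:R)%:E.
  by apply/idP/idP => [/mem_set|/set_mem].
have mI j : measurable_fun setT (fun x => (\1_(A j) x : R)%:E).
  exact/measurable_EFinP/measurable_indic.
have mt j : measurable_fun setT (fun x => (w j.+1 * (big (omega x) v (N j))%:R)%:E).
  by rewrite tE; apply: measurable_funeM.
apply: le_trans (integral_le_pointwise _ _ (fun x => exp_log_cluster_le (omega x) v)) _.
  by move=> x; rewrite /exp_log_pow; case: (cluster_size _ _) => // y; rewrite lee_fin expR_ge0.
rewrite ge0_integralD //; [|by move=> x _; rewrite lee_fin|by move=> x _; apply: nneseries_ge0|
  by apply: ge0_emeasurable_sum].
rewrite integral_cst // [X in (_ * X)%E](_ : _ = 1%E); last exact: probability_setT.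
rewrite mule1 integral_nneseries //.
rewrite EFinD; apply: leeD2l.
have hj j : (\int[P]_x (w j.+1 * (big (omega x) v (N j))%:R)%:E <= (t / (2 ^ (j + 1))%:R)%:E)%E.
  rewrite tE ge0_integralZl_EFin //.
  have /= pA := prob_cyl B (cyl_big G (N j) v).
  by rewrite integral_indic // setIT [X in (_ * X)%E]pA -EFinM lee_fin; apply: H.
apply: le_trans (lee_nneseries _ (fun j _ => hj j)) _.
  by move=> j _ _; apply: integral_ge0.
have /cvg_lim -> // := @cvg_geometric_eseries_half R t 0.
by rewrite expr0 divr1.
Qed.

End Moment.

(** The logarithm doubles from one scale to the next, so replacing a size by the next scale costs
    only a constant factor in the logarithm. *)
Definition scale (j : nat) : nat := 2 ^ (2 ^ j).

Lemma ln_scale {R : realType} j : ln (scale j)%:R = (2 ^ j)%:R * ln 2 :> R.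
Proof. by rewrite /scale (natrX _ 2 (2 ^ j)) lnXn ?ltr0n // [RHS]mulr_natl. Qed.

Lemma ln_scale8 {R : realType} j : ln (scale j ^ 8)%:R = 8 * (2 ^ j)%:R * ln 2 :> R.
Proof.
by rewrite (natrX _ (scale j) 8) lnXn ?ltr0n ?expn_gt0 // ln_scale -[LHS]mulr_natl mulrA.
Qed.

(** An exponent [a] strictly between [beta] and [b] separates the two sides: the weight and the
    factor [2 ^ (j + 1)] are both exponentials of [O(Y ^ a)] with [Y = 2 ^ j], while the tail is the
    exponential of minus a multiple of [Y ^ b]. *)
Lemma geometric_tail {R : realType} (beta b : R) (n0 : nat) : 0 <= beta -> beta < b -> exists t : R,
  forall j (q : R), 0 <= q <= 1 ->
  ((n0 <= scale j)%N -> q <= expR (- ((8 * ln (scale j)%:R) `^ b))) ->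
  expR (ln (scale j.+1 ^ 8)%:R `^ beta) * q <= t / (2 ^ (j + 1))%:R.
Proof.
move=> beta0 bb; set L : R := ln 2.
have L0 : 0 < L by apply: ln_gt0; rewrite ltr1n.
have L1 : L <= 1.
  by rewrite -[leRHS]expRK ler_ln ?posrE ?expR_gt0 //; apply: le_trans (expR_ge1Dx 1); lra.
pose a : R := (beta + b) / 2; have a0 : 0 < a by rewrite /a; lra.
have ba : beta <= a by rewrite /a; lra.
have ab : a < b by rewrite /a; lra.
(* The terms pay for the weight, as [8 * 2 ^ (j + 1) = 16 Y], for [2 ^ j] through
   [ln Y <= Y ^ a / a], and for the remaining factor 2. *)
set C := 16 `^ beta + a^-1 + 1.
have C0 : 0 <= C by rewrite !addr_ge0 ?powR_ge0 // invr_ge0 ltW.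
have K0 : 0 < (8 * L) `^ b by apply: powR_gt0; rewrite mulr_gt0.
have [x0 x01 H] := powR_dominates (ltW a0) ab C0 K0.
set J := maxn n0 (Num.truncn x0).+1.
set w := fun j => expR (ln (scale j.+1 ^ 8)%:R `^ beta).
have w0 j : 0 <= w j by apply: expR_ge0.
have S0 : 0 <= \sum_(i < J) w i by apply: sumr_ge0.
(* Below [J] only [q <= 1] is used, so [t] contains all the weights up to that index. *)
exists ((1 + \sum_(i < J) w i) * (2 ^ J)%:R) => j q /andP[q0 q1] hq; rewrite -/(w j).
have d0 : 0 < (2 ^ (j + 1))%:R :> R by rewrite ltr0n expn_gt0.
rewrite ler_pdivlMr //.
have [jJ|Jj] := ltnP j J.
  apply: ler_pM; rewrite ?mulr_ge0 //; last by rewrite ler_nat leq_exp2l // addn1.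
  apply: (@le_trans _ _ (w j)); first by rewrite ler_piMr.
  rewrite (bigD1 (Ordinal jJ)) //= addrCA lerDl addr_ge0 //; exact: sumr_ge0.
apply: (@le_trans _ _ 1); last first.
  by apply: mulr_ege1; [rewrite lerDl|rewrite ler1n expn_gt0].
have j2 : (j < 2 ^ j)%N by apply: ltn_expl.
have n0s : (n0 <= scale j)%N.
  apply: leq_trans (leq_trans (leq_maxl _ _) Jj) _.
  by apply: leq_trans (ltnW j2) _; apply/ltnW/ltn_expl.
have xY : x0 <= (2 ^ j)%:R.
  apply: le_trans (ltW (truncnS_gt _)) _; rewrite ler_nat.
  by apply: leq_trans (leq_trans (leq_maxr _ _) Jj) (ltnW j2).
set Y : R := (2 ^ j)%:R in xY *; have Y1 : 1 <= Y by apply: le_trans xY.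
have eY : (2 ^ (j + 1))%:R = expR (j.+1%:R * L) :> R.
  by rewrite expRM_natl lnK ?posrE // addn1 natrX.
have jY : j%:R * L <= a^-1 * Y `^ a.
  rewrite ler_pdivlMl //.
  have -> : Y `^ a = expR (j%:R * L * a).
    rewrite mulrC /powR gt_eqF ?(lt_le_trans ltr01) //; congr (expR (a * _)).
    by rewrite /Y (natrX _ 2 j) lnXn // -[LHS]mulr_natl.
  by rewrite mulrC; apply: le_trans (expR_ge1Dx _); rewrite lerDr.
have wY : ln (scale j.+1 ^ 8)%:R `^ beta <= 16 `^ beta * Y `^ a.
  rewrite ln_scale8 expnS natrM -/Y -/L.
  apply: (@le_trans _ _ ((16 * Y) `^ beta)).
    apply: ge0_ler_powR => //; rewrite ?nnegrE ?mulr_ge0 ?(ltW L0) //.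
    rewrite (_ : 8 * (2 * Y) = 16 * Y); last by ring.
    by rewrite ler_piMr ?mulr_ge0.
  by rewrite powRM // ler_wpM2l ?powR_ge0 // ler_powR.
have := hq n0s; rewrite ln_scale -/Y -/L.
rewrite (_ : 8 * (Y * L) = 8 * L * Y); last by ring.
rewrite powRM ?mulr_ge0 ?(ltW L0) // => {}hq.
have {}H := H _ xY.
apply: (@le_trans _ _ (w j * expR (- ((8 * L) `^ b * Y `^ b)) * (2 ^ (j + 1))%:R)).
  by apply: ler_wpM2r; rewrite ?(ltW d0) // ler_wpM2l.
rewrite eY -!expRD -[leRHS]expR0 ler_expR (_ : j.+1%:R = j%:R + 1); last by rewrite natr1.
have Ya : 1 <= Y `^ a by rewrite -(powRr0 Y) ler_powR // ltW.
have A0 : 0 <= 16 `^ beta :> R by apply: powR_ge0.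
move: wY jY H; rewrite /C; move: (ln _ `^ beta) ((8 * L) `^ b * Y `^ b) => u z h1 h2 h3.
have ai : 0 <= a^-1 by rewrite invr_ge0 ltW.
clear -h1 h2 h3 ai L1 Ya A0.
lra.
Qed.

(** The conditions [gamma <= 1] and [0 < M] come after [K] because they are deduced from a graph,
    while [K] must be chosen before any graph is given. *)
Lemma exponential_moment {R : realType} (gamma c eps beta : R) (M rad : nat) :
  1 / 2 < gamma -> 0 < c -> 0 < eps ->
  0 <= beta -> beta < (2 * gamma - 1) / gamma ->
  exists K : R, gamma <= 1 -> (0 < M)%N -> forall (V : countType) (nbr : V -> seq V) (O : seq V) (mu : V -> R),
    unimodular_walk_graph gamma c eps M rad nbr O mu ->
  forall p : R, 0 <= p -> p <= p_c nbr ->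
  forall (d : measure_display) (Omega : measurableType d)
    (P : probability Omega R) (omega : Omega -> Edge nbr -> bool),
    bernoulli_perc p P omega ->
  forall v : V, (\int[P]_x exp_log_pow beta (cluster_size (omega x) v) <= K%:E)%E.
Proof.
move=> g2 c0 eps0 beta0 bth; have [M0|] := posnP M; first by exists 0; rewrite M0.
have [g1 M0|g1 _] := leP gamma 1; last by exists 0.
have [beta_b b_th] := midf_lt bth; set b := _ / 2 in beta_b b_th.
have b0 : 0 < b by apply: le_lt_trans beta_b.
have [n0 tail] := tail_bound rad g2 g1 c0 eps0 b0 b_th M0.
have [t Ht] := geometric_tail n0 beta0 beta_b.
exists (expR (ln (scale 0 ^ 8)%:R `^ beta) + t) => _ _ V nbr O mu U p p0 ppc d Omega P omega B v.
have G := uwg_simple U.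
have p01 : 0 <= p <= 1 by rewrite p0 (le_trans ppc) // p_c_le1.
have s0 j : (0 < scale j)%N by rewrite expn_gt0.
apply: (integral_exp_log_le G (N := fun j => (scale j ^ 8)%N)
  (w := fun j => expR (ln (scale j ^ 8)%:R `^ beta)) _ _ _ B).
- move=> j; apply: (@leq_trans (2 ^ j)); first exact: ltn_expl.
  apply: (@leq_trans (scale j)); first by apply/ltnW/ltn_expl.
  by rewrite -[leqLHS]expn1 leq_pexp2l.
- by move=> j; rewrite -expR0 ler_expR powR_ge0.
- move=> j s sgt sN; rewrite ler_expR; apply: ge0_ler_powR => //.
  + by rewrite nnegrE ln_ge0 // ler1n.
  + by rewrite nnegrE ln_ge0 // ler1n expn_gt0 s0.
  + by rewrite ler_ln ?posrE ?ltr0n ?expn_gt0 ?s0 // ler_nat ltnW.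
move=> j; apply: Ht; first by rewrite Pr_ge0 ?Pr_le1 //; apply: (cyl_big G).
by move=> n0s; apply: (tail _ _ _ _ U).
Qed.

Lemma cluster_isolated {V : countType} (nbr : V -> seq V) (om : Edge nbr -> bool) v0 v :
  connected_graph nbr -> nbr v0 = [::] -> Defs.cluster om v = [set v].
Proof.
move=> conn n0.
have all0 u : u = v0.
  by have [[|y s] [/= H <-]] := conn v0 u => //; case: H; rewrite /adj n0.
by apply/seteqP; split=> w _ /=; [rewrite (all0 w) (all0 v)|exists [::]; rewrite (all0 w) (all0 v)].
Qed.

Theorem theorem4p1 (R : realType) (gamma c eps beta : R) (r M : nat) :
  1 / 2 < gamma -> 0 < c -> 0 < eps ->
  0 <= beta -> beta < (2 * gamma - 1) / gamma ->
  exists K : R,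
  forall (V : countType) (nbr : V -> seq V) (O : seq V) (mu : V -> R),
    simple_graph nbr -> connected_graph nbr -> max_degree_le nbr M ->
    quasi_transitive nbr -> unimodular nbr ->
    orbit_transversal nbr O -> mtp_measure nbr O mu ->
    HK nbr gamma c -> QT nbr O mu r eps ->
  forall (p : R), 0 <= p -> p <= p_c nbr ->
  forall (d : measure_display) (Omega : measurableType d)
    (P : probability Omega R) (omega : Omega -> Edge nbr -> bool),
    bernoulli_perc p P omega ->
  forall v : V,
    (\int[P]_x exp_log_pow beta (cluster_size (omega x) v) <= K%:E)%E.
Proof.
move=> g2 c0 eps0 beta0 bth.
have [K HK'] := exponential_moment M r g2 c0 eps0 beta0 bth.
(* [expR 1] serves the one-vertex graph, where the logarithm of the cluster size is 0 and its power
   [beta] is 1 or 0 according to whether [beta = 0]. *)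
exists (Num.max K (expR 1)) => V nbr O mu G conn dM _ _ [_ [orb _]] mtp hk qt p p0 ppc d Omega P omega B v.
have [dpos|/existsNP[v0 nv0]] := pselect (forall x, (0 < size (nbr x))%N).
  have M0 : (0 < M)%N by apply: leq_trans (dpos v) (dM v).
  have g1 := HK_le1 v G dM M0 dpos c0 hk.
  apply: (@le_trans _ _ K%:E); last by rewrite lee_fin le_max lexx.
  have U := UWG G dpos dM orb mtp hk qt.
  exact: (HK' g1 M0 _ _ _ _ U p p0 ppc _ _ _ _ B v).
have n0 : nbr v0 = [::] by apply: size0nil; move/negP: nv0; rewrite lt0n negbK => /eqP.
apply: (@le_trans _ _ (expR 1)%:E); last by rewrite lee_fin le_max lexx orbT.
rewrite -[leRHS]mule1 -(probability_setT P).
rewrite -[leRHS](integral_cst P measurableT).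
apply: integral_le_pointwise => x.
  by rewrite /exp_log_pow; case: cluster_size => // y; rewrite lee_fin expR_ge0.
rewrite /cluster_size (cluster_isolated _ _ conn n0) asboolT ?finite_set1 // fset_set1 finmap.cardfs1 /=.
rewrite ln1 lee_fin ler_expR.
have [->|be] := eqVneq beta 0; first by rewrite powRr0.
by rewrite powR0.
Qed.
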